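(* Let $b$ be a prime. There are constants $C_{\alpha,\lambda}>0$, defined for integers $\alpha\ge2$ and reals $1/\alpha<\lambda\le1$ and depending only on $\alpha$ and $\lambda$ (and on the fixed base $b$), such that the following holds. Let $\alpha\ge2$ and $s\ge1$ be integers, let $\boldsymbol{\gamma}=(\gamma_u)_{u\subseteq\{1,\ldots,s\}}$ be a set of non-negative weights, and let $H_{\alpha,\boldsymbol{\gamma}}$ be the weighted Sobolev space of smoothness $\alpha$. Let $m,n\in\mathbb{N}$ with $n\ge m$ and let $p\in\mathbb{Z}_b[x]$ be irreducible with $\deg(p)=n$. Then there exists a generating vector $\boldsymbol{q}^*=(q_1^*,\ldots,q_s^* )\in(\mathbb{Z}_b[x])^s$ with $\deg(q_j^* )<n$ for all $j$ which satisfies $$e^{\mathrm{wor}}\bigl(H_{\alpha,\boldsymbol{\gamma}};\pi(\mathcal{P}_{b\text{-}\mathrm{ant}}(p,\boldsymbol{q}^* ))\bigr)\le\frac{1}{b^{\min(m/\lambda,2n)}}\left[\sum_{\emptyset\ne u\subseteq\{1,\ldots,s\}}\gamma_u^{\lambda/2}C_{\alpha,\lambda}^{|u|}\right]^{1/\lambda}$$ for any $1/\alpha<\lambda\le1$, where $\mathcal{P}_{b\text{-}\mathrm{ant}}(p,\boldsymbol{q}^* )$ is the $b$-adic antithetic sampling of the higher order polynomial lattice point set $\mathcal{P}(p,\boldsymbol{q}^* )$ (with parameters $m,n$).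
   Context: Notation: $\mathbb{N}=\{1,2,\ldots\}$. $\mathbb{Z}_b$ is the field of integers modulo the prime $b$, identified with $\{0,\ldots,b-1\}$. $G=\prod_{i\ge1}\mathbb{Z}_b$ is the infinite direct product group with componentwise addition $\oplus$ modulo $b$ (also on $G^s$). Projection: $\pi:G\to[0,1]$, $\pi(\zeta_1,\zeta_2,\ldots)=\sum_{i\ge1}\zeta_ib^{-i}$, applied componentwise to $G^s$. All point sets are finite and counted with multiplicity (indexed families/multisets). Digital net: given $C_1,\ldots,C_s\in\mathbb{Z}_b^{\mathbb{N}\times m}$ (infinitely many rows, $m$ columns), for $0\le h<b^m$ with $h=\eta_0+\cdots+\eta_{m-1}b^{m-1}$, $\eta_i\in\{0,\ldots,b-1\}$, let $\boldsymbol{z}_h=(z_{h,1},\ldots,z_{h,s})\in G^s$ with $z_{h,j}^{\top}=C_j(\eta_0,\ldots,\eta_{m-1})^{\top}$ over $\mathbb{Z}_b$. The digital net over $\mathbb{Z}_b$ in $G^s$ with generating matrices $C_1,\ldots,C_s$ is $\{\boldsymbol{z}_0,\ldots,\boldsymbol{z}_{b^m-1}\}$. Higher order polynomial lattice point set: for $m\le n$, $p\in\mathbb{Z}_b[x]$ with $\deg(p)=n$ and $\boldsymbol{q}=(q_1,\ldots,q_s)\in(\mathbb{Z}_b[x])^s$ with $\deg(q_j)<n$ (the zero polynomial is allowed), expand $q_j(x)/p(x)=\sum_{l=1}^\infty t_l^{(j)}x^{-l}$ in the field $\mathbb{Z}_b((x^{-1}))$ of formal Laurent series. $\mathcal{P}(p,\boldsymbol{q})$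 is the digital net over $\mathbb{Z}_b$ in $G^s$ with generating matrices $C_j=(c^{(j)}_{l,r})\in\mathbb{Z}_b^{\mathbb{N}\times m}$, where $c^{(j)}_{l,r}=t^{(j)}_{l+r-1}$ if $l\le n$ and $c^{(j)}_{l,r}=0$ otherwise. It has $b^m$ points. $b$-adic antithetic sampling: for $l\in\mathbb{Z}_b$ let $e_l=(l,l,\ldots)\in G$ and $\boldsymbol{e}_l=(e_l,\ldots,e_l)\in G^s$. For a finite $\mathcal{P}\subset G^s$, $\mathcal{P}_{b\text{-}\mathrm{ant}}=\bigcup_{l\in\mathbb{Z}_b}\{\boldsymbol{z}\oplus\boldsymbol{e}_l:\boldsymbol{z}\in\mathcal{P}\}$, with multiplicity, so $|\mathcal{P}_{b\text{-}\mathrm{ant}}|=b|\mathcal{P}|$. Weighted Sobolev space: $H_{\alpha,\boldsymbol{\gamma}}$ is the reproducing kernel Hilbert space of real-valued functions on $[0,1]^s$ with reproducing kernel $$K_{\alpha,\boldsymbol{\gamma}}(\boldsymbol{x},\boldsymbol{y})=\sum_{u\subseteq\{1,\ldots,s\}}\gamma_u\prod_{j\in u}\left\{\sum_{r=1}^{\alpha}\frac{\mathcal{B}_r(x_j)\mathcal{B}_r(y_j)}{(r!)^2}+(-1)^{\alpha+1}\frac{\mathcal{B}_{2\alpha}(|x_j-y_j|)}{(2\alpha)!}\right\},$$ where $\mathcal{B}_r$ is the Bernoulli polynomial of degree $r$ and the empty product is $1$. Its inner product is $$\langle f,g\rangle=\sum_{u\subseteq\{1,\ldots,s\}}\gamma_u^{-1}\sum_{v\subseteq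 u}\sum_{\boldsymbol{r}_{u\setminus v}\in\{1,\ldots,\alpha-1\}^{|u\setminus v|}}\int_{[0,1]^{|v|}}\left(\int_{[0,1]^{s-|v|}}f^{(\boldsymbol{r}_{u\setminus v},\boldsymbol{\alpha}_v,\boldsymbol{0})}(\boldsymbol{x})\,d\boldsymbol{x}_{\{1,\ldots,s\}\setminus v}\right)\left(\int_{[0,1]^{s-|v|}}g^{(\boldsymbol{r}_{u\setminus v},\boldsymbol{\alpha}_v,\boldsymbol{0})}(\boldsymbol{x})\,d\boldsymbol{x}_{\{1,\ldots,s\}\setminus v}\right)d\boldsymbol{x}_v,$$ where $(\boldsymbol{r}_{u\setminus v},\boldsymbol{\alpha}_v,\boldsymbol{0})$ is the multi-index of partial derivatives whose $j$-th entry is $r_j$ if $j\in u\setminus v$, $\alpha$ if $j\in v$, and $0$ otherwise, $\boldsymbol{x}_v=(x_j)_{j\in v}$, and $0/0=0$. Worst-case error: with $I(f)=\int_{[0,1]^s}f(\boldsymbol{x})\,d\boldsymbol{x}$ and $I(f;P)=\frac1{|P|}\sum_{\boldsymbol{x}\in P}f(\boldsymbol{x})$ (with multiplicity), $e^{\mathrm{wor}}(H;P)=\sup_{f\in H,\ \|f\|_H\le1}|I(f;P)-I(f)|$. *)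

(* Defs.v *)
From HB Require Import structures.
From mathcomp Require Import all_boot all_order all_algebra.
From mathcomp Require Import all_classical all_reals all_analysis.
From mathcomp Require Import zify.

Set Implicit Arguments.
Unset Strict Implicit.
Unset Printing Implicit Defensive.

Import Order.TTheory GRing.Theory Num.Theory.
Import numFieldNormedType.Exports.

Local Open Scope classical_set_scope.
Local Open Scope ring_scope.

Section Laurent.
Variable F : fieldType.

(* Elements of the field F((x^-1)) are coded as functions sending e to the
   coefficient of x^e, vanishing for all large e; the sum defining their Cauchy
   product is then finitely supported. *)
Definition is_laurent (u : int -> F) :=
  exists N : int, forall e : int, N < e -> u e = 0.

Definition laurent_mul (u v : int -> F) : int -> F :=
  fun e => \sum_(i \in [set: int]) u i * v (e - i).

Definition laurent_of_poly (p : {poly F}) : int -> F :=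
  fun e => if e is Posz k then p`_k else 0.

(* The quotient q / p in F((x^-1)).  For p != 0 the choice is never void and
   unambiguous: see laurent_divP and laurent_div_unique. *)
Definition laurent_div (q p : {poly F}) : int -> F :=
  xget (fun=> 0) [set u : int -> F | is_laurent u /\
    laurent_mul (laurent_of_poly p) u = laurent_of_poly q].

Lemma laurent_mul_polyE p u e :
  laurent_mul (laurent_of_poly p) u e = \sum_(i < size p) p`_i * u (e - i%:Z).
Proof.
rewrite /laurent_mul.
transitivity (\sum_(i \in Posz @` `I_(size p)) laurent_of_poly p i * u (e - i)).
  apply/esym/fsbig_widen => //= -[k|k] [_ /= nk]; last by rewrite mul0r.
  rewrite nth_default ?mul0r// leqNgt; apply/negP => kp.
  by apply: nk; exists k.
rewrite fsbig_image; last by move=> i j _ _ [].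
by rewrite -fsbig_ord.
Qed.

Lemma laurent_div_unique p u v : p != 0 -> is_laurent u -> is_laurent v ->
  laurent_mul (laurent_of_poly p) u = laurent_mul (laurent_of_poly p) v ->
  u = v.
Proof.
move=> p0 [M uM] [N vN] uv; apply/funext => e; apply/eqP; apply: contrapT.
move=> /negP uve.
have step (f : int) : u f != v f -> exists2 g : int, f < g & u g != v g.
  move=> uvf; apply: contrapT => ng.
  have {ng}eqg (g : int) : f < g -> u g = v g.
    by move=> fg; apply/eqP; apply: contrapT => /negP ?; apply: ng; exists g.
  have sp : (0 < size p)%N by rewrite size_poly_gt0.
  have := congr1 (fun w => w (f + (size p).-1%:Z)) uv.
  rewrite !laurent_mul_polyE.
  have : size p = (size p).-1.+1 by rewrite prednK.
  set d := (size p).-1 => ->.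
  rewrite !big_ord_recr/= addrK.
  have -> : \sum_(i < d) p`_i * u (f + d%:Z - i%:Z) =
            \sum_(i < d) p`_i * v (f + d%:Z - i%:Z).
    apply: eq_bigr => i _; rewrite eqg// -addrA ltrDl subr_gt0.
    by rewrite ltz_nat.
  move=> /addrI/mulfI H; move/eqP: uvf; apply; apply: H.
  by rewrite -lead_coefE lead_coef_eq0.
have climb (k : nat) : exists2 g : int, e + k%:Z <= g & u g != v g.
  elim: k => [|k [g eg /step[h gh uvh]]]; first by exists e; rewrite ?addr0.
  by exists h => //; rewrite -addn1 PoszD addrA lezD1 (le_lt_trans eg).
have [g eg /eqP] := climb (absz (Num.max M N - e + 1)).
apply; have : Num.max M N < g.
  apply: lt_le_trans eg; rewrite -ltrBlDl (@lt_le_trans _ _ (Num.max M N - e + 1))//.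
    by rewrite ltrDl.
  by rewrite abszE ler_norm.
by rewrite gt_max => /andP[Mg Ng]; rewrite uM// vN.
Qed.

Lemma laurent_divP q p : p != 0 ->
  is_laurent (laurent_div q p) /\
  laurent_mul (laurent_of_poly p) (laurent_div q p) = laurent_of_poly q.
Proof.
move=> p0; apply: (@xgetPex _ (fun=> 0)
  [set u | is_laurent u /\ laurent_mul (laurent_of_poly p) u = laurent_of_poly q]).
pose D N := (q * 'X^N) %/ p.
have DS N k : (D N.+1)`_k.+1 = (D N)`_k.
  rewrite /D exprSr mulrA {1}(divp_eq (q * 'X^N) p) mulrDl.
  rewrite -mulrA (mulrC p) mulrA divpD mulpK// coefD coefMX/=.
  rewrite [X in _ + X]nth_default ?addr0//.
  rewrite size_divp//.
  set r := (q * 'X^N) %% p; have : (size (r * 'X)%R <= size p)%N.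
    have [->|r0] := eqVneq r 0; first by rewrite mul0r size_poly0.
    by rewrite size_mulX// ltn_modp.
  have sp : (0 < size p)%N by rewrite size_poly_gt0.
  move=> hx; rewrite leq_subLR (leq_trans hx)//.
  by rewrite -[leqLHS](prednK sp) -addn1 leq_add2l.
have DD N M k : (D (N + M)%N)`_(k + M) = (D N)`_k.
  by elim: M => [|M IH]; rewrite ?addn0// !addnS DS.
pose T (e : int) : F := if e is Posz k then (D 0%N)`_k else (D `|e|%N)`_0.
have TE (e : int) (N k : nat) : e + N%:Z = k%:Z -> T e = (D N)`_k.
  case: e => [j|j] /= H.
    have -> : k = (j + N)%N by case: H.
    by rewrite -{1}(add0n N) DD.
  have -> : N = (j.+1 + k)%N by move: H; rewrite NegzE; lia.
  by rewrite -{2}(add0n k) DD.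
exists T; split.
  exists (size (D 0%N))%:Z => -[k|k]//= sk.
  by rewrite nth_default// ltnW.
apply/funext => e; rewrite laurent_mul_polyE.
pose N := (`|e| + size p)%N.
have [k ek kp] : exists2 k : nat, e + N%:Z = k%:Z & (size p <= k)%N.
  by exists (absz (e + N%:Z)); rewrite /N; lia.
transitivity (\sum_(i < size p) p`_i * (D N)`_(k - i)).
  apply: eq_bigr => i _; congr (_ * _); apply: TE.
  have := ltn_ord i; move: ek kp; lia.
have -> : \sum_(i < size p) p`_i * (D N)`_(k - i) = (p * D N)`_k.
  rewrite coefM.
  rewrite (big_ord_widen k.+1 (fun i => p`_i * (D N)`_(k - i)) (leqW kp)).
  rewrite big_mkcond/=; apply: eq_bigr => i _.
  by case: ltnP => // pi; rewrite nth_default ?mul0r.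
have := congr1 (fun w : {poly F} => w`_k) (divp_eq (q * 'X^N) p).
rewrite coefD [X in _ = _ + X]nth_default ?addr0; last first.
  by rewrite (leq_trans _ kp)// ltnW// ltn_modp.
rewrite (mulrC p) => <-; rewrite coefMXn.
move: ek; rewrite {}/N; case: e => [j|j] /= ek.
  have -> : k = (j + (j + size p))%N by case: ek.
  by rewrite ltnNge leq_addl/= addnK.
by rewrite ifT//; move: ek; rewrite NegzE; lia.
Qed.

End Laurent.

Section DigitalNet.
Variables (b m s : nat).

(* Sequences are indexed from 0: z i is the digit with index i + 1 of an element
   z of G, and row l, column r of a generating matrix carry the 1-based indices
   l + 1, r + 1. *)
Definition digitseq := nat -> 'F_b.

Definition net_point (C : 'I_s -> nat -> 'I_m -> 'F_b) (h : nat) :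
    'I_s -> digitseq :=
  fun j l => \sum_(r < m) C j l r * ((h %/ b ^ r) %% b)%:R.

Definition digital_net (C : 'I_s -> nat -> 'I_m -> 'F_b) :
    seq ('I_s -> digitseq) :=
  [seq net_point C h | h <- iota 0 (b ^ m)].

Definition ho_poly_matrix (n : nat) (p q : {poly 'F_b}) (l : nat) (r : 'I_m) :
    'F_b :=
  if (l < n)%N then laurent_div q p (- (l + r).+1%:Z) else 0.

Definition ho_poly_lattice (n : nat) (p : {poly 'F_b})
    (q : 'I_s -> {poly 'F_b}) : seq ('I_s -> digitseq) :=
  digital_net (fun j => ho_poly_matrix n p (q j)).

Definition antithetic (P : seq ('I_s -> digitseq)) : seq ('I_s -> digitseq) :=
  [seq (fun j i => z j i + l) | l <- enum 'F_b, z <- P].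

End DigitalNet.

Section Projection.
Variables (R : realType) (b s : nat).

(* An element of 'F_b coerces to its representative in {0, ..., b - 1}. *)
Definition digit_proj (z : digitseq b) : R :=
  limn (series (fun i => (z i : nat)%:R / b%:R ^+ i.+1 : R)).

Definition net_proj (z : 'I_s -> digitseq b) : s.-tuple R :=
  [tuple digit_proj (z j) | j < s].

End Projection.

Section Cube.
Variables (R : realType).

Definition in_cube s (x : s.-tuple R) : bool :=
  [forall j, 0 <= tnth x j <= 1].

Definition cube s := {x : s.-tuple R | in_cube x}.

Definition cube_extend s (f : cube s -> R) (x : s.-tuple R) : R :=
  oapp f 0 (insub x).

Definition pair_tuple s (x : measurableTypeR R * s.-tuple (measurableTypeR R)) :
    s.+1.-tuple (measurableTypeR R) :=
  [tuple of x.1 :: x.2].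

Lemma measurable_pair_tuple s : measurable_fun setT (@pair_tuple s).
Proof. exact: measurable_cons. Qed.

HB.instance Definition _ s :=
  isMeasurableFun.Build _ _ _ _ (@pair_tuple s) (@measurable_pair_tuple s).

(* Lebesgue measure on [0, 1]^s, as a measure on all of R^s: the s-fold product
   of the one-dimensional Lebesgue measure restricted to [0, 1]. *)
Fixpoint cube_measure s : probability (s.-tuple (measurableTypeR R)) R :=
  if s is s'.+1 then
    distribution (uniform_prob (@ltr01 R) \x cube_measure s')%E (@pair_tuple s')
  else \d_ [tuple].

Definition cube_int s (f : cube s -> R) : R :=
  \int[cube_measure s]_x cube_extend f x.

(* Points are listed with multiplicity. *)
Definition cube_qmc s (P : seq (s.-tuple R)) (f : cube s -> R) : R :=
  (\sum_(x <- P) cube_extend f x) / (size P)%:R.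

(* The points of a projected net lie in the domain of integration, so that
   [cube_qmc] only evaluates f there. *)
Lemma net_proj_in_cube b s (z : 'I_s -> digitseq b) :
  prime b -> in_cube (net_proj R z).
Proof.
move=> pb; apply/forallP => j; rewrite tnth_mktuple /digit_proj.
set f := (X in series X).
have b0 : (0 : R) < b%:R by rewrite ltr0n prime_gt0.
have f0 i : 0 <= f i by rewrite /f divr_ge0// exprn_ge0// ltW.
have fle n : series f n <= 1 - b%:R ^- n.
  elim: n => [|n IH]; first by rewrite /series/= big_geq// expr0 invr1 subrr.
  have zb : (z j n : nat)%:R + 1 <= b%:R :> R.
    by rewrite natr1 ler_nat (leq_trans (ltn_ord _))// Fp_cast.
  set c := b%:R ^- n.+1; have c0 : 0 <= c by rewrite invr_ge0 exprn_ge0// ltW.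
  have bc : b%:R ^- n = b%:R * c.
    by rewrite /c exprS invfM mulrA divff ?mul1r// gt_eqF.
  have zc : (z j n : nat)%:R * c + c <= b%:R * c.
    by rewrite -[X in _ + X]mul1r -mulrDl; exact: ler_wpM2r.
  rewrite seriesSr (_ : f n = (z j n : nat)%:R * c)//.
  by rewrite lerBrDr -addrA (le_trans (lerD IH zc))// bc subrK.
have f1 n : series f n <= 1.
  by rewrite (le_trans (fle n))// lerBlDr lerDl invr_ge0 exprn_ge0// ltW.
have cf : cvgn (series f).
  apply: nondecreasing_is_cvgn; first exact/nondecreasing_series.
  by exists 1 => _ [n _ <-].
apply/andP; split.
  by apply: limr_ge => //; apply: nearW => n; apply: sumr_ge0.
by apply: limr_le => //; apply: nearW.
Qed.

End Cube.

Section RKHS.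
Variables (R : realType) (X : Type).

(* The Hilbert space of functions on X with reproducing kernel K.  By the
   Moore-Aronszajn theorem it is determined by K: rkhs_dom is unique, and so is
   rkhs_dot on rkhs_dom. *)
Record rkhs (K : X -> X -> R) := RKHS {
  rkhs_dom : set (X -> R);
  rkhs_dot : (X -> R) -> (X -> R) -> R;
  rkhs_norm := fun f => Num.sqrt (rkhs_dot f f);
  rkhs_dom0 : rkhs_dom 0;
  rkhs_domP : forall a f g, rkhs_dom f -> rkhs_dom g -> rkhs_dom (a *: f + g);
  rkhs_dotC : forall f g, rkhs_dom f -> rkhs_dom g ->
    rkhs_dot f g = rkhs_dot g f;
  rkhs_dotP : forall a f g h, rkhs_dom f -> rkhs_dom g -> rkhs_dom h ->
    rkhs_dot (a *: f + g) h = a * rkhs_dot f h + rkhs_dot g h;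
  rkhs_dot_gt0 : forall f, rkhs_dom f -> f <> 0 -> 0 < rkhs_dot f f;
  rkhs_complete : forall u : nat -> X -> R, (forall k, rkhs_dom (u k)) ->
    (forall e : R, 0 < e -> exists N, forall i j, (N <= i)%N -> (N <= j)%N ->
      rkhs_norm (u i - u j) < e) ->
    exists2 f, rkhs_dom f & (fun k => rkhs_norm (u k - f)) @ \oo --> (0 : R);
  rkhs_kernel : forall y, rkhs_dom (K^~ y);
  rkhs_reproducing : forall f y, rkhs_dom f -> rkhs_dot f (K^~ y) = f y
}.

End RKHS.

(* Valued in the extended reals, so that an unbounded error is +oo rather than a
   default value. *)
Definition worst_case_error (R : realType) s (K : cube R s -> cube R s -> R)
    (H : rkhs K) (P : seq (s.-tuple R)) : \bar R :=
  ereal_sup [set `|cube_qmc P f - cube_int f|%:E |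
    f in [set f | rkhs_dom H f /\ rkhs_norm H f <= 1]].

Section SobolevKernel.
Variable R : realType.

(* The Bernoulli numbers B_0, ..., B_(n-1), from
   \sum_(k < n.+1) 'C(n.+1, k) B_k = (n == 0). *)
Fixpoint bernoulli_seq (n : nat) : seq R :=
  if n is n'.+1 then
    let B := bernoulli_seq n' in
    rcons B (((n' == 0)%:R - \sum_(k < n') 'C(n'.+1, k)%:R * B`_k) / n'.+1%:R)
  else [::].

Definition bernoulli_num (n : nat) : R := (bernoulli_seq n.+1)`_n.

Definition bernoulli_poly (n : nat) : {poly R} :=
  \sum_(k < n.+1) ('C(n, k)%:R * bernoulli_num k) *: 'X^(n - k).

Definition sobolev_kernel (alpha s : nat) (gamma : {set 'I_s} -> R)
    (x y : cube R s) : R :=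
  \sum_(u : {set 'I_s}) gamma u * \prod_(j in u)
    (let xj := tnth (val x) j in
     let yj := tnth (val y) j in
     (\sum_(1 <= r < alpha.+1)
       (bernoulli_poly r).[xj] * (bernoulli_poly r).[yj] / (r`!%:R ^+ 2))
     + (-1) ^+ alpha.+1 * (bernoulli_poly (2 * alpha)).[`|xj - yj|]
         / (2 * alpha)`!%:R).

End SobolevKernel.

(* Main.v *)
(** Functions of the reproducing kernel Hilbert space are continuous, so the
    integration error of f is the limit over N of the error obtained by
    truncating the points to N digits and replacing the integral by the average
    over the grid of mesh b^-N.  The truncated error is bounded by a quadratic
    form of the kernel on the finite group (F_b^N)^s, in whose Walsh expansion
    only the non-zero vectors k of the dual net occur.  The univariate kernel is
    a polynomial plus a multiple of |x - y|^(2 alpha - 1), because the odd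
    Bernoulli numbers after the first one vanish.  Each non-zero digit of a
    Walsh index acts as a difference operator, so its coefficients are
    O(r(k) r(l)), where r(k) = b^-(sum of the alpha largest positions of
    non-zero digits of k).  Constant terms need not be separated: the estimate
    with r(0) = 1 only inflates the constants C^#|u|.

    Antithetic sampling restricts the dual net to vectors whose digits sum to
    zero.  If the first n digits of all components of such a k <> 0 vanish, then
    k has two non-zero digits at positions beyond n, which gives a factor
    b^(-2n).  Otherwise k lies in the dual net of q for at most a fraction b^-m
    of all q.  Some q minimises the resulting bound for infinitely many N;
    raising the bound to the power lambda (which is subadditive) and averaging
    over q estimates the minimum for all lambda at once. *)

Require Import Defs.
From HB Require Import structures.
From mathcomp Require Import all_boot all_order all_algebra.
From mathcomp Require Import all_classical all_reals all_analysis.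
From mathcomp Require Import measurable_realfun complex ring lra zify.
Import ComplexField.Normc.

Set Implicit Arguments.
Unset Strict Implicit.
Unset Printing Implicit Defensive.

Import Order.TTheory GRing.Theory Num.Theory.
Import numFieldNormedType.Exports.

Local Open Scope classical_set_scope.
Local Open Scope ring_scope.

(** * Walsh coefficients on digit vectors *)

(** The coefficients of the kernel are bounded by r(k) r(l) for all pairs of indices, so the double
    sum over the dual net is at most the square of a simple sum, and the error is linear in r. Hence
    the weights enter as gamma^(1/2), and lambda > 1/alpha is what makes the sum of r^lambda
    converge.

    At each level only indices of N digits occur, and no infinite Walsh series has to converge; the
    price is that every constant must be uniform in N.

    The cusp of the kernel is one order too rough: its differences are under control up to order 2
    alpha - 1, whereas r(k) r(l) asks for 2 alpha. The missing factor comes from the support of the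
    last difference near the diagonal x = y, where few points of the grid lie. *)

Section AdditiveCharacter.
Variables (R : realType) (b : nat).

Definition add_char (psi : 'F_b -> R[i]) :=
  [/\ forall x y, psi (x + y) = psi x * psi y,
      forall x, normc (psi x) = 1 &
      forall c, c != 0 -> \sum_x psi (c * x) = 0].

(** A root w of 1 + X + ... + X^(b-1) is a b-th root of unity other than 1, because b <> 0 in
    [R[i]]; so w^x depends only on x modulo b. *)
Lemma exists_add_char : prime b -> exists psi, add_char psi.
Proof.
move=> pb; have b1 := prime_gt1 pb; have b0 := prime_gt0 pb.
pose P : {poly R[i]} := \poly_(i < b) 1.
have /closed_rootP[w] : size P != 1%N by rewrite size_poly_eq ?oner_eq0// gtn_eqF.
rewrite /root horner_poly => /eqP Pw.
have {Pw}Sw : \sum_(i < b) w ^+ i = 0.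
  by rewrite -[RHS]Pw; apply: eq_bigr => i _; rewrite mul1r.
have wb : w ^+ b = 1 by apply/eqP; rewrite -subr_eq0 subrX1 Sw mulr0.
have w1 : w != 1.
  apply/eqP => w1; move: Sw; rewrite w1.
  under eq_bigr do rewrite expr1n.
  by rewrite sumr_const card_ord => /eqP; rewrite pnatr_eq0 gtn_eqF.
pose psi (x : 'F_b) := w ^+ x; exists psi.
have psiD x y : psi (x + y) = psi x * psi y.
  rewrite /psi -exprD.
  have -> : ((x + y)%R : nat) = ((x + y) %% b)%N :> nat.
    by rewrite /=; congr (_ %% _)%N; exact: Fp_cast.
  by rewrite [in RHS](divn_eq (x + y) b) exprD mulnC exprM wb expr1n mul1r.
have nX n : normc (w ^+ n) = normc w ^+ n.
  by elim: n => [|n IH]; rewrite ?expr0 ?normc1// !exprS normcM IH.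
have n0 : 0 <= normc w by case: w {Sw wb w1 psi psiD nX} => ? ?; rewrite sqrtr_ge0.
split=> // [x|c c0].
  rewrite nX (_ : normc w = 1) ?expr1n//.
  have := nX b; rewrite wb normc1 => /esym/eqP.
  by rewrite pexpr_eq1// => /eqP.
have psi1 : psi 1 != 1 by rewrite /psi /= modn_small ?Fp_cast// expr1.
(* The translation by c^-1 permutes the summands and multiplies each of them by [psi 1]. *)
have : (psi 1 - 1) * \sum_x psi (c * x) = 0.
  rewrite mulrBl mul1r mulr_sumr; apply/eqP; rewrite subr_eq0; apply/eqP.
  rewrite [RHS](reindex_inj (addIr c^-1)); apply: eq_bigr => x _.
  by rewrite mulrDr divff// psiD mulrC.
by move/eqP; rewrite mulf_eq0 subr_eq0 (negbTE psi1) => /eqP.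
Qed.

End AdditiveCharacter.

Section NormC.
Variable R : realType.
Implicit Types (z : R[i]) (r : R).

Lemma normc_nneg z : 0 <= normc z.
Proof. by case: z => ? ?; rewrite sqrtr_ge0. Qed.

Lemma normc_real r : normc r%:C%C = `|r|.
Proof. by rewrite /normc/= expr0n addr0 sqrtr_sqr. Qed.

Lemma normc_sum (I : Type) (s : seq I) (P : pred I) (F : I -> R[i]) :
  normc (\sum_(i <- s | P i) F i) <= \sum_(i <- s | P i) normc (F i).
Proof.
elim/big_ind2 : _ => [|x1 x2 y1 y2 h1 h2|//]; first by rewrite normc0.
by rewrite (le_trans (le_normcD _ _))// lerD.
Qed.

Lemma normc_prod (I : Type) (s : seq I) (P : pred I) (F : I -> R[i]) :
  normc (\prod_(i <- s | P i) F i) = \prod_(i <- s | P i) normc (F i).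
Proof. by elim/big_ind2 : _ => [|x1 x2 y1 y2 <- <-|//]; rewrite ?normc1 ?normcM. Qed.

End NormC.

Section Tuples.
Variables (T : finType).

Lemma big_tupleS (V : nmodType) n (Phi : n.+1.-tuple T -> V) :
  \sum_t Phi t = \sum_(t : n.-tuple T) \sum_d Phi [tuple of d :: t].
Proof.
rewrite pair_bigA/=.
rewrite (reindex (fun p : n.-tuple T * T => [tuple of p.2 :: p.1]))//=.
exists (fun t : n.+1.-tuple T => ([tuple of behead t], thead t)) => [[t d] _|t _] /=.
  by congr pair; apply: val_inj.
by apply: val_inj => /=; case/tupleP: t => d t.
Qed.

Lemma big_tuple0 (V : nmodType) (Phi : 0.-tuple T -> V) :
  \sum_t Phi t = Phi [tuple].
Proof.
rewrite (bigD1 [tuple])//= big1 ?addr0// => t.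
by rewrite (tuple0 t) => /eqP.
Qed.

End Tuples.

Section Walsh.
Variables (R : realType) (b : nat) (b_prime : prime b).
Variables (psi : 'F_b -> R[i]) (psi_char : add_char psi).
Local Notation F := 'F_b.

(** psi (dot k x) is the k-th Walsh function at x: the digit of x of weight b^-i meets the digit of
    k of weight b^(i - 1), so the head of k is its leading digit. *)
Fixpoint dot (k x : seq F) : F :=
  match k, x with c :: k', d :: x' => c * d + dot k' x' | _, _ => 0 end.

Lemma dotC k x : dot k x = dot x k.
Proof. by elim: k x => [|c k IH] [|d x]//=; rewrite IH mulrC. Qed.

Lemma psiD x y : psi (x + y) = psi x * psi y.
Proof. by case: psi_char. Qed.

Lemma psi_norm x : normc (psi x) = 1.
Proof. by case: psi_char. Qed.

Lemma psi0 : psi 0 = 1.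
Proof.
have p0 : psi 0 != 0.
  by apply/eqP => p0; have /eqP := psi_norm 0; rewrite p0 normc0 eq_sym oner_eq0.
by apply: (mulfI p0); rewrite -psiD addr0 mulr1.
Qed.

Lemma psi_sum (I : Type) (s : seq I) (P : pred I) (f : I -> F) :
  psi (\sum_(i <- s | P i) f i) = \prod_(i <- s | P i) psi (f i).
Proof. exact: (big_morph psi psiD psi0). Qed.

Lemma sum_psi c : \sum_x psi (x * c) = if c == 0 then b%:R else 0.
Proof.
case: eqP => [->|/eqP c0].
  under eq_bigr do rewrite mulr0 psi0.
  by rewrite sumr_const card_Fp.
by case: psi_char => _ _ /(_ c c0) {2}<-; apply: eq_bigr => x _; rewrite mulrC.
Qed.

Lemma sum_psi_dot n (x y : n.-tuple F) :
  \sum_(k : n.-tuple F) psi (dot k x - dot k y) = (if x == y then b ^ n else 0)%N%:R.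
Proof.
elim: n x y => [|n IH] x y.
  by rewrite big_tuple0/= subrr psi0 [x]tuple0 [y]tuple0 eqxx.
case/tupleP: x => x0 x; case/tupleP: y => y0 y.
rewrite big_tupleS/=.
under eq_bigr => k _.
  under eq_bigr => d _.
    rewrite (_ : _ - _ = d * (x0 - y0) + (dot k x - dot k y)); last by ring.
    rewrite psiD; over.
  rewrite -mulr_suml sum_psi; over.
rewrite -mulr_sumr IH subr_eq0.
have -> : ([tuple of x0 :: x] == [tuple of y0 :: y]) = (x0 == y0) && (x == y) by [].
by case: (x0 == y0); case: (x == y); rewrite ?mulr0 ?mul0r//= -natrM expnS.
Qed.

(** Both characters carry the same sign, without conjugation in y: a quadratic form then contains
    the product of two transforms of one real weight, of which only absolute values are used. *)
Definition wcoef2 n (f : n.-tuple F -> n.-tuple F -> R[i]) (k l : n.-tuple F) : R[i] :=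
  (\sum_(x : n.-tuple F) \sum_(y : n.-tuple F) psi (- (dot k x + dot l y)) * f x y) / (b ^ n)%:R ^+ 2.

Lemma wcoef2_inv n (f : n.-tuple F -> n.-tuple F -> R[i]) x y :
  f x y = \sum_(k : n.-tuple F) \sum_(l : n.-tuple F) wcoef2 f k l * psi (dot k x + dot l y).
Proof.
have bn0 : (b ^ n)%:R != 0 :> R[i] by rewrite pnatr_eq0 expn_eq0 gtn_eqF// prime_gt0.
transitivity (\sum_x' \sum_y' f x' y' * (\sum_(k : n.-tuple F) psi (dot k x - dot k x')) *
    (\sum_(l : n.-tuple F) psi (dot l y - dot l y')) / (b ^ n)%:R ^+ 2).
  rewrite (bigD1 x)//= (bigD1 y)//= !sum_psi_dot !eqxx.
  rewrite [X in _ + X + _]big1 ?addr0; last first.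
    by move=> y' ny; rewrite !sum_psi_dot eq_sym (negbTE ny) mulr0 mul0r.
  rewrite [X in _ + X]big1 ?addr0; last first.
    move=> x' nx; rewrite big1// => y' _.
    by rewrite !sum_psi_dot eq_sym (negbTE nx) mulr0 !mul0r.
  by rewrite -(mulrA (f x y)) -expr2 mulfK ?expf_neq0.
under [RHS]eq_bigr => k _.
  under eq_bigr => l _.
    rewrite /wcoef2 mulrAC mulr_suml mulr_suml.
    under eq_bigr => x' _ do rewrite !mulr_suml.
    over.
  rewrite exchange_big/=; over.
rewrite [RHS]exchange_big/=; apply: eq_bigr => x' _.
under [RHS]eq_bigr => k _ do rewrite exchange_big/=.
rewrite [RHS]exchange_big/=; apply: eq_bigr => y' _.
rewrite mulrAC [X in X * _]mulrAC -mulrA mulr_suml mulr_sumr; apply: eq_bigr => k _.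
rewrite mulrA mulr_sumr; apply: eq_bigr => l _.
rewrite (_ : dot k x + dot l y = (dot k x - dot k x') + (dot l y - dot l y')
  + (dot k x' + dot l y')); last by ring.
set d := dot k x' + dot l y'; set u := dot k x - _; set v := dot l y - _.
rewrite (psiD (u + v)) (psiD u) -[LHS]mulr1 -psi0 -(addNr d) (psiD (- d)).
by ring.
Qed.

End Walsh.

Section Digits.
Variables (R : realType) (b : nat) (b_prime : prime b).
Local Notation F := 'F_b.

Lemma base_gt0 : 0 < b%:R :> R. Proof. by rewrite ltr0n prime_gt0. Qed.
Lemma base_ge1 : 1 <= b%:R :> R. Proof. by rewrite ler1n prime_gt0. Qed.

Lemma digit_lt (d : F) : (d < b)%N.
Proof. by rewrite (leq_trans (ltn_ord d))// Fp_cast. Qed.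

Lemma digit_le (d : F) : (d : nat)%:R <= b%:R - 1 :> R.
Proof. by rewrite lerBrDr natr1 ler_nat digit_lt. Qed.

(* Digit lists start with the least significant digit: the head of a list of
   size N is the digit of weight b^-N in rval. *)
Fixpoint nval (t : seq F) : nat := if t is d :: t' then (d + b * nval t')%N else 0.

Fixpoint rval (t : seq F) : R :=
  if t is d :: t' then (d : nat)%:R * b%:R ^- (size t').+1 + rval t' else 0.

Lemma nval_lt t : (nval t < b ^ size t)%N.
Proof.
elim: t => [|d t IH]; rewrite ?expn0//= expnS.
have db := digit_lt d; apply: (@leq_trans (b * (nval t).+1)%N).
  by rewrite mulnS ltn_add2r.
by rewrite leq_mul2l IH orbT.
Qed.

Lemma nval_inj t u : size t = size u -> nval t = nval u -> t = u.
Proof.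
have b0 := prime_gt0 b_prime.
elim: t u => [|d t IH] [|e u]//= [stu] h.
have de : d = e.
  apply: val_inj => /=; have := congr1 (modn^~ b) h.
  by rewrite /= (mulnC b) (mulnC b (nval u)) addnC modnMDl addnC modnMDl !modn_small ?digit_lt.
rewrite de in h *; congr cons; apply: IH => //.
by move/addnI: h => /eqP; rewrite eqn_pmul2l// => /eqP.
Qed.

Lemma rval_nval t : rval t = (nval t)%:R * b%:R ^- size t.
Proof.
have b0 := lt0r_neq0 base_gt0.
elim: t => [|d t IH]/=; first by rewrite mul0r.
rewrite IH natrD natrM mulrDl; congr (_ + _).
by rewrite exprS invfM [b%:R * _]mulrC -mulrA mulVKf.
Qed.

Lemma rval_ge0 t : 0 <= rval t.
Proof. by rewrite rval_nval mulr_ge0// invr_ge0 exprn_ge0// ltW// base_gt0. Qed.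

Lemma rval_le1 t : rval t <= 1.
Proof.
rewrite rval_nval ler_pdivrMr ?exprn_gt0 ?base_gt0// mul1r -natrX ler_nat ltnW//.
exact: nval_lt.
Qed.

(** The numerators over b^n are integers at distance less than 2. This counts the grid points near
    the diagonal. *)
Lemma card_rval_near n (y : n.-tuple F) :
  (#|[pred x : n.-tuple F | (`|rval x - rval y| < 2 * b%:R ^- n)%R]| <= 3)%N.
Proof.
set A := [pred x | _]; rewrite cardE.
rewrite -(size_map (nval \o val)).
(* For c = 0 the list repeats 0; only its length matters. *)
pose c := nval y; apply: (@leq_trans (size [:: c.-1; c; c.+1])) => //.
apply: uniq_leq_size.
  rewrite map_inj_in_uniq ?enum_uniq// => t u _ _ /= h.
  by apply/val_inj/nval_inj; rewrite ?size_tuple.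
move=> m /mapP[t]; rewrite mem_enum inE => h ->.
have {}h : `|(nval t)%:R - c%:R| < 2 :> R.
  move: h; rewrite !rval_nval !size_tuple -mulrBl normrM [X in _ * X]ger0_norm.
    by rewrite ltr_pM2r// invr_gt0 exprn_gt0// base_gt0.
  by rewrite invr_ge0 exprn_ge0// ltW// base_gt0.
rewrite -[X in X \in _]/(nval t); move: (nval t) h => v h.
have h1 : (v <= c.+1)%N.
  rewrite -ltnS -(ltr_nat R) -(addn2 c) natrD -ltrBlDl.
  by rewrite (le_lt_trans (ler_norm _)).
have h2 : (c <= v.+1)%N.
  rewrite -ltnS -(ltr_nat R) -(addn2 v) natrD -ltrBlDl.
  by rewrite (le_lt_trans (ler_norm _))// distrC.
by rewrite !inE /=; lia.
Qed.

(* b^-(a_1 + ... + a_beta), where a_1 > ... > a_beta are the largest positions of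
   non-zero digits of k (all of them if there are fewer than beta). *)
Fixpoint dw (beta : nat) (k : seq F) : R :=
  if k is c :: k' then
    if (c != 0) && (0 < beta)%N then b%:R ^- (size k').+1 * dw beta.-1 k'
    else dw beta k'
  else 1.

Lemma dw_ge0 beta k : 0 <= dw beta k.
Proof.
elim: k beta => [|c k IH] beta//=; case: ifP => // _.
by rewrite mulr_ge0// invr_ge0 exprn_ge0// ltW// base_gt0.
Qed.

Lemma dw0 k : dw 0 k = 1.
Proof. by elim: k => [|c k IH]//=; rewrite andbF. Qed.

End Digits.

(** * Differences and decay of Walsh coefficients *)

Section Differences.
Variable R : realType.

Fixpoint diffs (V : zmodType) (hs : seq R) (f : R -> V) : R -> V :=
  if hs is h :: hs' then fun x => diffs hs' f (x + h) - diffs hs' f x else f.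

Definition mass (hs : seq R) := \sum_(h <- hs) `|h|.

(** A discrete C^j bound on [-B, B]; [mass] keeps all evaluation points in the interval. Differences
    commute with the finite averages [twist] and also make sense for the cusp. *)
Definition diff_bounded j (M B : R) (f : R -> R[i]) :=
  0 <= M /\ forall hs x, (size hs <= j)%N -> `|x| + mass hs <= B ->
    normc (diffs hs f x) <= M * \prod_(h <- hs) `|h|.

Lemma mass_cons h hs : mass (h :: hs) = `|h| + mass hs.
Proof. by rewrite /mass big_cons. Qed.

Lemma diff_bounded_at j M B f x :
  diff_bounded j M B f -> `|x| <= B -> normc (f x) <= M.
Proof.
move=> [_ fM] xB; have := fM [::] x (leq0n _).
by rewrite /mass !big_nil addr0 mulr1; exact.
Qed.

End Differences.

Section Twist.
Variables (R : realType) (b : nat) (b_prime : prime b).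
Variables (psi : 'F_b -> R[i]) (psi_char : add_char psi).
Local Notation F := 'F_b.

(* The effect on f of summing the least significant digit out of a Walsh
   coefficient; for c <> 0 the weights psi (d * c) sum to zero, which makes it a
   combination of differences of f. *)
Definition twist (c : F) (h : R) (f : R -> R[i]) (x : R) : R[i] :=
  (\sum_(d : F) psi (d * c) * f (x + (d : nat)%:R * h)) / b%:R.

Let bR0 : b%:R != 0 :> R.
Proof. exact/lt0r_neq0/base_gt0. Qed.

Lemma normc_nat n : normc (n%:R : R[i]) = n%:R.
Proof. by rewrite -(rmorph_nat (real_complex R)) normc_real ger0_norm. Qed.

Lemma normc_avg (a : F -> F) (v : F -> R[i]) m :
  (forall d, normc (v d) <= m) ->
  normc ((\sum_d psi (a d) * v d) / b%:R) <= m.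
Proof.
move=> vm; rewrite normcM normcV normc_nat ler_pdivrMr ?base_gt0//.
rewrite (le_trans (normc_sum _ _ _))//.
apply: (@le_trans _ _ (\sum_(d : F) m)).
  by apply: ler_sum => d _; rewrite normcM psi_norm ?mul1r.
by rewrite sumr_const card_Fp// mulr_natr.
Qed.

Lemma diffs_twist hs c h f x :
  diffs hs (twist c h f) x = twist c h (diffs hs f) x.
Proof.
elim: hs x => [//|h' hs IH] x /=.
rewrite !IH /twist -mulrBl -sumrB; congr (_ / _); apply: eq_bigr => d _.
by rewrite mulrBr addrAC.
Qed.

Lemma twist_diff c h f x : c != 0 -> twist c h f x =
  (\sum_(d : F) psi (d * c) * (f (x + (d : nat)%:R * h) - f x)) / b%:R.
Proof.
move=> c0; congr (_ / _).
under [RHS]eq_bigr do rewrite mulrBr.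
by rewrite sumrB -mulr_suml (sum_psi b_prime psi_char) (negbTE c0) mul0r subr0.
Qed.

Lemma digit_step (d : F) (h : R) : `|(d : nat)%:R * h| <= (b%:R - 1) * `|h|.
Proof. by rewrite normrM ger0_norm// ler_wpM2r// digit_le. Qed.

Lemma digit_step1 (d : F) (h : R) : `|(d : nat)%:R * h| <= b%:R * `|h|.
Proof. by rewrite (le_trans (digit_step _ _))// ler_wpM2r// lerBlDr lerDl. Qed.

Lemma diff_bounded_twist c h j M B f : diff_bounded j M B f ->
  diff_bounded j M (B - (b%:R - 1) * `|h|) (twist c h f).
Proof.
move=> [M0 fM]; split=> // hs x sz xB; rewrite diffs_twist.
apply: normc_avg => d; apply: fM => //.
have := ler_normD x ((d : nat)%:R * h); have := digit_step d h; lra.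
Qed.

(** For c <> 0 a twist averages differences of step d * h, and each such step joins the list: one
    order is spent and a factor b * |h| gained. *)
Lemma diff_bounded_twist1 c h j M B f : c != 0 -> diff_bounded j.+1 M B f ->
  diff_bounded j (M * (b%:R * `|h|)) (B - (b%:R - 1) * `|h|) (twist c h f).
Proof.
move=> c0 [M0 fM]; split=> [|hs x sz xB].
  by rewrite !mulr_ge0.
rewrite diffs_twist twist_diff//; apply: normc_avg => d.
rewrite (le_trans (fM ((d : nat)%:R * h :: hs) x _ _))//.
  by rewrite mass_cons; have := digit_step d h; lra.
by rewrite big_cons -mulrA ler_wpM2l// ler_wpM2r ?prodr_ge0// digit_step1.
Qed.

Definition wcoef1 n (f : R -> R[i]) (k : n.-tuple F) : R[i] :=
  (\sum_(x : n.-tuple F) psi (- dot k x) * f (rval R x)) / (b ^ n)%:R.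

Lemma wcoef1S n f c (k : n.-tuple F) :
  wcoef1 f [tuple of c :: k] = wcoef1 (twist (- c) (b%:R ^- n.+1) f) k.
Proof.
rewrite /wcoef1 big_tupleS/= expnS natrM invfM mulrA mulr_suml.
congr (_ / _); apply: eq_bigr => x _.
rewrite mulrA mulr_sumr; congr (_ / _); apply: eq_bigr => d _.
rewrite mulrA -psiD//; congr (psi _ * f _).
  by rewrite opprD mulrN addrC mulrC.
by rewrite size_tuple addrC.
Qed.

Definition wcoef_diff n (f : R -> R[i]) (k l : n.-tuple F) : R[i] :=
  wcoef2 psi (fun x y : n.-tuple F => f (rval R x - rval R y)) k l.

Lemma wcoef_diffS n f c e (k l : n.-tuple F) :
  wcoef_diff f [tuple of c :: k] [tuple of e :: l] =
  wcoef_diff (twist (- c) (b%:R ^- n.+1) (twist (- e) (- b%:R ^- n.+1) f)) k l.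
Proof.
rewrite /wcoef_diff /wcoef2 big_tupleS/=.
under eq_bigr => x _.
  under eq_bigr => d _ do rewrite big_tupleS/=.
  rewrite exchange_big/=; over.
rewrite expnS natrM exprMn invfM mulrA mulr_suml; congr (_ / _).
apply: eq_bigr => x _; rewrite mulr_suml; apply: eq_bigr => y _.
rewrite {1}/twist mulrA mulr_sumr expr2 invfM mulrA; congr (_ / _).
rewrite mulr_suml; apply: eq_bigr => d _.
rewrite /twist !mulrA mulr_sumr; congr (_ / _); apply: eq_bigr => d' _.
rewrite !mulrA -!psiD//; congr (psi _ * f _); first by ring.
by rewrite !size_tuple; ring.
Qed.

Let h_gt0 n : 0 < b%:R ^- n :> R.
Proof. by rewrite invr_gt0 exprn_gt0// base_gt0. Qed.

Let h_S n : b%:R ^- n = b%:R * b%:R ^- n.+1 :> R.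
Proof. by rewrite exprS invfM mulrA divff// mul1r. Qed.

(** Digits are summed out from the least significant one. A non-zero digit spends one order as long
    as j > 0; after that it gains nothing, just as in [dw]. The power of b collects the loss b of
    each order. *)
Lemma wcoef1_le n j M B f (k : n.-tuple F) : diff_bounded j M B f ->
  1 - b%:R ^- n <= B ->
  normc (wcoef1 f k) <= M * b%:R ^+ j * dw R j k.
Proof.
elim: n j M B f k => [|n IH] j M B f k.
  rewrite expr0 invr1 subrr => fM B0; have [M0 _] := fM.
  rewrite [k]tuple0/= mulr1 /wcoef1 big_tuple0/= oppr0 psi0// mul1r expn0 divr1.
  apply: le_trans (diff_bounded_at fM _) _; first by rewrite normr0.
  by rewrite ler_peMr// exprn_ege1// base_ge1.
case/tupleP: k => c k fM nB; rewrite wcoef1S/=.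
(* (b - 1) b^-(n+1) = b^-n - b^-(n+1): the twist shortens the interval by just what the remaining
   digits no longer need. *)
have nB' : 1 - b%:R ^- n <= B - (b%:R - 1) * `|b%:R ^- n.+1 : R|.
  by move: nB; rewrite gtr0_norm// (h_S n); lra.
case: ifP => [/andP[c0 j0]|_]; last first.
  by apply: IH nB'; apply: diff_bounded_twist.
case: j j0 fM => // j _ fM.
have nc0 : - c != 0 by rewrite oppr_eq0.
have /IH := diff_bounded_twist1 (b%:R ^- n.+1) nc0 fM.
move=> /(_ k nB') /le_trans; apply.
rewrite gtr0_norm// size_tuple [in leRHS]exprS le_eqVlt; apply/orP; left; apply/eqP.
by rewrite /=; ring.
Qed.

(* Models |x|^(q - 1): differences of order q vanish at distance L from the cusp,
   but those of order q - 1 are only bounded.  Each non-zero digit lowers q by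
   one and gains a factor eta; at q = 0 no smoothness is left, and the last
   factor eta comes from averaging a function supported in |x| < L over the grid
   (wcoef_diff_supported). *)
Definition cusp_class q (M eta L B : R) (f : R -> R[i]) :=
  [/\ 0 <= M,
      if q is q'.+1 then diff_bounded q' M B f
      else forall x, `|x| <= B -> eta * normc (f x) <= M &
      forall hs x, size hs = q -> L + mass hs <= `|x| -> diffs hs f x = 0].

Lemma cusp_class_twist q M eta L B f c h : 0 <= eta ->
  cusp_class q M eta L B f ->
  cusp_class q M eta (L + (b%:R - 1) * `|h|) (B - (b%:R - 1) * `|h|) (twist c h f).
Proof.
move=> eta0 [M0 fM f0]; split=> //.
  case: q fM f0 => [|q] fM f0; last exact: diff_bounded_twist.
  have [->|eta1] := eqVneq eta 0; first by move=> x; rewrite mul0r.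
  have {}eta0 : 0 < eta by rewrite lt0r eta1.
  move=> x xB; rewrite mulrC -ler_pdivlMr//; apply: normc_avg => d.
  rewrite ler_pdivlMr// mulrC fM//.
  have := ler_normD x ((d : nat)%:R * h); have := digit_step d h; lra.
move=> hs x sz Lx; rewrite diffs_twist /twist big1 ?mul0r// => d _.
rewrite f0 ?mulr0//.
have := lerB_normD x ((d : nat)%:R * h); have := digit_step d h; lra.
Qed.

(** With eta equal to b * |h|, the gain from a difference and the factor demanded in order 0
    coincide. On reaching order 0 the difference gains nothing, and the definition of the class
    supplies the factor. *)
Lemma cusp_class_twist1 q M L B f c h : c != 0 ->
  cusp_class q.+1 M (b%:R * `|h|) L B f ->
  cusp_class q (M * (b%:R * `|h|)) (b%:R * `|h|)
    (L + (b%:R - 1) * `|h|) (B - (b%:R - 1) * `|h|) (twist c h f).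
Proof.
move=> c0 [M0 fM f0]; split; first by rewrite !mulr_ge0.
  case: q fM f0 => [|q] fM f0; last exact: diff_bounded_twist1.
  move=> x xB; rewrite mulrC ler_wpM2r ?mulr_ge0//.
  exact: diff_bounded_at (diff_bounded_twist c h fM) xB.
move=> hs x sz Lx; rewrite diffs_twist twist_diff// big1 ?mul0r// => d _.
have := f0 ((d : nat)%:R * h :: hs) x; rewrite /= sz => -> //; rewrite ?mulr0//.
by rewrite mass_cons; have := digit_step d h; lra.
Qed.

(** For each x at most 3 of the b^n points y contribute, each of them at most M * b^n, so the
    average over y is at most 3 * M. *)
Lemma wcoef_diff_supported n M f (k l : n.-tuple F) : 0 <= M ->
  (forall x, `|x| <= 1 -> b%:R ^- n * normc (f x) <= M) ->
  (forall x, 2 * b%:R ^- n <= `|x| -> f x = 0) ->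
  normc (wcoef_diff f k l) <= 3 * M.
Proof.
move=> M0 fM f0; pose h : R := b%:R ^- n; have h0 : 0 < h by exact: h_gt0.
have bn0 : (0 : R) < (b ^ n)%:R by rewrite ltr0n expn_gt0 prime_gt0.
have hE : h = (b ^ n)%:R^-1 by rewrite /h natrX.
rewrite /wcoef_diff /wcoef2 normcM normcV -natrX normc_nat natrX expr2.
rewrite ler_pdivrMr ?mulr_gt0// (le_trans (normc_sum _ _ _))//.
apply: (@le_trans _ _ (\sum_(x : n.-tuple F) 3 * (M / h))); last first.
  rewrite sumr_const card_tuple card_Fp// -mulr_natr hE invrK.
  by rewrite le_eqVlt; apply/orP; left; apply/eqP; ring.
apply: ler_sum => x _; rewrite (le_trans (normc_sum _ _ _))//.
pose A := [pred y : n.-tuple F | (`|rval R y - rval R x| < 2 * h)%R].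
apply: (@le_trans _ _ (\sum_(y | A y) M / h)).
  rewrite [leRHS]big_mkcond/=; apply: ler_sum => y _.
  rewrite normcM psi_norm// mul1r distrC; case: ltP => [_|xy].
    rewrite ler_pdivlMr// mulrC fM//.
    have := rval_ge0 R b_prime x; have := rval_le1 R b_prime x.
    have := rval_ge0 R b_prime y; have := rval_le1 R b_prime y.
    by rewrite ler_norml; lra.
  by rewrite f0 ?normc0.
rewrite sumr_const -[leLHS]mulr_natl ler_wpM2r ?divr_ge0 ?(ltW h0)//.
by rewrite ler_nat card_rval_near.
Qed.

(** Digits of k and of l act on the same function of x - y, so i + j orders are consumed. In B, 1 is
    for x - y itself and 2 * (1 - b^-n) for the two twists per digit. *)
Lemma wcoef_diff_cusp n i j M B f (k l : n.-tuple F) :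
  cusp_class (i + j) M (b%:R ^- n) (2 * b%:R ^- n) B f ->
  1 + 2 * (1 - b%:R ^- n) <= B ->
  normc (wcoef_diff f k l) <= 3 * M * b%:R ^+ (i + j) * (dw R i k * dw R j l).
Proof.
(* Once all orders are spent the estimate closes immediately, at the level whose mesh is eta; the
   remaining digits are not summed out one by one. *)
have base_case n' i' j' M' B' f' (k' l' : n'.-tuple F) : (i' + j')%N = 0 ->
    cusp_class (i' + j') M' (b%:R ^- n') (2 * b%:R ^- n') B' f' ->
    1 + 2 * (1 - b%:R ^- n') <= B' ->
    normc (wcoef_diff f' k' l') <= 3 * M' * b%:R ^+ (i' + j') * (dw R i' k' * dw R j' l').
  move=> ij; rewrite ij; move/eqP: ij; rewrite addn_eq0 => /andP[/eqP-> /eqP->].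
  move=> [M0 fM f0] nB; rewrite !dw0 expr0 !mulr1; apply: wcoef_diff_supported => //.
    move=> x x1; apply: fM; rewrite (le_trans x1)// (le_trans _ nB)// lerDl.
    by rewrite mulr_ge0// subr_ge0 invf_le1 ?exprn_gt0 ?base_gt0// exprn_ege1// base_ge1.
  by move=> x Lx; have := f0 [::] x erefl; rewrite /mass big_nil addr0 => /(_ Lx).
elim: n i j M B f k l => [|n IH] i j M B f k l; have [ij|] := posnP (i + j).
- exact: base_case.
- case: (i + j)%N => // q _ [M0 fM _]; rewrite expr0 invr1 subrr mulr0 addr0 => B1.
  rewrite [k]tuple0 [l]tuple0/= !mulr1 /wcoef_diff /wcoef2 !big_tuple0/=.
  rewrite addr0 oppr0 psi0// mul1r expn0 expr1n divr1 subrr.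
  apply: le_trans (diff_bounded_at fM _) _; first by rewrite normr0 (le_trans ler01 B1).
  apply: (@le_trans _ _ (3 * M)); first by rewrite ler_peMl// ler1n.
  by rewrite ler_peMr ?mulr_ge0// exprn_ege1// base_ge1.
- exact: base_case.
move=> ij0 fM nB.
case/tupleP: k => c k; case/tupleP: l => e l; rewrite wcoef_diffS.
pose h : R := b%:R ^- n.+1; have h0 : 0 < h by exact: h_gt0.
pose eta := b%:R * h; have etaE : eta = b%:R ^- n by rewrite /eta h_S.
have eta_ge0 : 0 <= eta by rewrite etaE ltW.
(* In positive order the class does not mention eta, which may thus be reset from b^-(n+1) to
   b^-n. *)
have {}fM : cusp_class (i + j) M eta (2 * h) B f.
  by move: ij0 fM; case: (i + j)%N.
have hN : `|- h| = h by rewrite normrN gtr0_norm.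
have hP : `|h| = h by rewrite gtr0_norm.
pose j' := if (e != 0) && (0 < j)%N then j.-1 else j.
pose M' := if (e != 0) && (0 < j)%N then M * eta else M.
have {}fM : cusp_class (i + j') M' eta (2 * h + (b%:R - 1) * h)
    (B - (b%:R - 1) * h) (twist (- e) (- h) f).
  rewrite /j' /M'; case: ifP => [/andP[e0 j0]|_].
    rewrite -[in (b%:R - 1) * h]hN /eta -[in b%:R * h]hN; apply: cusp_class_twist1.
      by rewrite oppr_eq0.
    by rewrite hN -addnS prednK.
  by have := cusp_class_twist (- e) (- h) eta_ge0 fM; rewrite hN.
pose i' := if (c != 0) && (0 < i)%N then i.-1 else i.
pose M'' := if (c != 0) && (0 < i)%N then M' * eta else M'.
have {}fM : cusp_class (i' + j') M'' (b%:R ^- n) (2 * b%:R ^- n)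
    (B - 2 * (b%:R - 1) * h) (twist (- c) h (twist (- e) (- h) f)).
  rewrite -etaE.
  (* The width 2 * b^-n reproduces itself: two twists add 2 * (b - 1) * h to 2 * h. This fixes the
     constant 2. *)
  have -> : 2 * eta = 2 * h + (b%:R - 1) * h + (b%:R - 1) * h by rewrite /eta; ring.
  have -> : B - 2 * (b%:R - 1) * h = B - (b%:R - 1) * h - (b%:R - 1) * h by ring.
  rewrite /i' /M''; case: ifP => [/andP[c0 i0]|_].
    rewrite -[in (b%:R - 1) * h]hP /eta -[in b%:R * h]hP; apply: cusp_class_twist1.
      by rewrite oppr_eq0.
    by rewrite hP -addSn prednK.
  by have := cusp_class_twist (- c) h eta_ge0 fM; rewrite hP.
have {}nB : 1 + 2 * (1 - b%:R ^- n) <= B - 2 * (b%:R - 1) * h.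
  by move: nB; rewrite (h_S n) -/h; lra.
apply: (le_trans (IH _ _ _ _ _ k l fM nB)).
rewrite le_eqVlt; apply/orP; left; apply/eqP.
rewrite /= !size_tuple -/h /M'' /M' /i' /j'.
case: ifP => [/andP[_]|_]; case: ifP => [/andP[_]|_].
- case: i {ij0 fM i' M''} => // i; case: j {j' M'} => // j _ _ /=.
  by rewrite addnS addSn !exprS /eta; ring.
- by case: i {ij0 fM j' i' M' M''} => // i _ /=; rewrite addSn exprS /eta; ring.
- by case: j {ij0 fM j' i' M' M''} => // j _ /=; rewrite addnS exprS /eta; ring.
- by [].
Qed.

End Twist.

(** * Smoothness of polynomials and of the cusp |x| x^m *)

Section RealDifferences.
Variable R : realType.
Implicit Types (F f : R -> R) (hs : seq R) (x : R).

Lemma is_derive_quadratic F x c : (forall h, `|F (x + h) - F x - c * h| <= h ^+ 2) ->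
  is_derive x (1 : R) F c.
Proof.
move=> Fc.
have cv : (fun h : R => h^-1 *: (F (h *: (1 : R) + x) - F x)) @ (0 : R)^' --> c.
  apply/cvgrPdist_le => e e0; near=> h.
  have h0 : h != 0 by near: h; exact: nbhs_dnbhs_neq.
  have he : `|h| <= e.
    by near: h; exact: dnbhs0_le.
  rewrite /= /GRing.scale/= mulr1 distrC (addrC h).
  have -> : h^-1 * (F (x + h) - F x) - c = h^-1 * (F (x + h) - F x - c * h).
    by field.
  rewrite normrM normfV ler_pdivrMl ?normr_gt0// (le_trans (Fc h))//.
  by rewrite -real_normK ?num_real// expr2 ler_wpM2l.
by split; [apply/cvg_ex; exists c | apply: cvg_lim].
Unshelve. all: by end_near. Qed.

Lemma is_derive_diffs F f : (forall x, is_derive x (1 : R) F (f x)) ->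
  forall hs x, is_derive x (1 : R) (diffs hs F) (diffs hs f x).
Proof.
move=> Ff; elim => [//|h hs IH] x /=.
apply: is_deriveB.
have := @is_derive1_comp _ (diffs hs F) (shift h) x _ _ (IH (x + h))
  (is_derive_shift x 1 h).
by rewrite mulr1.
Qed.

(** The mean value theorem for [diffs hs F], whose derivative is [diffs hs f]. As z is within |h| of
    x, |z| + mass hs stays below |x| + mass (h :: hs), and conditions on the domain pass on to f. *)
Lemma diffs_mvt F f : (forall x, is_derive x (1 : R) F (f x)) ->
  forall h hs x, exists2 z, `|z - x| <= `|h| &
    diffs (h :: hs) F x = h * diffs hs f z.
Proof.
move=> Ff h hs x; have dF := is_derive_diffs Ff hs.
have cF : continuous (diffs hs F).
  by move=> y; apply/differentiable_continuous/derivable1_diffP; case: (dF y).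
have seg a b : a <= b ->
    exists2 c, c \in `[a, b] & diffs hs F b - diffs hs F a = diffs hs f c * (b - a).
  by move=> ab; apply: MVT_segment => //; exact: continuous_subspaceT.
have [h0|h0] := leP 0 h.
  have [|z zI /= zE] := seg x (x + h); first by rewrite lerDl.
  exists z; last by rewrite /= zE mulrC addrAC subrr add0r.
  by move: zI; rewrite in_itv/= => /andP[z1 z2]; rewrite !ger0_norm//; lra.
have [|z zI /= zE] := seg (x + h) x; first by rewrite gerDl ltW.
exists z; last by rewrite /= -[LHS]opprB zE; ring.
by move: zI; rewrite in_itv/= => /andP[z1 z2]; rewrite ler0_norm ?ltr0_norm//; lra.
Qed.

Definition rdiff_bounded j M B f :=
  0 <= M /\ forall hs x, (size hs <= j)%N -> `|x| + mass hs <= B ->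
    `|diffs hs f x| <= M * \prod_(h <- hs) `|h|.

Lemma rdiff_bounded0 M B f : 0 <= M ->
  (forall x, `|x| <= B -> `|f x| <= M) -> rdiff_bounded 0 M B f.
Proof.
move=> M0 fM; split=> // -[|//] x _; rewrite /mass !big_nil addr0 mulr1.
exact: fM.
Qed.

Lemma rdiff_bounded_primitive F f j M M' B :
  (forall x, is_derive x (1 : R) F (f x)) -> rdiff_bounded j M B f ->
  (forall x, `|x| <= B -> `|F x| <= M') -> 0 <= M' ->
  rdiff_bounded j.+1 (M + M') B F.
Proof.
move=> Ff [M0 fM] FM M'0; split=> [|[|h hs] x]; first exact: addr_ge0.
  rewrite /mass !big_nil addr0 mulr1 => _ /FM /le_trans; apply.
  by rewrite lerDr.
rewrite ltnS mass_cons big_cons => sz xB.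
have [z zx ->] := diffs_mvt Ff h hs x.
rewrite normrM mulrCA ler_wpM2l//.
apply: (@le_trans _ _ (M * \prod_(h <- hs) `|h|)); last first.
  by rewrite ler_wpM2r ?prodr_ge0// lerDl.
apply: fM => //; have := ler_normD (z - x) x; rewrite subrK; lra.
Qed.

Lemma rdiff_bounded_complex j M B f : rdiff_bounded j M B f ->
  diff_bounded j M B (fun x => (f x)%:C%C).
Proof.
move=> [M0 fM]; split=> // hs x sz xB.
suff -> : diffs hs (fun x => (f x)%:C%C) x = (diffs hs f x)%:C%C.
  by rewrite normc_real fM.
by elim: hs x {sz xB} => [//|h hs IH] x /=; rewrite !IH rmorphB.
Qed.

Lemma rdiff_bounded_poly j B (p : {poly R}) :
  exists M, rdiff_bounded j M B (horner p).
Proof.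
have bnd (q : {poly R}) : exists2 M, 0 <= M & forall x, `|x| <= B -> `|q.[x]| <= M.
  exists (\sum_(i < size q) `|q`_i| * `|B| ^+ i).
    by apply: sumr_ge0 => i _; rewrite mulr_ge0// exprn_ge0.
  move=> x xB; rewrite horner_coef (le_trans (ler_norm_sum _ _ _))//.
  apply: ler_sum => i _; rewrite normrM normrX ler_wpM2l//.
  by rewrite lerXn2r ?nnegrE// (le_trans xB)// ler_norm.
elim: j p => [|j IH] p; have [M' M'0 pM] := bnd p.
  by exists M'; exact: rdiff_bounded0.
have [M dpM] := IH p^`(); exists (M + M').
exact: rdiff_bounded_primitive (is_derive_poly p) dpM pM M'0.
Qed.

(** For even m this is |x|^(m + 1). The product form makes the family closed under differentiation,
    whatever the parity of m. *)
Definition cusp m : R -> R := fun x => `|x| * x ^+ m.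

Lemma is_derive_cusp m x :
  is_derive x (1 : R) (cusp m.+1) (m.+2%:R * cusp m x).
Proof.
elim: m => [|m IH].
  apply: is_derive_quadratic => h; rewrite /cusp !expr1 expr0 mulr1.
  have sqn (y : R) : 0 <= y -> `|y| = y by exact: ger0_norm.
  have [x0|x0] := leP 0 x; have [h0|h0] := leP 0 (x + h);
    rewrite ?(ger0_norm x0) ?(ger0_norm h0) ?(ltr0_norm x0) ?(ltr0_norm h0);
    rewrite ler_norml; apply/andP; split; nra.
have -> : cusp m.+2 = id * cusp m.+1.
  by apply/funext => y; rewrite /cusp !fctE exprS mulrCA.
apply: is_derive_eq; rewrite /cusp /GRing.scale/= exprS -[m.+3%:R]natr1.
by rewrite mulr1; ring.
Qed.

Lemma rdiff_bounded_cusp m B : exists M, rdiff_bounded m.+1 M B (cusp m).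
Proof.
have bnd i : forall x, `|x| <= B -> `|cusp i x| <= `|B| ^+ i.+1.
  move=> x xB; rewrite /cusp normrM normr_id normrX -exprS.
  by rewrite lerXn2r ?nnegrE// (le_trans xB)// ler_norm.
elim: m => [|m [M IH]].
  exists (1 + `|B| ^+ 1); split=> [|[|h [|//]] x _]; first by rewrite addr_ge0.
    rewrite /mass !big_nil addr0 mulr1 => /bnd /le_trans; apply.
    by rewrite lerDr.
  move=> _; rewrite big_seq1/= /cusp !expr0 !mulr1 (le_trans (ler_dist_dist _ _))//.
  by rewrite addrAC subrr add0r ler_peMl// lerDl.
have [M0 fM] := IH.
exists (m.+2%:R * M + `|B| ^+ m.+2).
apply: (rdiff_bounded_primitive (is_derive_cusp m)) (bnd m.+1) _ => //.
  split=> [|hs x sz xB]; first by rewrite mulr_ge0.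
  have -> : diffs hs (fun x => m.+2%:R * cusp m x) x = m.+2%:R * diffs hs (cusp m) x.
    by elim: hs x {sz xB} => //= h hs IHs x; rewrite !IHs mulrBr.
  by rewrite normrM ger0_norm// -mulrA ler_wpM2l// fM.
Qed.

(** On either side of 0 the cusp is a polynomial of degree m + 1, and steps of total length at most
    |x| do not cross 0. The mean value theorem lowers m and the number of steps together, down to
    |x| itself. *)
Lemma diffs_cusp_eq0 m hs x : size hs = m.+2 -> mass hs <= `|x| ->
  diffs hs (cusp m) x = 0.
Proof.
elim: m hs x => [|m IH] [//|h hs] x.
  case: hs => [//|h' [|//]] _; rewrite /mass !big_cons big_nil addr0 => hx.
  rewrite /= /cusp !expr0 !mulr1.
  have := ler_norm h; have := ler_norm (- h); have := ler_norm h'.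
  have := ler_norm (- h'); rewrite !normrN.
  have [x0|x0] := leP 0 x; move: hx.
    by rewrite (ger0_norm x0) => *; rewrite !ger0_norm; lra.
  by rewrite (ltr0_norm x0) => *; rewrite !ler0_norm; lra.
move=> [sz]; rewrite mass_cons => hx.
have [z zx ->] := diffs_mvt (is_derive_cusp m) h hs x.
have -> : diffs hs (fun x => m.+2%:R * cusp m x) z = m.+2%:R * diffs hs (cusp m) z.
  by elim: hs z {sz hx zx} => //= h' hs IHs z; rewrite !IHs mulrBr.
rewrite IH ?mulr0//.
have := ler_normD (x - z) z; rewrite subrK distrC; lra.
Qed.

End RealDifferences.

(** * Bernoulli numbers and the Sobolev kernel *)

Section Bernoulli.
Variable R : realType.
Local Notation B := (@bernoulli_num R).

Lemma size_bernoulli_seq n : size (bernoulli_seq R n) = n.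
Proof. by elim: n => //= n IH; rewrite size_rcons IH. Qed.

Lemma nth_bernoulli_seq n k : (k < n)%N -> (bernoulli_seq R n)`_k = B k.
Proof.
elim: n => [//|n IH]; rewrite ltnS leq_eqVlt => /orP[/eqP->//|kn].
by rewrite /= nth_rcons size_bernoulli_seq kn IH.
Qed.

Lemma bernoulli_rec n :
  \sum_(k < n.+1) 'C(n.+1, k)%:R * B k = (n == 0)%:R.
Proof.
rewrite big_ord_recr/= {2}/bernoulli_num/= nth_rcons size_bernoulli_seq ltnn eqxx.
rewrite binSn mulrC divfK ?pnatr_eq0//.
under [X in X + _]eq_bigr => k _ do rewrite -(nth_bernoulli_seq (ltn_ord k)).
by rewrite addrC subrK.
Qed.

(** In terms of Bernoulli polynomials: B_n(1) = B_n(0) except for n = 1. *)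
Lemma bernoulli_sum n :
  \sum_(k < n.+1) 'C(n, k)%:R * B k = B n + (n == 1)%:R.
Proof.
rewrite big_ord_recr/= binn mul1r addrC; congr (_ + _).
by case: n => [|n]; rewrite ?big_ord0// bernoulli_rec.
Qed.

(** Both sides count the pairs of disjoint subsets of sizes j and k; with truncated subtraction they
    still vanish together when j + k > n. *)
Lemma mul_bin_trinomial n j k : ('C(n, j) * 'C(n - j, k) = 'C(n, k) * 'C(n - k, j))%N.
Proof.
have out i l : (n < i + l)%N -> ('C(n, i) * 'C(n - i, l))%N = 0%N.
  move=> il; have [ni|ni] := ltnP n i; first by rewrite bin_small ?mul0n.
  by rewrite (@bin_small (n - i)) ?muln0//; lia.
have [jk|jk] := leqP (j + k) n; last by rewrite !out// addnC.
have f0 i : (0 < i`!)%N by exact: fact_gt0.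
have E1 : ('C(n, j) * 'C(n - j, k) * (j`! * k`! * (n - j - k)`!) = n`!)%N.
  rewrite -[RHS](@bin_fact n j); last by lia.
  by rewrite -[in RHS](@bin_fact (n - j) k); [ring|lia].
have E2 : ('C(n, k) * 'C(n - k, j) * (j`! * k`! * (n - j - k)`!) = n`!)%N.
  rewrite -[RHS](@bin_fact n k); last by lia.
  rewrite -[in RHS](@bin_fact (n - k) j); last by lia.
  by rewrite (_ : n - j - k = n - k - j)%N; [ring|lia].
by apply/eqP; rewrite -(@eqn_pmul2r (j`! * k`! * (n - j - k)`!)) ?muln_gt0 ?f0// E1 E2.
Qed.

(** The companion of [bernoulli_rec] with alternating signs: in the difference of the two, only odd
    indices remain. *)
Lemma bernoulli_altsum n : (0 < n)%N ->
  \sum_(k < n) 'C(n, k)%:R * ((-1) ^+ k * B k) = n%:R.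
Proof.
move=> n0.
have alt i : \sum_(j < i.+1) (-1) ^+ j * 'C(i, j)%:R = (i == 0)%:R :> R.
  transitivity ((1 - 1 : R) ^+ i); last by rewrite subrr expr0n.
  rewrite exprBn; apply: eq_bigr => j _.
  by rewrite !expr1n !mulr1 mulr_natr.
(* Both orders of summation of S are evaluated: umbrally, (B + 1 - 1)^n. *)
pose S := \sum_(j < n.+1) \sum_(k < n.+1)
  (-1) ^+ j * ('C(n, j) * 'C(n - j, k))%:R * B k.
have widen i (G : nat -> R) : (i <= n)%N ->
    \sum_(k < n.+1) 'C(i, k)%:R * G k = \sum_(k < i.+1) 'C(i, k)%:R * G k.
  move=> iN; have iN' : (i.+1 <= n.+1)%N by [].
  rewrite (big_ord_widen _ (fun k => 'C(i, k)%:R * G k) iN') [RHS]big_mkcond/=.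
  apply: eq_bigr => k _; case: ifP => // /negbT; rewrite -leqNgt => ik.
  by rewrite bin_small// mul0r.
(* Summing over j first leaves (1 - 1)^(n - k), so only k = n survives. *)
have S1 : S = B n.
  have inner k : (k <= n)%N ->
      \sum_(j < n.+1) (-1) ^+ j * ('C(n, j) * 'C(n - j, k))%:R * B k =
      'C(n, k)%:R * B k * (n - k == 0)%N%:R.
    move=> kn; rewrite -alt.
    transitivity ('C(n, k)%:R * B k * \sum_(j < n.+1) 'C(n - k, j)%:R * (-1) ^+ j).
      rewrite mulr_sumr; apply: eq_bigr => j _.
      by rewrite mul_bin_trinomial natrM; ring.
    rewrite (widen _ (fun j => (-1) ^+ j)) ?leq_subr//.
    by congr (_ * _); apply: eq_bigr => j _; rewrite mulrC.
  rewrite /S exchange_big/= (bigD1 ord_max)//= [X in _ + X]big1 ?addr0.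
    by rewrite inner// subnn binn eqxx mul1r mulr1.
  move=> k kn; rewrite inner; last by rewrite -ltnS.
  have kltn : (k < n)%N.
    by rewrite ltn_neqAle -ltnS ltn_ord andbT; move: kn; rewrite -val_eqE.
  by rewrite subn_eq0 leqNgt kltn mulr0.
(* Summing over k first gives [bernoulli_sum], whose exceptional term occurs at j = n - 1 and
   produces n. *)
have S2 : S = (-1) ^+ n * (\sum_(k < n.+1) 'C(n, k)%:R * ((-1) ^+ k * B k) - n%:R).
  rewrite mulrBr mulr_sumr [in RHS](reindex_inj rev_ord_inj)/=.
  have -> : - ((-1) ^+ n * n%:R) = \sum_(j < n.+1) (-1) ^+ j * 'C(n, j)%:R * (n - j == 1)%N%:R :> R.
    rewrite (bigD1 (inord n.-1))//= inordK; last by lia.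
    rewrite (_ : n - n.-1 = 1)%N ?eqxx; last by lia.
    rewrite mulr1 big1 ?addr0; last first.
      move=> j jn; case: eqP => [jE|]; last by rewrite mulr0.
      by case/eqP: jn; apply/val_inj; rewrite /= inordK; lia.
    case: n n0 {S S1 widen} => // i _ /=.
    by rewrite binSn exprS mulN1r mulNr opprK.
  rewrite -big_split/=; apply: eq_bigr => j _.
  have jn : (j <= n)%N by rewrite -ltnS.
  transitivity ((-1) ^+ j * 'C(n, j)%:R * (\sum_(k < n.+1) 'C(n - j, k)%:R * B k)).
    by rewrite mulr_sumr; apply: eq_bigr => k _; rewrite natrM !mulrA.
  rewrite widen ?leq_subr// bernoulli_sum mulrDr; congr (_ + _).
  have sg : (-1) ^+ j = (-1) ^+ n * (-1) ^+ (n - j) :> R.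
    transitivity ((-1) ^+ (n - j + j) * (-1) ^+ (n - j) :> R); last by rewrite subnK.
    by rewrite exprD mulrAC -exprD addnn -mul2n exprM sqrrN !expr1n mul1r.
  by rewrite subSS bin_sub// sg; ring.
move: S1; rewrite S2 big_ord_recr/= binn mul1r => /(congr1 (fun x => (-1) ^+ n * x)).
rewrite mulrA -exprD addnn -mul2n exprM sqrrN expr1n expr1n mul1r.
by move/eqP; rewrite addrAC -subr_eq0 addrK subr_eq0 => /eqP.
Qed.

Lemma bernoulli_odd k : odd k -> k != 1%N -> B k = 0.
Proof.
elim/ltn_ind: k => k IH ok k1.
have k3 : (3 <= k)%N by case: k ok k1 {IH} => [|[|[|]]].
have := bernoulli_altsum (ltn0Sn k); have := bernoulli_rec k.
rewrite [in X in X -> _](_ : (k == 0%N) = false); last by lia.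
move=> E1 E2.
have B1 : B 1 = - 2^-1.
  have := bernoulli_rec 1; rewrite !big_ord_recl big_ord0/= addr0 bin0 bin1.
  have := bernoulli_rec 0; rewrite big_ord1 bin0 mul1r => ->.
  by rewrite /=; lra.
(* Even indices cancel, odd ones strictly between 1 and k vanish by induction, and the term of index
   1 is k + 1, the whole right-hand side. *)
have : \sum_(i < k.+1) ('C(k.+1, i)%:R * ((-1) ^+ i * B i) - 'C(k.+1, i)%:R * B i) =
   k.+1%:R by rewrite sumrB E1 E2 subr0.
rewrite (bigD1 ord_max)//= (bigD1 (inord 1))/=; last first.
  by rewrite -val_eqE /= inordK; lia.
rewrite inordK; last by lia.
rewrite big1 ?addr0 => [|i /andP[ik i1]].
  rewrite bin1 B1 binSn -signr_odd ok ?expr1 /= ?expr1 => E.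
  have {E} : k.+1%:R * B k = 0 by lra.
  by move/eqP; rewrite mulf_eq0 pnatr_eq0 => /eqP.
have [oi|ei] := boolP (odd i).
  have -> : B i = 0.
    apply: IH => //; first by rewrite ltn_neqAle -ltnS ltn_ord andbT; move: ik; rewrite -val_eqE.
    by apply/eqP => i1'; case/eqP: i1; apply/val_inj; rewrite /= inordK; lia.
  by rewrite !mulr0 subrr.
by rewrite -signr_odd (negbTE ei) expr0 mul1r subrr.
Qed.

(** In degree 2a every power t^(2a - k) with B_k <> 0 is even and does not see the sign of t, except
    for k = 1; that one is the cusp. *)
Lemma bernoulli_poly_norm a : (0 < a)%N -> exists (q : {poly R}) (c : R),
  forall t : R, (bernoulli_poly R (2 * a)).[`|t|] = q.[t] + c * cusp (2 * a).-2 t.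
Proof.
move=> a0; pose one : 'I_(2 * a).+1 := inord 1.
have oneE : one = 1%N :> nat by rewrite inordK //; lia.
exists (\sum_(k < (2 * a).+1 | k != one) ('C(2 * a, k)%:R * B k) *: 'X^(2 * a - k)).
exists ('C(2 * a, 1)%:R * B 1) => t.
rewrite /bernoulli_poly !horner_sum (bigD1 one)//= addrC; congr (_ + _).
  apply: eq_bigr => k k1; rewrite !hornerZ !hornerXn.
  have [ok|ek] := boolP (odd k).
    rewrite (bernoulli_odd ok) ?mulr0 ?mul0r//.
    by apply: contraNneq k1 => k1; apply/eqP/val_inj; rewrite /= oneE.
  have e2 : ~~ odd (2 * a - k) by rewrite oddB ?oddM//= -ltnS.
  by rewrite -normrX ger0_norm// exprn_even_ge0.
rewrite hornerZ hornerXn oneE /cusp; congr (_ * _).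
have e2 : ~~ odd (2 * a).-2 by rewrite (_ : (2 * a).-2 = 2 * a.-1)%N ?oddM//; lia.
rewrite (_ : 2 * a - 1 = (2 * a).-2.+1)%N; last by lia.
by rewrite exprS -normrX (ger0_norm (exprn_even_ge0 _ e2)).
Qed.

End Bernoulli.

(** * Walsh decay of the one-dimensional kernel *)

Section SobolevWalsh.
Variables (R : realType) (b : nat) (b_prime : prime b).
Variables (psi : 'F_b -> R[i]) (psi_char : add_char psi).
Local Notation F := 'F_b.

(** M precedes n: the number of digits will tend to infinity with the constant fixed. *)
Definition walsh_decay alpha (phi : R -> R -> R) := exists2 M : R, 0 <= M &
  forall n (k l : n.-tuple F),
    normc (wcoef2 psi (fun x y : n.-tuple F => (phi (rval R x) (rval R y))%:C%C) k l)
      <= M * (dw R alpha k * dw R alpha l).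

Lemma eq_walsh_decay alpha phi phi' : (forall x y, phi x y = phi' x y) ->
  walsh_decay alpha phi -> walsh_decay alpha phi'.
Proof. by move=> e; have -> : phi = phi' by apply/funext => x; apply/funext => y. Qed.

Lemma walsh_decay0 alpha : walsh_decay alpha (fun _ _ => 0).
Proof.
exists 0 => // n k l; rewrite mul0r /wcoef2 big1 ?mul0r ?normc0// => x _.
by rewrite big1// => y _; rewrite mulr0.
Qed.

Lemma walsh_decayD alpha phi phi' : walsh_decay alpha phi -> walsh_decay alpha phi' ->
  walsh_decay alpha (fun x y => phi x y + phi' x y).
Proof.
move=> [M M0 hM] [M' M'0 hM']; exists (M + M'); first exact: addr_ge0.
move=> n k l; rewrite mulrDl.
apply: le_trans (lerD (hM n k l) (hM' n k l)).
apply: le_trans (le_normcD _ _); rewrite /wcoef2 -mulrDl -big_split/=.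
rewrite le_eqVlt; apply/orP; left; apply/eqP; congr (normc (_ / _)).
apply: eq_bigr => x _; rewrite -big_split/=; apply: eq_bigr => y _.
by rewrite rmorphD mulrDr.
Qed.

Lemma walsh_decayZ alpha c phi : walsh_decay alpha phi ->
  walsh_decay alpha (fun x y => c * phi x y).
Proof.
move=> [M M0 hM]; exists (`|c| * M); first exact: mulr_ge0.
move=> n k l; rewrite -mulrA; apply: le_trans (ler_wpM2l (normr_ge0 c) (hM n k l)).
rewrite -normc_real -normcM le_eqVlt; apply/orP; left; apply/eqP; congr normc.
rewrite /wcoef2 mulrA mulr_sumr; congr (_ / _).
apply: eq_bigr => x _; rewrite mulr_sumr; apply: eq_bigr => y _.
by rewrite rmorphM mulrCA.
Qed.

Lemma walsh_decay_sum alpha (I : Type) (s : seq I) (P : pred I) (phi : I -> R -> R -> R) :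
  (forall i, walsh_decay alpha (phi i)) ->
  walsh_decay alpha (fun x y => \sum_(i <- s | P i) phi i x y).
Proof.
move=> h; elim: s => [|i s IH].
  by apply: eq_walsh_decay (walsh_decay0 alpha) => x y; rewrite big_nil.
have [Pi|Pi] := boolP (P i).
  by apply: eq_walsh_decay (walsh_decayD (h i) IH) => x y; rewrite big_cons Pi.
by apply: eq_walsh_decay IH => x y; rewrite big_cons (negbTE Pi).
Qed.

Lemma walsh_decay_poly alpha (p q : {poly R}) :
  walsh_decay alpha (fun x y => p.[x] * q.[y]).
Proof.
have [Mp pM] := rdiff_bounded_poly alpha 1 p.
have [Mq qM] := rdiff_bounded_poly alpha 1 q.
have [Mp0 _] := pM; have [Mq0 _] := qM.
have ba : 0 <= b%:R ^+ alpha :> R by rewrite exprn_ge0.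
exists ((Mp * b%:R ^+ alpha) * (Mq * b%:R ^+ alpha)); first by rewrite !mulr_ge0.
move=> n k l; pose f (r : {poly R}) := fun x => (r.[x])%:C%C.
have -> : wcoef2 psi (fun x y : n.-tuple F => (p.[rval R x] * q.[rval R y])%:C%C) k l =
    wcoef1 psi (f p) k * wcoef1 psi (f q) l.
  rewrite /wcoef2 /wcoef1 mulrACA -invfM -expr2; congr (_ / _).
  rewrite mulr_suml; apply: eq_bigr => x _; rewrite mulr_sumr; apply: eq_bigr => y _.
  by rewrite opprD (psiD psi_char) rmorphM/= /f; ring.
have n1 : 1 - b%:R ^- n <= 1 :> R by rewrite gerDl oppr_le0 invr_ge0 exprn_ge0.
rewrite normcM mulrACA ler_pM ?normc_nneg//.
  exact: (wcoef1_le b_prime psi_char k (rdiff_bounded_complex pM) n1).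
exact: (wcoef1_le b_prime psi_char l (rdiff_bounded_complex qM) n1).
Qed.

Lemma walsh_decay_poly_diff alpha (q : {poly R}) :
  walsh_decay alpha (fun x y => q.[x - y]).
Proof.
pose phi i x y : R :=
  q`_i * \sum_(j < i.+1) ((-1) ^+ j * 'C(i, j)%:R) * (('X^(i - j)).[x] * ('X^j).[y]).
apply: (@eq_walsh_decay _ (fun x y => \sum_(i < size q) phi i x y)).
  move=> x y; rewrite horner_coef; apply: eq_bigr => i _; rewrite exprBn; congr (_ * _).
  apply: eq_bigr => j _; rewrite !hornerXn -[RHS]mulr_natr; ring.
apply: walsh_decay_sum => i; apply: walsh_decayZ; apply: walsh_decay_sum => j.
exact/walsh_decayZ/walsh_decay_poly.
Qed.

Lemma walsh_decay_cusp alpha : (0 < alpha)%N ->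
  walsh_decay alpha (fun x y => cusp (2 * alpha).-2 (x - y)).
Proof.
move=> a0; set m := (2 * alpha).-2.
have aa : (alpha + alpha)%N = m.+2 by rewrite /m; lia.
(* 3 bounds 1 + 2 * (1 - b^-n), the interval required by [wcoef_diff_cusp], for all n. *)
have [M fM] := rdiff_bounded_cusp m (3 : R); have [M0 _] := fM.
exists (3 * M * b%:R ^+ (alpha + alpha)); first by rewrite !mulr_ge0// exprn_ge0.
move=> n k l.
have bn0 : 0 < b%:R ^- n :> R by rewrite invr_gt0 exprn_gt0// base_gt0.
apply: (@wcoef_diff_cusp _ _ b_prime _ psi_char n alpha alpha M 3
  (fun x => (cusp m x)%:C%C) k l); last by lra.
rewrite aa; split=> // [|hs x sz Lx]; first exact: rdiff_bounded_complex.
have -> : diffs hs (fun x => (cusp m x)%:C%C) x = (diffs hs (cusp m) x)%:C%C.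
  by elim: hs x {sz Lx} => [//|h hs IH] x /=; rewrite !IH rmorphB.
by rewrite diffs_cusp_eq0//; lra.
Qed.

Definition sobolev_kernel1 alpha (x y : R) : R :=
  (\sum_(1 <= r < alpha.+1)
      (bernoulli_poly R r).[x] * (bernoulli_poly R r).[y] / (r`!%:R ^+ 2))
  + (-1) ^+ alpha.+1 * (bernoulli_poly R (2 * alpha)).[`|x - y|]
      / (2 * alpha)`!%:R.

Lemma walsh_decay_sobolev alpha : (0 < alpha)%N ->
  walsh_decay alpha (sobolev_kernel1 alpha).
Proof.
move=> a0; apply: walsh_decayD.
  apply: walsh_decay_sum => r.
  apply: (@eq_walsh_decay _ (fun x y => (r`!%:R ^+ 2)^-1 *
     ((bernoulli_poly R r).[x] * (bernoulli_poly R r).[y]))).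
    by move=> x y; rewrite mulrC.
  exact/walsh_decayZ/walsh_decay_poly.
have [q [c qc]] := @bernoulli_poly_norm R alpha a0.
apply: (@eq_walsh_decay _ (fun x y => ((-1) ^+ alpha.+1 / (2 * alpha)`!%:R) *
     (q.[x - y] + c * cusp (2 * alpha).-2 (x - y)))).
  by move=> x y; rewrite qc; ring.
apply: walsh_decayZ; apply: walsh_decayD; first exact: walsh_decay_poly_diff.
exact/walsh_decayZ/walsh_decay_cusp.
Qed.

End SobolevWalsh.

(** * Summability of the weights *)

Lemma gt1_ltr_powR (R : realType) (a x y : R) : 1 < a -> x < y -> a `^ x < a `^ y.
Proof.
move=> a1 xy; have a0 : 0 < a := lt_trans ltr01 a1.
by rewrite /powR gt_eqF// ltr_expR ltr_pM2r// ln_gt0.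
Qed.

Section WeightSum.
Variables (R : realType) (b : nat) (b_prime : prime b).
Local Notation F := 'F_b.

(* The number of non-zero digits that enter dw beta k. *)
Fixpoint nsel (beta : nat) (k : seq F) : nat :=
  if k is c :: k' then
    if (c != 0) && (0 < beta)%N then (nsel beta.-1 k').+1 else nsel beta k'
  else 0.

Lemma nsel_count beta k : nsel beta k = minn beta (count (fun c => c != 0) k).
Proof.
elim: k beta => [|c k IH] beta /=; first by rewrite minn0.
case: (c != 0) => /=; last by rewrite IH.
by case: beta => [|beta] /=; rewrite IH ?min0n// add1n minnSS.
Qed.

(** In a list of size M + n the last n entries sit at positions 1, ..., n, those seen by the
    generating matrices. *)
Definition tail_zero M (k : seq F) := all (fun c => c == 0) (drop M k).

(** If positions 1, ..., n of k vanish, this is the weight of k with all its digits moved n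
    positions down. *)
Definition scaled_dw (n : nat) beta (k : seq F) : R :=
  (b ^ n)%:R ^+ nsel beta k * dw R beta k.

Lemma scaled_dw_ge0 n beta k : 0 <= scaled_dw n beta k.
Proof. by rewrite mulr_ge0 ?exprn_ge0// dw_ge0. Qed.

Definition dw_sum (lambda : R) n beta M : R :=
  \sum_(k : (M + n).-tuple F | tail_zero M k) scaled_dw n beta k `^ lambda.

Lemma dw_sum0 lambda n beta : dw_sum lambda n beta 0 = 1.
Proof.
rewrite /dw_sum (bigD1 [tuple of nseq n 0])/=; last first.
  by rewrite /tail_zero drop0 all_nseq eqxx orbT.
rewrite big1 => [|k /andP[]]; last first.
  rewrite /tail_zero drop0 => /all_pred1P k0 /eqP[]; apply: val_inj => /=.
  by rewrite k0 size_tuple.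
rewrite addr0 (_ : scaled_dw _ _ _ = 1) ?powR1// /scaled_dw.
have [-> ->] : nsel beta (nseq n 0) = 0%N /\ dw R beta (nseq n (0 : F)) = 1.
  by elim: (n) => [//|i [IH1 IH2]]; rewrite /= ?eqxx.
by rewrite expr0 mulr1.
Qed.

Lemma powR_expn (x lambda : R) n : 0 <= x -> (x ^+ n) `^ lambda = (x `^ lambda) ^+ n.
Proof.
move=> x0; rewrite -(powR_mulrn n x0) -(powR_mulrn n (powR_ge0 x lambda)).
by rewrite -!powRrM mulrC.
Qed.

(** The leading digit, at position M + 1 + n, is selected first. Its rescaled weight b^-(M+1) does
    not contain n, which makes the resulting bound uniform in n. *)
Lemma dw_sumS lambda n beta M :
  dw_sum lambda n beta.+1 M.+1 = dw_sum lambda n beta.+1 M +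
    (b%:R - 1) * ((b%:R^-1) `^ lambda) ^+ M.+1 * dw_sum lambda n beta M.
Proof.
have b0 : 0 < b%:R :> R by exact: base_gt0.
rewrite /dw_sum big_mkcond/= big_tupleS [X in X + _]big_mkcond/=.
rewrite [X in _ + _ * X]big_mkcond mulr_sumr -big_split/=; apply: eq_bigr => k _.
rewrite /tail_zero/=; case: ifP => _; last by rewrite mulr0 addr0 big1.
rewrite (bigD1 0)//=; congr (_ + _).
rewrite (eq_bigr (fun=> ((b%:R^-1) `^ lambda) ^+ M.+1 * scaled_dw n beta k `^ lambda)).
  rewrite sumr_const -[LHS]mulr_natl -[RHS]mulrA; congr (_ * _).
  have -> : #|[pred d : F | d != 0]| = b.-1.
    by have := cardC1 (0 : F); rewrite card_Fp.
  by rewrite -[in RHS](prednK (prime_gt0 b_prime)) -natr1 addrK.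
move=> d d0; rewrite /scaled_dw/= d0/= size_tuple.
have -> : (b ^ n)%:R ^+ (nsel beta k).+1 * (b%:R ^- (M + n).+1 * dw R beta k) =
    b%:R^-1 ^+ M.+1 * ((b ^ n)%:R ^+ nsel beta k * dw R beta k) :> R.
  rewrite exprS natrX exprVn -addSn exprD.
  by field; rewrite !expf_neq0// lt0r_neq0.
have b0' : 0 <= b%:R^-1 :> R by rewrite invr_ge0 ltW.
rewrite (powRM _ (exprn_ge0 M.+1 b0') (scaled_dw_ge0 n beta k)).
by rewrite (powR_expn _ _ b0').
Qed.

Lemma dw_sum_beta0 lambda n M : dw_sum lambda n 0 M <= b%:R ^+ M.
Proof.
rewrite /dw_sum (eq_bigr (fun=> 1)) => [|k _]; last first.
  rewrite /scaled_dw dw0 mulr1; case: k => k /= _.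
  by rewrite nsel_count min0n expr0 powR1.
elim: M => [|M IH].
  apply: (@le_trans _ _ (dw_sum 0 n 0 0)); last by rewrite dw_sum0 expr0.
  by apply: ler_sum => k _; rewrite powRr0.
rewrite big_mkcond/= big_tupleS/= exprS.
apply: le_trans (ler_wpM2l (ltW (base_gt0 R b_prime)) IH).
rewrite [X in _ * X]big_mkcond mulr_sumr; apply: ler_sum => k _.
rewrite /tail_zero/=; case: ifP => _; last by rewrite big1// mulr0.
by rewrite sumr_const card_Fp// mulr1.
Qed.

(* Conditioning on the least significant digit (dw_sumS), the sum for beta < alpha
   grows at most like b^(M (1 - beta / alpha)); at beta = alpha the increments are
   geometric with ratio b^(1 / alpha - lambda) < 1. *)
Lemma dw_sum_bounded alpha lambda : (0 < alpha)%N -> alpha%:R^-1 < lambda ->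
  exists2 A : R, 1 <= A & forall n M, dw_sum lambda n alpha M <= A.
Proof.
move=> a0 la; have b0 : 0 < b%:R :> R by exact: base_gt0.
have b1 : 1 < b%:R :> R by rewrite ltr1n prime_gt1.
pose w := b%:R `^ alpha%:R^-1 : R; pose v := (b%:R^-1) `^ lambda : R.
have w1 : 1 < w by rewrite -[ltLHS](powRr0 b%:R) gt1_ltr_powR ?invr_gt0 ?ltr0n.
have wb : w ^+ alpha = b%:R.
  by rewrite /w -powR_mulrn ?powR_ge0// -powRrM mulVf ?powRr1 ?ltW// pnatr_eq0 gtn_eqF.
have v0 : 0 < v by rewrite powR_gt0 ?invr_gt0.
have w0 : 0 < w by rewrite (lt_trans ltr01).
have vw : v * w < 1.
  rewrite /v -powR_inv1 ?ltW// -powRrM mulN1r -powRD ?(gt_eqF b0) ?implybT//.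
  by rewrite -[ltRHS](powRr0 b%:R) gt1_ltr_powR//; lra.
have low beta : (beta < alpha)%N -> exists2 A : R, 1 <= A &
    forall n M, dw_sum lambda n beta M <= A * (w ^+ (alpha - beta)) ^+ M.
  elim: beta => [|beta IH] ba.
    by exists 1 => // n M; rewrite mul1r subn0 wb dw_sum_beta0.
  have [A A1 FA] := IH (ltnW ba).
  have bA : 0 <= b%:R * A / (w - 1).
    by rewrite divr_ge0 ?mulr_ge0 ?subr_ge0 ?ltW// (lt_le_trans ltr01).
  (* The induction needs A' W^M + b A W^M <= A' W^(M+1), which follows from W >= w and A' (w - 1) >=
     b A. *)
  exists (1 + b%:R * A / (w - 1)) => [|n M]; first by rewrite lerDl.
  set A' := 1 + _; have A'1 : 1 <= A' by rewrite lerDl.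
  elim: M => [|M IHM]; first by rewrite dw_sum0 expr0 mulr1.
  rewrite dw_sumS; set W := w ^+ (alpha - beta.+1).
  have Ww : w <= W.
    rewrite /W -[leLHS]expr1 ler_weXn2l ?ltW// subn_gt0; exact: ba.
  have WM : w ^+ (alpha - beta) = w * W by rewrite /W -exprS subnSK// ltnW.
  have W0 : 0 < W ^+ M by rewrite exprn_gt0// (lt_le_trans w0).
  have step : (b%:R - 1) * v ^+ M.+1 * dw_sum lambda n beta M <= b%:R * A * W ^+ M.
    apply: (@le_trans _ _ (b%:R * v ^+ M.+1 * (A * (w * W) ^+ M))).
      rewrite ler_pM ?mulr_ge0 ?subr_ge0 ?exprn_ge0 ?(ltW b1) ?(ltW v0)//.
      - by apply: sumr_ge0 => k _; exact: powR_ge0.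
      - by rewrite ler_wpM2r ?exprn_ge0 ?(ltW v0)// gerDl.
      - by rewrite -WM FA.
    have -> : b%:R * v ^+ M.+1 * (A * (w * W) ^+ M) =
        (b%:R * A * W ^+ M) * (v * (v * w) ^+ M) by rewrite exprS !exprMn; ring.
    rewrite ler_piMr ?mulr_ge0 ?(ltW W0) ?(ltW b0) ?(le_trans ler01)//.
    have v1 : v <= 1.
      by rewrite (le_trans _ (ltW vw))// ler_peMr ?(ltW v0) ?(ltW w1).
    rewrite mulr_ile1 ?exprn_ile1 ?exprn_ge0 ?mulr_ge0 ?(ltW v0) ?(ltW w0) ?(ltW vw)//.
  apply: (le_trans (lerD IHM step)).
  rewrite -mulrDl [in leRHS]exprS mulrA ler_wpM2r ?(ltW W0)//.
  have : b%:R * A <= A' * (w - 1).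
    by rewrite /A' mulrDl mul1r divfK ?lerDr ?subr_ge0 ?(ltW w1)// subr_eq0 gt_eqF.
  have : A' * w <= A' * W by rewrite ler_wpM2l// (le_trans ler01).
  lra.
have ltaa : (alpha.-1 < alpha)%N by rewrite prednK.
have e1 : (alpha - alpha.-1)%N = 1%N by rewrite -subn1 subKn.
have [A A1] := low alpha.-1 ltaa; rewrite e1 expr1 => FA.
have A0 : 0 <= A by exact: le_trans ler01 A1.
pose r := v * w; have r0 : 0 <= r by rewrite mulr_ge0// ltW.
have r1 : 0 < 1 - r by rewrite subr_gt0.
pose D := b%:R * A / (1 - r).
have D0 : 0 <= D by rewrite divr_ge0 ?mulr_ge0// ltW.
exists (1 + D) => [|n M]; first by rewrite lerDl.
(* The partial sum of the geometric series is kept so that the induction goes through. *)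
apply: (@le_trans _ _ (1 + D * (1 - r ^+ M))); last first.
  by rewrite lerD2l ler_piMr// gerBl exprn_ge0.
elim: M => [|M IH]; first by rewrite dw_sum0 expr0 subrr mulr0 addr0.
rewrite -[in leLHS](prednK a0) dw_sumS (prednK a0).
have step : (b%:R - 1) * v ^+ M.+1 * dw_sum lambda n alpha.-1 M <= b%:R * A * r ^+ M.
  apply: (@le_trans _ _ (b%:R * v ^+ M.+1 * (A * w ^+ M))).
    rewrite ler_pM ?mulr_ge0 ?subr_ge0 ?exprn_ge0 ?(ltW b1) ?(ltW v0)//.
    - by apply: sumr_ge0 => k _; exact: powR_ge0.
    - by rewrite ler_wpM2r ?exprn_ge0 ?(ltW v0)// gerDl.
  have -> : b%:R * v ^+ M.+1 * (A * w ^+ M) = (b%:R * A * r ^+ M) * v.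
    by rewrite /r exprS !exprMn; ring.
  rewrite ler_piMr ?mulr_ge0 ?exprn_ge0 ?(ltW b0)//.
  by rewrite (le_trans _ (ltW vw))// ler_peMr ?(ltW v0) ?(ltW w1).
apply: (le_trans (lerD IH step)).
have -> : b%:R * A * r ^+ M = D * (1 - r) * r ^+ M.
  by rewrite /D divfK// gt_eqF.
by rewrite exprS le_eqVlt; apply/orP; left; apply/eqP; ring.
Qed.

End WeightSum.

(** * Polynomial lattices and their dual nets *)

Section LaurentQuotient.
Variable F : fieldType.
Implicit Types p q : {poly F}.

Lemma laurent_div_rec q p (e : int) : p != 0 ->
  \sum_(i < size p) p`_i * laurent_div q p (e - i%:Z) = laurent_of_poly q e.
Proof. by move=> p0; rewrite -laurent_mul_polyE; case: (laurent_divP q p0) => _ ->. Qed.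

Lemma laurent_divD q q' p (e : int) : p != 0 ->
  laurent_div (q + q') p e = laurent_div q p e + laurent_div q' p e.
Proof.
move=> p0.
have [[N uN] pu] := laurent_divP q p0; have [[N' uN'] pu'] := laurent_divP q' p0.
have [lu pq] := laurent_divP (q + q') p0.
rewrite (@laurent_div_unique _ p _ (fun e => laurent_div q p e + laurent_div q' p e) p0 lu)//.
  exists (Num.max N N') => f; rewrite gt_max => /andP[Nf N'f].
  by rewrite uN// uN'// addr0.
rewrite pq; apply/funext => f; rewrite laurent_mul_polyE.
under eq_bigr do rewrite mulrDr.
rewrite big_split/= -!laurent_mul_polyE pu pu'.
by case: f => f /=; rewrite ?coefD ?addr0.
Qed.

(* The sums are the coefficients of x^-1, ..., x^-n of (sum_i c_i x^i) q / p; if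
   they vanish, p divides (sum_i c_i x^i) q. *)
Lemma laurent_window_inj n p q (c : nat -> F) : irreducible_poly p ->
  size p = n.+1 -> (size q <= n)%N -> (exists2 i, (i < n)%N & c i != 0) ->
  (forall r, (r < n)%N ->
     \sum_(i < n) c i * laurent_div q p (- (i + r).+1%:Z) = 0) ->
  q = 0.
Proof.
move=> irp sp sq [i0 i0n ci0] Lq.
have p0 : p != 0 by rewrite -size_poly_gt0 sp.
pose u := laurent_div q p; pose k := \poly_(i < n) c i.
have [[N uN] _] := laurent_divP q p0.
(* The coefficient of x^e in k q / p; [V] below is the polynomial part. *)
pose v (e : int) := \sum_(i < n) c i * u (e - i%:Z).
have v0 r : (r < n)%N -> v (- r.+1%:Z) = 0.
  move=> rn; rewrite -[RHS](Lq r rn); apply: eq_bigr => i _.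
  by congr (_ * u _); lia.
pose D := (`|N| + n + 1)%N.
have vD e : (D <= e)%N -> v e%:Z = 0.
  move=> De; apply: big1 => i _; rewrite /u uN ?mulr0//.
  by have := ltn_ord i; move: De; rewrite /D; lia.
pose V := \poly_(e < D) v e%:Z.
have VE e : V`_e = v e%:Z.
  by rewrite coef_poly; case: ltnP => // De; rewrite vD.
(* For e >= 0 the coefficient of x^e in p * (k q / p) uses indices down to e - n >= -n only, and v
   vanishes from -1 to -n, so the fractional part contributes nothing. *)
have kq : k * q = p * V.
  apply/polyP => e.
  transitivity (\sum_(i < n) c i * laurent_of_poly q (e%:Z - i%:Z)).
    rewrite coefM [RHS](eq_bigr (fun i : 'I_n => k`_i * laurent_of_poly q (e%:Z - i%:Z))).
      rewrite (big_ord_widen (e.+1 + n) (fun i => k`_i * q`_(e - i))) ?leq_addr//.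
      rewrite (big_ord_widen (e.+1 + n) (fun i => k`_i * laurent_of_poly q (e%:Z - i%:Z))) ?leq_addl//.
      rewrite big_mkcond [RHS]big_mkcond/=; apply: eq_bigr => i _.
      case: ltnP => ie; case: ltnP => ni //.
      - by congr (_ * _); rewrite (_ : e%:Z - i%:Z = (e - i)%N%:Z)//; lia.
      - by rewrite nth_default ?mul0r// (leq_trans (size_poly _ _)).
      - rewrite (_ : e%:Z - i%:Z = Negz (i - e).-1) ?mulr0//; last by rewrite NegzE; lia.
    by move=> i _; rewrite coef_poly ltn_ord.
  under eq_bigr => i _ do rewrite -(laurent_div_rec q _ p0) mulr_sumr.
  rewrite exchange_big/= coefM sp.
  transitivity (\sum_(a < n.+1) p`_a * v (e%:Z - a%:Z)).
    apply: eq_bigr => a _; rewrite mulr_sumr; apply: eq_bigr => i _.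
    by rewrite mulrCA addrAC.
  rewrite (big_ord_widen (e.+1 + n.+1) (fun i => p`_i * V`_(e - i))) ?leq_addr//.
  rewrite (big_ord_widen (e.+1 + n.+1) (fun i => p`_i * v (e%:Z - i%:Z))) ?leq_addl//.
  rewrite big_mkcond [RHS]big_mkcond/=; apply: eq_bigr => i _.
  case: ltnP => ie; case: ltnP => ni //.
  - by rewrite VE; congr (_ * v _); lia.
  - rewrite (_ : e%:Z - i%:Z = - (i - e).-1.+1%:Z); last by lia.
    by rewrite v0 ?mulr0//; lia.
  - by rewrite nth_default ?mul0r// sp.
have : p %| k * q by rewrite kq dvdp_mulIl.
have cop (r : {poly F}) : (size r <= n)%N -> r != 0 -> coprimep p r.
  move=> sr r0; rewrite irreducible_poly_coprime//.
  by apply/negP => /dvdp_leq -/(_ r0); rewrite sp ltnNge sr.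
have k0 : k != 0.
  apply/eqP => /polyP/(_ i0); rewrite coef_poly i0n coef0 => /eqP.
  by rewrite (negbTE ci0).
rewrite Gauss_dvdpr ?cop ?size_poly// => pq.
apply/eqP; apply: contraTT pq => q0.
by apply/negP => /dvdp_leq -/(_ q0); rewrite sp ltnNge sq.
Qed.

End LaurentQuotient.

Section DualCount.
Variables (b : nat) (b_prime : prime b) (s m n : nat) (mn : (m <= n)%N).
Local Notation F := 'F_b.
Variables (p : {poly F}) (irp : irreducible_poly p) (sp : size p = n.+1).

Definition dual_form (c : 'I_s -> nat -> F) (q : 'I_s -> {poly F}) (r : nat) : F :=
  \sum_j \sum_(i < n) c j i * laurent_div (q j) p (- (i + r).+1%:Z).

Local Notation Q := {ffun 'I_s -> 'rV[F]_n}.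

(** Row vectors code the polynomials of degree below n, so that the generating vectors form a finite
    type. *)
Definition rV_family (q : Q) (j : 'I_s) : {poly F} := rVpoly (q j).

Definition in_dual (c : 'I_s -> nat -> F) (q : Q) : bool :=
  [forall r : 'I_m, dual_form c (rV_family q) r == 0].

(* A vector with a prescribed image under the first m linear forms can be added in
   coordinate j0, so that the b^m fibres of these forms have the same size. *)
Lemma card_in_dual (c : 'I_s -> nat -> F) :
  (exists j, exists2 i, (i < n)%N & c j i != 0) ->
  (#|[pred q : Q | in_dual c q]| * b ^ m
    <= #|{: Q}|)%N.
Proof.
move=> [j0 cj0]; have p0 : p != 0 by rewrite -size_poly_gt0 sp.
pose L (v : 'rV[F]_n) (r : nat) :=
  \sum_(i < n) c j0 i * laurent_div (rVpoly v) p (- (i + r).+1%:Z).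
have LD v w r : L (v + w) r = L v r + L w r.
  rewrite /L -big_split/=; apply: eq_bigr => i _.
  by rewrite raddfD laurent_divD// mulrDr.
(* All n forms together are injective by [laurent_window_inj], hence bijective; since m <= n, the
   values of the first m can be prescribed. *)
pose Psi (v : 'rV[F]_n) : 'rV[F]_n := \row_r L v r.
have Psi_inj : injective Psi.
  move=> v w vw; apply/eqP; rewrite -subr_eq0; apply/eqP.
  rewrite -[LHS]rVpolyK.
  rewrite (@laurent_window_inj _ n p (rVpoly (v - w)) (c j0)) ?linear0 ?size_poly//.
  move=> r rn; apply: (@addIr _ (L w r)); rewrite add0r -/(L (v - w) r) -LD subrK.
  by have /rowP/(_ (Ordinal rn)) := vw; rewrite !mxE.
have [g gK Kg] := injF_bij Psi_inj.
pose ext (e : m.-tuple F) : Q := [ffun j => if j == j0 then g (\row_(r < n) e`_r) else 0].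
pose S : {set Q} := [set q : Q | in_dual c q]%SET.
pose h (qe : Q * m.-tuple F) : Q := qe.1 + ext qe.2.
have formD (q q' : Q) r : dual_form c (rV_family (q + q')) r =
    dual_form c (rV_family q) r + dual_form c (rV_family q') r.
  rewrite /dual_form -big_split/=; apply: eq_bigr => j _.
  rewrite -big_split/=; apply: eq_bigr => i _.
  by rewrite /rV_family ffunE raddfD laurent_divD// mulrDr.
have div0 e : laurent_div 0 p e = 0.
  by apply: (@addrI _ (laurent_div 0 p e)); rewrite -laurent_divD// !addr0.
have form_ext e (r : 'I_m) : dual_form c (rV_family (ext e)) r = e`_r.
  rewrite /dual_form (bigD1 j0)//= [X in _ + X]big1 ?addr0.
    rewrite /rV_family ffunE eqxx -/(L _ r).
    have rn := leq_trans (ltn_ord r) mn.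
    have /rowP/(_ (Ordinal rn)) := Kg (\row_(r < n) e`_r).
    by rewrite !mxE.
  move=> j jj0; apply: big1 => i _.
  by rewrite /rV_family ffunE (negbTE jj0) linear0 div0 mulr0.
have h_inj : {in finset.setX S [set: m.-tuple F]%SET &, injective h}.
  move=> [q e] [q' e'] /=; rewrite !inE/= => /andP[/forallP qS _] /andP[/forallP q'S _].
  rewrite /h/= => qq'.
  have ee' : e = e'.
    apply: eq_from_tnth => r; rewrite !(tnth_nth 0) -!form_ext.
    have := congr1 (fun q => dual_form c (rV_family q) r) qq'.
    by rewrite /= !formD (eqP (qS r)) (eqP (q'S r)) !add0r.
  by move: qq'; rewrite ee' => /addIr ->.
have -> : #|[pred q : Q | in_dual c q]| = #|S|.
  by rewrite cardsE.
have := max_card (mem (h @: finset.setX S [set: m.-tuple F]%SET)).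
by rewrite card_in_imset// cardsX cardsT card_tuple card_Fp.
Qed.

End DualCount.

(** * Character sums over the antithetic lattice *)

Section NetWalsh.
Variables (R : realType) (b : nat) (b_prime : prime b).
Variables (psi : 'F_b -> R[i]) (psi_char : add_char psi).
Local Notation F := 'F_b.

Lemma big_nval (V : nmodType) (G : nat -> V) m :
  \sum_(0 <= h < b ^ m) G h = \sum_(t : m.-tuple F) G (nval t).
Proof.
have lt (t : m.-tuple F) : (nval t < b ^ m)%N.
  by have := nval_lt b_prime t; rewrite size_tuple.
rewrite big_mkord (reindex (fun t => Ordinal (lt t)))//.
apply: onW_bij; apply: inj_card_bij.
  move=> t u /(congr1 val)/= tu; apply/val_inj/(nval_inj b_prime) => //.
  by rewrite !size_tuple.
by rewrite card_ord card_tuple card_Fp.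
Qed.

Lemma nval_digit (t : seq F) r : ((nval t %/ b ^ r) %% b)%:R = t`_r :> F.
Proof.
have b0 := prime_gt0 b_prime.
elim: t r => [|d t IH] [|r]; rewrite ?div0n ?mod0n//=.
  rewrite expn0 divn1 addnC mulnC modnMDl modn_small ?digit_lt//.
  exact: natr_Zp.
by rewrite expnS divnMA addnC mulnC divnMDl// (divn_small (digit_lt b_prime d)) addn0 IH.
Qed.

(** Reversed because digit lists start with the least significant digit; digit i of a point is
    therefore paired with entry i of [rev k]. *)
Definition trunc N (z : digitseq b) : N.-tuple F := [tuple of rev (mkseq z N)].

Lemma truncS N z : trunc N.+1 z = z N :: trunc N z :> seq F.
Proof. by rewrite /= mkseqS rev_rcons. Qed.

Lemma dot_trunc N (k : N.-tuple F) z :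
  dot k (trunc N z) = \sum_(i < N) (rev k)`_i * z i.
Proof.
elim: N k => [|N IH] k; first by rewrite [k]tuple0 big_ord0.
case/tupleP: k => c k; rewrite truncS big_ord_recr; rewrite [LHS]/= IH [LHS]addrC/=; congr (_ + _).
  apply: eq_bigr => i _; rewrite rev_cons nth_rcons size_rev size_tuple.
  by rewrite ltn_ord.
by rewrite rev_cons nth_rcons size_rev size_tuple ltnn eqxx.
Qed.

Lemma rval_trunc N z :
  rval R (trunc N z) = series (fun i => (z i : nat)%:R / b%:R ^+ i.+1) N.
Proof.
elim: N => [|N IH]; first by rewrite /series/= big_geq.
by rewrite truncS/= seriesSr IH size_rev size_mkseq addrC.
Qed.

Lemma sum_psi_linear m (L : 'I_m -> F) :
  \sum_(t : m.-tuple F) psi (\sum_(r < m) L r * t`_r) =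
  (if [forall r, L r == 0] then (b ^ m)%N else 0%N)%:R.
Proof.
have dotE (u v : m.-tuple F) : dot u v = \sum_(r < m) u`_r * v`_r.
  elim: m u v {L} => [|m IH] u v; first by rewrite [u]tuple0 big_ord0.
  by case/tupleP: u => c u; case/tupleP: v => d v; rewrite big_ord_recl/= IH.
pose x := [tuple of mkseq (fun r => if insub r is Some r' then L r' else 0) m].
pose y := [tuple of nseq m (0 : F)].
have xE (r : 'I_m) : x`_r = L r.
  by rewrite nth_mkseq// insubT//= => rm; congr L; apply: val_inj.
have <- : (x == y) = [forall r, L r == 0].
  apply/eqP/forallP => [xy r|L0].
    by rewrite -xE xy /= nth_nseq ltn_ord.
  apply: eq_from_tnth => r; rewrite !(tnth_nth 0) xE (eqP (L0 r)).
  by rewrite /= nth_nseq ltn_ord.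
rewrite -(sum_psi_dot b_prime psi_char); apply: eq_bigr => t _.
rewrite !dotE [X in _ - X]big1 => [|r _]; last by rewrite nth_nseq ltn_ord mulr0.
by rewrite subr0; congr psi; apply: eq_bigr => r _; rewrite xE mulrC.
Qed.

Section Net.
Variables (s m n : nat) (p : {poly F}).

Lemma size_antithetic_lattice (q : 'I_s -> {poly F}) :
  size (antithetic (ho_poly_lattice m n p q)) = (b * b ^ m)%N.
Proof.
by rewrite size_allpairs -cardE card_Fp// size_map size_iota.
Qed.

(** The pairing is additive in z, so the sum factors: the shifts yield the digit sum condition, the
    net the linear forms. Matrix rows beyond n vanish, so the forms see n digits, while a shift
    moves all N. *)
Lemma lattice_walsh_sum N (q : 'I_s -> {poly F}) (k : 'I_s -> N.-tuple F) :
  (n <= N)%N ->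
  \sum_(z <- antithetic (ho_poly_lattice m n p q))
     psi (\sum_j dot (k j) (trunc N (z j))) =
  (if (\sum_j \sum_(i < N) (rev (k j))`_i == 0) &&
      [forall r : 'I_m, dual_form n p (fun j i => (rev (k j))`_i) q r == 0]
   then (b * b ^ m)%N else 0%N)%:R.
Proof.
move=> nN; pose c (j : 'I_s) (i : nat) : F := (rev (k j))`_i; rewrite -/c.
rewrite big_allpairs_dep/= big_enum/=.
transitivity (\sum_(l : F) psi (l * \sum_j \sum_(i < N) c j i) *
    \sum_(t : m.-tuple F) psi (\sum_(r < m) dual_form n p c q r * t`_r)).
  apply: eq_bigr => l _; rewrite mulr_sumr /ho_poly_lattice /digital_net big_map.
  have -> : iota 0 (b ^ m) = index_iota 0 (b ^ m) by rewrite /index_iota subn0.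
  rewrite big_nval; apply: eq_bigr => t _.
  rewrite -(psiD psi_char); congr psi.
  transitivity (\sum_j (l * (\sum_(i < N) c j i) + \sum_(i < N) c j i *
      net_point (fun j => @ho_poly_matrix b m n p (q j)) (nval t) j i)).
    apply: eq_bigr => j _; rewrite dot_trunc mulr_sumr -big_split/=.
    by apply: eq_bigr => i _; rewrite mulrDr addrC [_ * l]mulrC.
  rewrite big_split/= -mulr_sumr; congr (_ + _).
  rewrite exchange_big/= /dual_form.
  under [RHS]eq_bigr do rewrite mulr_suml.
  rewrite [RHS]exchange_big/=.
  rewrite exchange_big/=; apply: eq_bigr => j _.
  under [RHS]eq_bigr do rewrite mulr_suml.
  rewrite [RHS]exchange_big/=.
  rewrite (big_ord_widen N (fun i => \sum_(r < m)
    c j i * laurent_div (q j) p (- (i + r).+1%:Z) * t`_r) nN).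
  rewrite [RHS]big_mkcond/=; apply: eq_bigr => i _.
  rewrite /net_point mulr_sumr /ho_poly_matrix.
  case: ltnP => ni; last by rewrite big1// => r _; rewrite mul0r mulr0.
  by apply: eq_bigr => r _; rewrite nval_digit mulrA.
rewrite -mulr_suml sum_psi_linear (sum_psi b_prime psi_char).
by case: (_ == 0); case: [forall r, _]; rewrite ?mul0r ?mulr0// -natrM.
Qed.

End Net.
End NetWalsh.

(** * Reproducing kernels and the integral over the cube *)

Section RKHSBounds.
Variables (R : realType) (X : Type) (K : X -> X -> R) (H : rkhs K).
Local Notation dom := (rkhs_dom H).
Local Notation dot := (rkhs_dot H).

Lemma rkhs_dot0l f : dom f -> dot 0 f = 0.
Proof.
move=> df; have := rkhs_dotP 1 (rkhs_dom0 H) (rkhs_dom0 H) df.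
by rewrite scaler0 addr0 mul1r => /esym/eqP; rewrite -subr_eq0 addrK => /eqP.
Qed.

Lemma rkhs_dot_ge0 f : dom f -> 0 <= dot f f.
Proof.
move=> df; have [->|f0] := pselect (f = 0); first by rewrite rkhs_dot0l//; exact: rkhs_dom0.
exact/ltW/rkhs_dot_gt0.
Qed.

Lemma rkhs_cauchy_schwarz f g : dom f -> dom g -> dot f g ^+ 2 <= dot f f * dot g g.
Proof.
move=> df dg; have [->|g0] := pselect (g = 0).
  rewrite rkhs_dotC ?rkhs_dot0l//; try exact: rkhs_dom0.
  by rewrite expr0n mulr0.
have gg := rkhs_dot_gt0 dg g0.
(* The minimiser of the squared norm of t g + f. *)
pose t := - (dot f g / dot g g).
have dh : dom (t *: g + f) by exact: rkhs_domP.
have := rkhs_dot_ge0 dh.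
rewrite (rkhs_dotP t dg df dh) (rkhs_dotC dg dh) (rkhs_dotC df dh).
rewrite !(rkhs_dotP t dg df) // (rkhs_dotC dg df) => h.
rewrite -subr_ge0.
have -> : dot f f * dot g g - dot f g ^+ 2 =
   (t * (t * dot g g + dot f g) + (t * dot f g + dot f f)) * dot g g.
  by rewrite /t; field; rewrite gt_eqF.
by rewrite mulr_ge0// ltW.
Qed.

Lemma rkhs_comb (I : Type) (s : seq I) (w : I -> R) (x : I -> X) :
  dom (\sum_(i <- s) w i *: K^~ (x i)) /\ forall h, dom h ->
    dot (\sum_(i <- s) w i *: K^~ (x i)) h = \sum_(i <- s) w i * h (x i).
Proof.
elim: s => [|i s [dg gE]].
  by rewrite big_nil; split=> [|h dh]; [exact: rkhs_dom0|rewrite big_nil rkhs_dot0l].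
have dk := rkhs_kernel H (x i); rewrite big_cons; split=> [|h dh].
  exact: rkhs_domP.
by rewrite big_cons rkhs_dotP// gE// rkhs_dotC// rkhs_reproducing.
Qed.

(** Cauchy-Schwarz against the representer sum_i w_i K(., x_i). It covers finite combinations of
    point values, which is why the integral is replaced by a grid average. *)
Lemma rkhs_quadrature (I : finType) (w : I -> R) (x : I -> X) f : dom f ->
  (\sum_i w i * f (x i)) ^+ 2 <=
  dot f f * \sum_i \sum_j w i * w j * K (x i) (x j).
Proof.
move=> df; have [dg gE] := rkhs_comb (index_enum I) w x.
rewrite -gE// rkhs_dotC//; apply: le_trans (rkhs_cauchy_schwarz df dg) _.
rewrite ler_wpM2l ?rkhs_dot_ge0// gE// le_eqVlt; apply/orP; left; apply/eqP.
apply: eq_bigr => i _; rewrite fct_sumE mulr_sumr; apply: eq_bigr => j _.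
by rewrite /GRing.scale/= mulrA.
Qed.

Lemma rkhs_evaluation f x : dom f -> f x ^+ 2 <= dot f f * K x x.
Proof.
move=> df; have := rkhs_quadrature (fun=> 1) (fun _ : 'I_1 => x) df.
by rewrite !big_ord1 !mul1r.
Qed.

Lemma rkhs_increment f x y : dom f ->
  (f x - f y) ^+ 2 <= dot f f * (K x x - K x y - (K y x - K y y)).
Proof.
move=> df.
have := rkhs_quadrature (fun i : bool => (-1) ^+ ~~ i) (fun i => if i then x else y) df.
rewrite !big_bool/= expr0 expr1 => h.
by apply: le_trans (le_trans _ h) _; rewrite le_eqVlt; apply/orP; left; apply/eqP; ring.
Qed.

Lemma rkhs_cvg (x_ : nat -> X) x f : dom f ->
  K (x_ n) (x_ n) @[n --> \oo] --> K x x ->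
  K (x_ n) x @[n --> \oo] --> K x x -> K x (x_ n) @[n --> \oo] --> K x x ->
  f (x_ n) @[n --> \oo] --> f x.
Proof.
move=> df c1 c2 c3.
have c0 : dot f f * (K (x_ n) (x_ n) - K (x_ n) x - (K x (x_ n) - K x x))
    @[n --> \oo] --> dot f f * (K x x - K x x - (K x x - K x x)).
  by apply: cvgMr; apply: cvgB; apply: cvgB => //; exact: cvg_cst.
rewrite !subrr mulr0 in c0.
apply/cvgrPdist_le => e e0; near=> n.
rewrite distrC -ler_sqr ?nnegrE ?(ltW e0)// real_normK ?num_real//.
apply: le_trans (rkhs_increment _ _ df) _.
have : `|0 - dot f f * (K (x_ n) (x_ n) - K (x_ n) x - (K x (x_ n) - K x x))| <= e ^+ 2.
  by near: n; move/cvgrPdist_le: c0; apply; rewrite exprn_gt0.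
by rewrite sub0r normrN => /(le_trans (ler_norm _)).
Unshelve. all: by end_near. Qed.

End RKHSBounds.

(** * Riemann sums over the cube *)

Section GridIntegral.
Variable R : realType.

(** Half-open, except that the last cell contains 1, so that the cells partition [0, 1]. *)
Definition grid_cell M (a : 'I_M) : set R :=
  [set` Interval (BLeft (a%:R / M%:R)) (BSide (a.+1 != M) (a.+1%:R / M%:R))].

Lemma grid_cellP M (a : 'I_M) (x : R) : grid_cell a x ->
  [/\ 0 <= x, x <= 1, a%:R / M%:R <= x & x <= a.+1%:R / M%:R].
Proof.
rewrite /grid_cell/= itv_boundlr/= => /andP[ax xa].
rewrite bnd_simp in ax.
have M0 : (0 : R) < M%:R by rewrite ltr0n (leq_ltn_trans _ (ltn_ord a)).
have {}xa : x <= a.+1%:R / M%:R.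
  by move: xa; case: (a.+1 != M); rewrite bnd_simp // => /ltW.
split=> //; first by rewrite (le_trans _ ax)// divr_ge0// ltW.
by rewrite (le_trans xa)// ler_pdivrMr// mul1r ler_nat.
Qed.

Lemma grid_cell_inj M (a a' : 'I_M) x : grid_cell a x -> grid_cell a' x -> a = a'.
Proof.
have M0 : (0 : R) < M%:R by rewrite ltr0n (leq_ltn_trans _ (ltn_ord a)).
suff le (c c' : 'I_M) : grid_cell c x -> grid_cell c' x -> (c' <= c)%N.
  by move=> ha ha'; apply/val_inj/eqP; rewrite eqn_leq !le.
rewrite /grid_cell/= !itv_boundlr/= => /andP[_ xc] /andP[c'x _].
rewrite bnd_simp in c'x; have [cM|cM] := eqVneq c.+1 M.
  by rewrite -ltnS cM.
move: xc; rewrite cM bnd_simp => /(le_lt_trans c'x).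
by rewrite ltr_pM2r ?invr_gt0// ltr_nat ltnS.
Qed.

Lemma grid_cell_ex M x : (0 < M)%N -> 0 <= x <= 1 -> exists a : 'I_M, grid_cell a x.
Proof.
move=> M0 /andP[x0 x1]; have MR0 : (0 : R) < M%:R by rewrite ltr0n.
have xM : 0 <= x * M%:R by rewrite mulr_ge0// ltW.
have /andP[t1 t2] := truncn_itv xM; set t := Num.truncn _ in t1 t2.
have tM : (t <= M)%N by rewrite -(ler_nat R) (le_trans t1)// ler_piMl// ltW.
have [e|tM'] := eqVneq t M.
  have M1 : (M.-1 < M)%N by rewrite prednK.
  exists (Ordinal M1); rewrite /grid_cell/= itv_boundlr/= prednK// eqxx/= !bnd_simp.
  rewrite divff ?gt_eqF// x1 andbT ler_pdivrMr// (le_trans _ t1)// ler_nat e.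
  exact: leq_pred.
have tM2 : (t < M)%N by rewrite ltn_neqAle tM'.
exists (Ordinal tM2); rewrite /grid_cell/= itv_boundlr/= !bnd_simp.
rewrite ler_pdivrMr// t1/=; have xt : x < t.+1%:R / M%:R by rewrite ltr_pdivlMr.
by case: (t.+1 != M); rewrite !bnd_simp // ltW.
Qed.

Lemma measurable_grid_cell M (a : 'I_M) :
  measurable (grid_cell a : set (measurableTypeR R)).
Proof. exact: measurable_itv. Qed.

Lemma uniform_grid_cell M (a : 'I_M) :
  uniform_prob (@ltr01 R) (grid_cell a) = (M%:R^-1)%:E.
Proof.
have M0 : (0 : R) < M%:R by rewrite ltr0n (leq_ltn_trans _ (ltn_ord a)).
rewrite /uniform_prob (eq_integral (cst 1%:E)); last first.
  move=> x; rewrite inE => /grid_cellP[x0 x1 _ _].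
  by rewrite /uniform_pdf x0 x1/= subr0 invr1.
rewrite integral_cst; last exact: measurable_grid_cell.
rewrite mul1e /grid_cell; transitivity (lebesgue_measure [set` Interval (BLeft (a%:R / M%:R : R)) (BSide (a.+1 != M) (a.+1%:R / M%:R))]) => //.
rewrite lebesgue_measure_itv/= lte_fin ltr_pM2r ?invr_gt0// ltr_nat ltnSn.
by rewrite -EFinB -mulrBl -[a.+1%:R]natr1 addrAC subrr add0r mul1r.
Qed.

Lemma measurable_box s (A : 'I_s -> set (measurableTypeR R)) :
  (forall j, measurable (A j)) ->
  measurable [set x : s.-tuple (measurableTypeR R) | forall j, A j (tnth x j)].
Proof.
move=> mA.
have -> : [set x : s.-tuple (measurableTypeR R) | forall j, A j (tnth x j)] =
    \bigcap_(j in [set: 'I_s]) ((fun x => tnth x j) @^-1` A j).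
  by apply/seteqP; split=> x /= h j; [move=> _|]; apply: h.
apply: fin_bigcap_measurable => // j _.
rewrite -[X in measurable X]setTI; exact: (@measurable_tnth _ _ s j measurableT _ (mA j)).
Qed.

Lemma cube_measure_box s (A : 'I_s -> set (measurableTypeR R)) :
  (forall j, measurable (A j)) ->
  cube_measure R s [set x | forall j, A j (tnth x j)] =
  (\prod_j uniform_prob (@ltr01 R) (A j))%E.
Proof.
elim: s A => [|s IH] A mA.
  rewrite big_ord0 /= diracE mem_set//= => -[].
  by [].
rewrite big_ord_recl -IH// /= /distribution /pushforward.
transitivity ((uniform_prob (@ltr01 R) \x cube_measure R s)%E
    (A ord0 `*` [set x : s.-tuple (measurableTypeR R) |
       forall j, A (lift ord0 j) (tnth x j)])).
  congr (_ _); apply/seteqP; split=> -[x t] /=.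
    move=> h; split; first by have := h ord0; rewrite tnth0.
    by move=> j; have := h (lift ord0 j); rewrite tnthS.
  move=> [h0 h] j; case: (unliftP ord0 j) => [j'|] ->; first by rewrite tnthS.
  by rewrite tnth0.
rewrite product_measure1E//.
exact: (@measurable_box s (fun j => A (lift ord0 j)) (fun j => mA _)).
Qed.

Section Grid.
Variable s : nat.
Local Notation T := (s.-tuple (measurableTypeR R)).

Definition grid_point M (a : {ffun 'I_s -> 'I_M}) : s.-tuple R :=
  [tuple (a j)%:R / M%:R | j < s].

Definition grid_box M (a : {ffun 'I_s -> 'I_M}) : set T :=
  [set x | forall j, grid_cell (a j) (tnth x j)].

Lemma measurable_grid_box M (a : {ffun 'I_s -> 'I_M}) : measurable (grid_box a).
Proof.
exact: (@measurable_box s (fun j => grid_cell (a j))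
  (fun j => measurable_grid_cell (a j))).
Qed.

Lemma cube_measure_grid_box M (a : {ffun 'I_s -> 'I_M}) :
  cube_measure R s (grid_box a) = ((M ^ s)%:R^-1)%:E.
Proof.
rewrite (@cube_measure_box s (fun j => grid_cell (a j)) (fun j => measurable_grid_cell (a j))).
under eq_bigr do rewrite uniform_grid_cell.
by rewrite prodEFin prodr_const card_ord natrX exprVn.
Qed.

Definition grid_fun M (f : s.-tuple R -> R) (x : T) : R :=
  \sum_(a : {ffun 'I_s -> 'I_M}) f (grid_point a) * \1_(grid_box a) x.

Lemma grid_funE M f (a : {ffun 'I_s -> 'I_M}) x :
  grid_box a x -> grid_fun M f x = f (grid_point a).
Proof.
move=> ax; rewrite /grid_fun (bigD1 a)//= indicE mem_set// mulr1 big1 ?addr0// => a' aa'.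
rewrite indicE memNset ?mulr0// => a'x; case/eqP: aa'.
by apply/ffunP => j; exact: grid_cell_inj (a'x j) (ax j).
Qed.

Lemma measurable_grid_fun M f : measurable_fun setT (grid_fun M f).
Proof.
apply: measurable_sum => a; apply: measurable_funM; first exact: measurable_cst.
exact: (measurable_indic (measurable_grid_box a)).
Qed.

Lemma integral_grid_fun M f :
  (\int[cube_measure R s]_x (grid_fun M f x)%:E)%E =
  ((\sum_(a : {ffun 'I_s -> 'I_M}) f (grid_point a)) / (M ^ s)%:R)%:E.
Proof.
under eq_integral do rewrite /grid_fun -sumEFin.
have int_ind a : (cube_measure R s).-integrable setT
    (fun x => (\1_(@grid_box M a) x)%:E).
  exact: (integrable_indic (cube_measure R s) (measurable_grid_box a)).
rewrite integral_sum//; last first.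
  move=> a; under eq_fun do rewrite EFinM.
  exact/integrableZl.
rewrite mulr_suml -sumEFin; apply: eq_bigr => a _.
under eq_integral do rewrite EFinM.
rewrite integralZl// integral_indic//; last exact: measurable_grid_box.
by rewrite setIT EFinM; congr (_ * _)%E; exact: cube_measure_grid_box.
Qed.

Definition cube_continuous (f : cube R s -> R) :=
  forall (x_ : nat -> cube R s) x,
    (forall j, tnth (val (x_ n)) j @[n --> \oo] --> tnth (val x) j) ->
    f (x_ n) @[n --> \oo] --> f x.

Lemma grid_point_in_cube M (a : {ffun 'I_s -> 'I_M}) : in_cube (grid_point a).
Proof.
apply/forallP => j; rewrite tnth_mktuple.
have M0 : (0 : R) < M%:R by rewrite ltr0n (leq_ltn_trans _ (ltn_ord (a j))).
by rewrite divr_ge0 ?ler_pdivrMr//= ?mul1r ?ler_nat 1?ltnW// ltW.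
Qed.

Lemma cube_extendE (f : cube R s -> R) x (xc : in_cube x) :
  cube_extend f x = f (Sub x xc).
Proof. by rewrite /cube_extend insubT. Qed.

(** The averages are integrals of the step functions [grid_fun], which converge pointwise by
    sequential continuity and are dominated by B. Measurability of f comes from the same limit. *)
Lemma grid_average_cvg (f : cube R s -> R) (B : R) (M_ : nat -> nat) :
  (forall x, `|f x| <= B) -> cube_continuous f ->
  (forall n, (0 < M_ n)%N) -> ((M_ n)%:R^-1 : R) @[n --> \oo] --> (0 : R) ->
  (\sum_(a : {ffun 'I_s -> 'I_(M_ n)}) cube_extend f (grid_point a)) / (M_ n ^ s)%:R
    @[n --> \oo] --> cube_int f.
Proof.
move=> fB fc M0 Mcv.
have B0 : 0 <= B.
  have c0 : in_cube (nseq_tuple s (0 : R)).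
    by apply/forallP => j; rewrite tnth_nseq lexx ler01.
  exact: le_trans (normr_ge0 _) (fB (Sub _ c0)).
have feB x : `|cube_extend f x| <= B.
  by rewrite /cube_extend; case: insubP => [u _ _|_] //=; rewrite normr0.
pose g n := grid_fun (M_ n) (cube_extend f).
have cell_ex (x : T) n : in_cube x -> exists a : {ffun 'I_s -> 'I_(M_ n)}, grid_box a x.
  move=> /forallP xc.
  have ex j : exists a : 'I_(M_ n), grid_cell a (tnth x j) by exact: grid_cell_ex.
  by exists [ffun j => projT1 (cid (ex j))] => j; rewrite ffunE; case: cid.
have cell_in n (a : {ffun 'I_s -> 'I_(M_ n)}) (x : T) : grid_box a x -> in_cube x.
  by move=> ax; apply/forallP => j; have [-> -> _ _] := grid_cellP (ax j).
have gB n x : `|g n x| <= B.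
  have [xc|xc] := boolP (in_cube x).
    by have [a ax] := cell_ex x n xc; rewrite /g (grid_funE _ ax).
  rewrite /g /grid_fun big1 ?normr0// => a _.
  by rewrite indicE memNset ?mulr0// => /cell_in; rewrite (negbTE xc).
have gcv x : g n x @[n --> \oo] --> cube_extend f x.
  have [xc|xc] := boolP (in_cube x); last first.
    have -> : cube_extend f x = 0 by rewrite /cube_extend insubN.
    rewrite (_ : (fun n => g n x) = cst 0); first exact: cvg_cst.
    apply/funext => n; rewrite /g /grid_fun big1// => a _.
    by rewrite indicE memNset ?mulr0// => /cell_in; rewrite (negbTE xc).
  pose a n := projT1 (cid (cell_ex x n xc)).
  have ax n : grid_box (a n) x by rewrite /a; case: cid.
  pose y n : cube R s := Sub (grid_point (a n)) (grid_point_in_cube (a n)).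
  rewrite (_ : (fun n => g n x) = (fun n => f (y n))); last first.
    apply/funext => n; rewrite /g (grid_funE _ (ax n)).
    by rewrite (cube_extendE _ (grid_point_in_cube (a n))).
  rewrite (cube_extendE _ xc); apply: fc => j.
  apply/cvgrPdist_le => e e0; near=> n.
  rewrite /= tnth_mktuple.
  have [_ _ l1 l2] := grid_cellP (ax n j).
  have Me : `|(M_ n)%:R^-1 : R| <= e.
    near: n; move/cvgrPdist_le: Mcv => /(_ e e0); apply: filterS => n.
    by rewrite sub0r normrN.
  rewrite ger0_norm ?subr_ge0// (le_trans _ Me)// (le_trans _ (ler_norm _))//.
  rewrite lerBlDl (le_trans l2)// -[(_.+1)%:R]natr1 mulrDl mul1r//.
have mg n : measurable_fun setT (fun x : T => (g n x)%:E).
  by apply/measurable_EFinP; exact: (@measurable_grid_fun (M_ n) (cube_extend f)).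
have gcvE x : (g n x)%:E @[n --> \oo] --> (cube_extend f x)%:E.
  by apply: cvg_EFin; [exact: nearW|exact: gcv].
have [intf _] := @dominated_convergence _ T R (cube_measure R s) setT measurableT
  (fun n x => (g n x)%:E) (fun x => (cube_extend f x)%:E) (cst B%:E) mg
  (emeasurable_fun_cvg _ _ mg (fun x _ => gcvE x))
  (aeW _ (fun x _ => gcvE x)) (finite_measure_integrable_cst _ B measurableT)
  (aeW _ (fun x n _ => (gB n x : (`|(g n x)%:E| <= B%:E)%E))).
rewrite -(fineK (integrable_fin_num measurableT intf)) => /fine_cvg cv.
rewrite [X in X @ _ --> _](_ : _ = fine \o [sequence
  (\int[cube_measure R s]_x (g n x)%:E)%E]_n)//.
by apply/funext => n; rewrite /= /g integral_grid_fun.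
Unshelve. all: by end_near. Qed.

End Grid.
End GridIntegral.

(** * Continuity and boundedness of the Sobolev kernel *)

Section KernelContinuity.
Variable R : realType.

Lemma cvg_bigprod (I : Type) (r : seq I) (P : pred I) (u_ : I -> nat -> R) (u : I -> R) :
  (forall i, u_ i n @[n --> \oo] --> u i) ->
  \prod_(i <- r | P i) u_ i n @[n --> \oo] --> \prod_(i <- r | P i) u i.
Proof.
move=> ucv; elim: r => [|i r IH].
  by rewrite big_nil; under eq_cvg do rewrite big_nil; exact: cvg_cst.
rewrite big_cons; under eq_cvg do rewrite big_cons.
by case: (P i) => //; exact: cvgM.
Qed.

Lemma cvg_bigsum (I : Type) (r : seq I) (P : pred I) (u_ : I -> nat -> R) (u : I -> R) :
  (forall i, u_ i n @[n --> \oo] --> u i) ->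
  \sum_(i <- r | P i) u_ i n @[n --> \oo] --> \sum_(i <- r | P i) u i.
Proof.
move=> ucv; elim: r => [|i r IH].
  by rewrite big_nil; under eq_cvg do rewrite big_nil; exact: cvg_cst.
rewrite big_cons; under eq_cvg do rewrite big_cons.
by case: (P i) => //; exact: cvgD.
Qed.

Lemma cvg_horner (p : {poly R}) (u_ : nat -> R) (u : R) :
  u_ n @[n --> \oo] --> u -> p.[u_ n] @[n --> \oo] --> p.[u].
Proof. by move=> ucv; apply: continuous_cvg => //; exact: continuous_horner. Qed.

Lemma sobolev_kernel1_cvg alpha (u_ v_ : nat -> R) (u v : R) :
  u_ n @[n --> \oo] --> u -> v_ n @[n --> \oo] --> v ->
  sobolev_kernel1 alpha (u_ n) (v_ n) @[n --> \oo] --> sobolev_kernel1 alpha u v.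
Proof.
move=> ucv vcv; apply: cvgD.
  apply: cvg_bigsum => r; apply: cvgM; last exact: cvg_cst.
  by apply: cvgM; exact: cvg_horner.
apply: cvgM; last exact: cvg_cst.
apply: cvgM; first exact: cvg_cst.
by apply: cvg_horner; apply: cvg_norm; exact: cvgB.
Qed.

Lemma sobolev_kernel_cvg alpha s (gamma : {set 'I_s} -> R) (x_ y_ : nat -> cube R s) x y :
  (forall j, tnth (val (x_ n)) j @[n --> \oo] --> tnth (val x) j) ->
  (forall j, tnth (val (y_ n)) j @[n --> \oo] --> tnth (val y) j) ->
  sobolev_kernel alpha gamma (x_ n) (y_ n) @[n --> \oo] --> sobolev_kernel alpha gamma x y.
Proof.
move=> xcv ycv; apply: cvg_bigsum => u; apply: cvgM; first exact: cvg_cst.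
apply: cvg_bigprod => j.
exact: sobolev_kernel1_cvg (xcv j) (ycv j).
Qed.

Definition coef_norm (p : {poly R}) : R := \sum_(i < size p) `|p`_i|.

Lemma horner_coef_norm (p : {poly R}) x : 0 <= x <= 1 -> `|p.[x]| <= coef_norm p.
Proof.
move=> /andP[x0 x1]; rewrite horner_coef (le_trans (ler_norm_sum _ _ _))//.
apply: ler_sum => i _; rewrite normrM ler_piMr// normrX (ger0_norm x0).
by rewrite exprn_ile1.
Qed.

Lemma sobolev_kernel1_bounded alpha : exists2 B : R, 0 <= B &
  forall x y, 0 <= x <= 1 -> 0 <= y <= 1 -> `|sobolev_kernel1 alpha x y| <= B.
Proof.
have cn0 p : 0 <= coef_norm p by apply: sumr_ge0.
exists (\sum_(1 <= r < alpha.+1) coef_norm (bernoulli_poly R r) *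
    coef_norm (bernoulli_poly R r) / r`!%:R ^+ 2 +
  coef_norm (bernoulli_poly R (2 * alpha)) / (2 * alpha)`!%:R).
  rewrite addr_ge0 ?divr_ge0// sumr_ge0// => r _.
  by rewrite divr_ge0 ?mulr_ge0 ?exprn_ge0.
move=> x y x01 y01; rewrite (le_trans (ler_normD _ _))// lerD//.
  rewrite (le_trans (ler_norm_sum _ _ _))//; apply: ler_sum => r _.
  rewrite normrM normfV [X in _ / X]ger0_norm ?exprn_ge0// ler_wpM2r ?invr_ge0 ?exprn_ge0//.
  by rewrite normrM ler_pM// horner_coef_norm.
rewrite normrM normfV normrM normrX normrN1 expr1n mul1r [X in _ / X]ger0_norm//.
rewrite ler_wpM2r ?invr_ge0// horner_coef_norm// normr_ge0/= ler_norml.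
by move: x01 y01; lra.
Qed.

Lemma tnth_cube01 s (x : cube R s) j : 0 <= tnth (val x) j <= 1.
Proof. exact: (forallP (valP x) j). Qed.

Lemma sobolev_kernel_bounded alpha s (gamma : {set 'I_s} -> R) :
  exists2 B : R, 0 <= B & forall x y, `|sobolev_kernel alpha gamma x y| <= B.
Proof.
have [B B0 hB] := sobolev_kernel1_bounded alpha.
exists (\sum_(u : {set 'I_s}) `|gamma u| * \prod_(j in u) B).
  by apply: sumr_ge0 => u _; rewrite mulr_ge0// prodr_ge0.
move=> x y; rewrite (le_trans (ler_norm_sum _ _ _))//; apply: ler_sum => u _.
rewrite normrM ler_wpM2l// normr_prod; apply: ler_prod => j _.
by rewrite normr_ge0/=; apply: (hB _ _ (tnth_cube01 x j) (tnth_cube01 y j)).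
Qed.

End KernelContinuity.

(** * Point values and integrals as limits over truncated digits *)

Section ErrorLimit.
Variables (R : realType) (b : nat) (b_prime : prime b).
Variables (alpha s : nat) (gamma : {set 'I_s} -> R).
Variable H : rkhs (sobolev_kernel alpha gamma).
Local Notation F := 'F_b.

Lemma rkhs_cube_continuous f : rkhs_dom H f -> cube_continuous f.
Proof.
move=> df x_ x xcv; have cstcv j : tnth (val x) j @[_ --> \oo] --> tnth (val x) j.
  exact: cvg_cst.
by apply: rkhs_cvg df _ _ _; exact: sobolev_kernel_cvg.
Qed.

Lemma rkhs_cube_bounded f : rkhs_dom H f -> exists B, forall x, `|f x| <= B.
Proof.
move=> df; have [B B0 hB] := sobolev_kernel_bounded alpha gamma.
exists (Num.sqrt (rkhs_dot H f f * B)) => x.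
have ff := rkhs_dot_ge0 df.
rewrite -ler_sqr ?nnegrE ?sqrtr_ge0// sqr_sqrtr ?mulr_ge0// real_normK ?num_real//.
apply: le_trans (rkhs_evaluation x df) _.
by rewrite ler_wpM2l// (le_trans (ler_norm _)).
Qed.

Definition digit_point N (x : 'I_s -> N.-tuple F) : s.-tuple R := [tuple rval R (x j) | j < s].

Lemma digit_point_in_cube N (x : 'I_s -> N.-tuple F) : in_cube (digit_point x).
Proof. by apply/forallP => j; rewrite tnth_mktuple rval_ge0// rval_le1. Qed.

Definition digit_cube N (x : 'I_s -> N.-tuple F) : cube R s :=
  Sub (digit_point x) (digit_point_in_cube x).

Lemma digit_proj_cvg (z : digitseq b) :
  rval R (trunc N z) @[N --> \oo] --> digit_proj R z.
Proof.
under eq_cvg do rewrite (rval_trunc R).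
apply: nondecreasing_is_cvgn.
  apply/nondecreasing_seqP => N; rewrite seriesSr lerDl divr_ge0// exprn_ge0//.
exists 1 => _ [N _ <-]; rewrite -(rval_trunc R); exact: rval_le1.
Qed.

Lemma digit_cube_cvg f (z : 'I_s -> digitseq b) : rkhs_dom H f ->
  f (digit_cube (fun j => trunc N (z j))) @[N --> \oo] --> cube_extend f (net_proj R z).
Proof.
move=> df; rewrite (cube_extendE f (net_proj_in_cube R z b_prime)).
apply: rkhs_cube_continuous df _ _ _ => j.
rewrite /= tnth_mktuple; under eq_cvg do rewrite tnth_mktuple.
exact: digit_proj_cvg.
Qed.

(** The values of N-digit lists are the multiples of b^-N in [0, 1), that is, the lower corners of
    the grid cells. *)
Lemma digit_average_cvg f : rkhs_dom H f ->
  (\sum_(x : {ffun 'I_s -> N.-tuple F}) f (digit_cube x)) / ((b ^ N) ^ s)%:R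
    @[N --> \oo] --> cube_int f.
Proof.
move=> df; have [B fB] := rkhs_cube_bounded df.
have b0 := prime_gt0 b_prime.
have b1 : 1 < b%:R :> R by rewrite ltr1n prime_gt1.
have cv : ((b ^ N)%:R^-1 : R) @[N --> \oo] --> (0 : R).
  under eq_cvg do rewrite natrX -exprVn.
  by apply: cvg_expr; rewrite ger0_norm ?invr_ge0// invf_lt1// (lt_trans ltr01).
have bN N : (0 < b ^ N)%N by rewrite expn_gt0 b0.
suff E N : (\sum_(x : {ffun 'I_s -> N.-tuple F}) f (digit_cube x)) / ((b ^ N) ^ s)%:R =
    (\sum_(a : {ffun 'I_s -> 'I_(b ^ N)}) cube_extend f (grid_point R a)) / ((b ^ N) ^ s)%:R.
  under eq_cvg do rewrite E.
  exact: (grid_average_cvg (M_ := fun N => b ^ N)%N fB (rkhs_cube_continuous df) bN cv).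
congr (_ / _).
have lt (t : N.-tuple F) : (nval t < b ^ N)%N.
  by have := nval_lt b_prime t; rewrite size_tuple.
pose h (x : {ffun 'I_s -> N.-tuple F}) : {ffun 'I_s -> 'I_(b ^ N)} :=
  [ffun j => Ordinal (lt (x j))].
have hb : bijective h.
  apply: inj_card_bij; last by rewrite !card_ffun !card_ord card_tuple card_Fp.
  move=> x y /ffunP xy; apply/ffunP => j.
  have /(congr1 val)/= := xy j; rewrite !ffunE/= => e.
  by apply/val_inj/(nval_inj b_prime) => //; rewrite !size_tuple.
rewrite [RHS](reindex h) /=; last exact: onW_bij.
apply: eq_bigr => x _; apply/esym.
rewrite (cube_extendE f (grid_point_in_cube R (h x))); congr f; apply: val_inj => /=.
apply: eq_from_tnth => j; rewrite !tnth_mktuple ffunE/= rval_nval// size_tuple.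
by rewrite natrX.
Qed.

End ErrorLimit.

(** * The error of the truncated lattice *)

Section WalshQuadratic.
Variables (R : realType) (b : nat) (b_prime : prime b).
Variables (psi : 'F_b -> R[i]) (psi_char : add_char psi).
Local Notation F := 'F_b.

Definition zdigits N : N.-tuple F := [tuple of nseq N 0].

Lemma dot_zdigits N (k : seq F) : dot k (zdigits N) = 0.
Proof.
by elim: k N => [|c k IH] [|N] //=; rewrite mulr0 add0r; exact: IH.
Qed.

Lemma wcoef2_1 N (k l : N.-tuple F) :
  wcoef2 psi (fun _ _ : N.-tuple F => 1) k l = ((k == zdigits N) && (l == zdigits N))%:R.
Proof.
have sum1 (k' : N.-tuple F) : \sum_(x : N.-tuple F) psi (- dot k' x) =
    (if k' == zdigits N then b ^ N else 0)%N%:R.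
  rewrite eq_sym -(sum_psi_dot b_prime psi_char); apply: eq_bigr => x _.
  by rewrite dot_zdigits sub0r dotC.
have bn0 : (b ^ N)%:R != 0 :> R[i] by rewrite pnatr_eq0 expn_eq0 gtn_eqF// prime_gt0.
transitivity ((\sum_(x : N.-tuple F) psi (- dot k x)) *
    (\sum_(y : N.-tuple F) psi (- dot l y)) / (b ^ N)%:R ^+ 2).
  rewrite /wcoef2; congr (_ / _); rewrite mulr_suml; apply: eq_bigr => x _.
  rewrite mulr_sumr; apply: eq_bigr => y _.
  by rewrite opprD (psiD psi_char) mulr1.
rewrite !sum1; case: (k == _); case: (l == _); rewrite ?mulr0 ?mul0r//=.
by rewrite -expr2 divff// expf_neq0.
Qed.

Variables (s N : nat).
Local Notation X := {ffun 'I_s -> N.-tuple F}.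

Definition fdot (k x : X) : F := \sum_j dot (k j) (x j).

Definition fzero : X := [ffun=> zdigits N].

Definition walsh_transform (w : X -> R) (k : X) : R[i] :=
  \sum_(x : X) (w x)%:C%C * psi (fdot k x).

Lemma sum_psi_fdot (k : X) :
  \sum_(x : X) psi (fdot k x) = (if k == fzero then ((b ^ N) ^ s)%N else 0%N)%:R.
Proof.
under eq_bigr do rewrite /fdot (psi_sum psi_char).
rewrite -(bigA_distr_bigA (fun j (t : N.-tuple F) => psi (dot (k j) t))).
have sum1 (k' : N.-tuple F) : \sum_(t : N.-tuple F) psi (dot k' t) =
    (if k' == zdigits N then b ^ N else 0)%N%:R.
  rewrite -(sum_psi_dot b_prime psi_char); apply: eq_bigr => t _.
  by rewrite dot_zdigits subr0 dotC.
under eq_bigr do rewrite sum1.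
case: eqP => [->|/eqP kN0].
  under eq_bigr do rewrite ffunE eqxx.
  by rewrite prodr_const card_ord -natrX.
have [j kj] : exists j, k j != zdigits N.
  apply/existsP; apply: contraNT kN0; rewrite negb_exists => /forallP h.
  by apply/eqP/ffunP => j; rewrite ffunE; apply/eqP; move: (h j); rewrite negbK.
by rewrite (bigD1 j)//= (negbTE kj) mul0r.
Qed.

(** Expanding every factor in both variables gives a double sum over (k, l); the product bound on
    the coefficients separates k from l and leaves a square. *)
Lemma walsh_quadratic (w : X -> R) (G : 'I_s -> N.-tuple F -> N.-tuple F -> R)
    (M : 'I_s -> R) (rho : 'I_s -> N.-tuple F -> R) :
  (forall j, 0 <= M j) -> (forall j k, 0 <= rho j k) ->
  (forall j k l, normc (wcoef2 psi (fun x y => (G j x y)%:C%C) k l) <=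
     M j * (rho j k * rho j l)) ->
  `|\sum_(x : X) \sum_(y : X) w x * w y * \prod_j G j (x j) (y j)| <=
  \prod_j M j * (\sum_(k : X) normc (walsh_transform w k) * \prod_j rho j (k j)) ^+ 2.
Proof.
move=> M0 rho0 Gle; set c := fun j => wcoef2 psi (fun x y => (G j x y)%:C%C).
have GE (x y : X) : (\prod_j G j (x j) (y j))%:C%C =
    \sum_(k : X) \sum_(l : X) (\prod_j c j (k j) (l j)) * psi (fdot k x) * psi (fdot l y).
  rewrite rmorph_prod/=.
  under eq_bigr => j _.
    rewrite (wcoef2_inv b_prime psi_char (fun x y => (G j x y)%:C%C) (x j) (y j)); over.
  rewrite (bigA_distr_bigA (fun j (k : N.-tuple F) => \sum_(l : N.-tuple F)
    c j k l * psi (dot k (x j) + dot l (y j)))).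
  apply: eq_bigr => k _.
  rewrite (bigA_distr_bigA (fun j (l : N.-tuple F) =>
    c j (k j) l * psi (dot (k j) (x j) + dot l (y j)))).
  apply: eq_bigr => l _.
  rewrite big_split/= -mulrA; congr (_ * _).
  rewrite /fdot !(psi_sum psi_char) -big_split/=; apply: eq_bigr => j _.
  by rewrite (psiD psi_char).
have E : (\sum_(x : X) \sum_(y : X) w x * w y * \prod_j G j (x j) (y j))%:C%C =
    \sum_(k : X) \sum_(l : X) (\prod_j c j (k j) (l j)) *
      (walsh_transform w k * walsh_transform w l).
  rewrite rmorph_sum/=; under eq_bigr => x _.
    rewrite rmorph_sum/=; under eq_bigr => y _.
      rewrite rmorphM/= GE mulr_sumr; under eq_bigr do rewrite mulr_sumr.
      over.
    rewrite exchange_big/=; under eq_bigr do rewrite exchange_big/=.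
    over.
  rewrite exchange_big/=; apply: eq_bigr => k _.
  rewrite exchange_big/=; apply: eq_bigr => l _.
  rewrite /walsh_transform mulr_suml mulr_sumr; apply: eq_bigr => x _.
  rewrite !mulr_sumr; apply: eq_bigr => y _.
  by rewrite rmorphM/=; ring.
rewrite -normc_real E (le_trans (normc_sum _ _ _))//.
rewrite expr2 mulr_suml mulr_sumr; apply: ler_sum => k _.
rewrite (le_trans (normc_sum _ _ _))// !mulr_sumr; apply: ler_sum => l _.
rewrite !normcM normc_prod.
have -> : \prod_j M j * (normc (walsh_transform w k) * \prod_j rho j (k j) *
    (normc (walsh_transform w l) * \prod_j rho j (l j))) =
    (\prod_j (M j * (rho j (k j) * rho j (l j)))) *
    (normc (walsh_transform w k) * normc (walsh_transform w l)).
  by rewrite !big_split/=; ring.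
apply: ler_wpM2r; first by rewrite mulr_ge0// normc_nneg.
by apply: ler_prod => j _; rewrite normc_nneg Gle.
Qed.

End WalshQuadratic.

Section LatticeError.
Variables (R : realType) (b : nat) (b_prime : prime b).
Variables (psi : 'F_b -> R[i]) (psi_char : add_char psi).
Local Notation F := 'F_b.

Lemma sum_sqr_le (I : Type) (r : seq I) (a : I -> R) : (forall i, 0 <= a i) ->
  \sum_(i <- r) a i ^+ 2 <= (\sum_(i <- r) a i) ^+ 2.
Proof.
move=> a0; elim: r => [|i r IH]; first by rewrite !big_nil expr0n.
rewrite !big_cons sqrrD (le_trans (lerD (lexx _) IH))// lerD2r lerDl.
by rewrite mulrn_wge0// mulr_ge0// sumr_ge0.
Qed.

Variables (alpha s : nat).

(** Outside u the kernel factor is 1, whose only non-zero Walsh coefficient is at (0, 0); hence the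
    indicator. *)
Definition dual_weight N (u : {set 'I_s}) (k : {ffun 'I_s -> N.-tuple F}) : R :=
  \prod_j (if j \in u then dw R alpha (k j) else (k j == zdigits b N)%:R).

Lemma dual_weight_ge0 N u (k : {ffun 'I_s -> N.-tuple F}) : 0 <= dual_weight u k.
Proof. by apply: prodr_ge0 => j _; case: ifP => // _; exact: dw_ge0. Qed.

(** Each u contributes gamma_u times a square, and a sum of squares is at most the square of the
    sum; the root leaves gamma_u^(1/2). *)
Lemma rkhs_walsh_bound (M : R) : 0 <= M ->
  (forall n (k l : n.-tuple F), normc (wcoef2 psi (fun x y : n.-tuple F =>
     (sobolev_kernel1 alpha (rval R x) (rval R y))%:C%C) k l)
       <= M * (dw R alpha k * dw R alpha l)) ->
  forall (gamma : {set 'I_s} -> R) (H : rkhs (sobolev_kernel alpha gamma)) N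
    (w : {ffun 'I_s -> N.-tuple F} -> R) f,
  (forall u, 0 <= gamma u) -> rkhs_dom H f -> rkhs_dot H f f <= 1 ->
  `|\sum_(x : {ffun 'I_s -> N.-tuple F}) w x * f (digit_cube R b_prime x)| <=
  \sum_(u : {set 'I_s}) Num.sqrt (gamma u) * Num.sqrt M ^+ #|u| *
    \sum_(k : {ffun 'I_s -> N.-tuple F}) normc (walsh_transform psi w k) * dual_weight u k.
Proof.
move=> M0 hM gamma H N w f gamma0 df f1; set X : finType := ({ffun 'I_s -> N.-tuple F} : finType).
pose S u := \sum_(k : X) normc (walsh_transform psi w k) * dual_weight u k.
have S0 u : 0 <= S u.
  by apply: sumr_ge0 => k _; rewrite mulr_ge0 ?normc_nneg// dual_weight_ge0.
pose a u := Num.sqrt (gamma u) * Num.sqrt M ^+ #|u| * S u.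
have a0 u : 0 <= a u by rewrite !mulr_ge0 ?exprn_ge0 ?sqrtr_ge0.
have A0 : 0 <= \sum_u a u by apply: sumr_ge0.
suff : (\sum_(x : X) w x * f (digit_cube R b_prime x)) ^+ 2 <= (\sum_u a u) ^+ 2.
  by rewrite -[X in X <= _]real_normK ?num_real// ler_sqr.
apply: le_trans (rkhs_quadrature w (fun x : X => digit_cube R b_prime x) df) _.
set Q := \sum_(x : X) _.
have QE : Q = \sum_u gamma u * \sum_(x : X) \sum_(y : X) w x * w y *
    \prod_j (if j \in u then sobolev_kernel1 alpha (rval R (x j)) (rval R (y j)) else 1).
  under [RHS]eq_bigr do rewrite mulr_sumr.
  rewrite [RHS]exchange_big/=; apply: eq_bigr => x _.
  under [RHS]eq_bigr do rewrite mulr_sumr.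
  rewrite [RHS]exchange_big/=; apply: eq_bigr => y _.
  rewrite /sobolev_kernel mulr_sumr; apply: eq_bigr => u _.
  rewrite mulrCA; congr (_ * (_ * _)).
  rewrite big_mkcond/=; apply: eq_bigr => j _; case: ifP => // _.
  by rewrite !tnth_mktuple.
have Qle : Q <= \sum_u a u ^+ 2.
  rewrite QE; apply: ler_sum => u _; rewrite /a !exprMn sqr_sqrtr//.
  rewrite -mulrA ler_wpM2l// (le_trans (ler_norm _))//.
  pose G (j : 'I_s) (x y : N.-tuple F) : R :=
    if j \in u then sobolev_kernel1 alpha (rval R x) (rval R y) else 1.
  pose Mj (j : 'I_s) : R := if j \in u then M else 1.
  pose rho (j : 'I_s) (k : N.-tuple F) : R :=
    if j \in u then dw R alpha k else (k == zdigits b N)%:R.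
  apply: le_trans (@walsh_quadratic _ _ b_prime _ psi_char s N w G Mj rho _ _ _) _.
  - by move=> j; rewrite /Mj; case: ifP.
  - by move=> j k; rewrite /rho; case: ifP => // _; exact: dw_ge0.
  - move=> j k l; rewrite /G /Mj /rho; case: ifP => ju; first exact: hM.
    rewrite (wcoef2_1 b_prime psi_char) normc_nat mul1r -natrM.
    by case: (_ == _); case: (_ == _).
  have -> : \prod_j Mj j = M ^+ #|u| by rewrite /Mj -big_mkcond/= prodr_const.
  by rewrite exprAC sqr_sqrtr.
have QQ : 0 <= \sum_u a u ^+ 2 by apply: sumr_ge0 => u _; rewrite exprn_ge0.
apply: (@le_trans _ _ (\sum_u a u ^+ 2)); last exact: sum_sqr_le.
apply: (@le_trans _ _ (rkhs_dot H f f * \sum_u a u ^+ 2)).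
  by rewrite ler_wpM2l// rkhs_dot_ge0.
by rewrite ler_piMl.
Qed.

(** The signed measure comparing the truncated points with the uniform distribution on the digit
    grid; L is [R] in the error and [R[i]] in its Walsh transform. *)
Definition net_weight (L : fieldType) N (P : seq ('I_s -> digitseq b))
    (x : {ffun 'I_s -> N.-tuple F}) : L :=
  (\sum_(z <- P) (x == [ffun j => trunc N (z j)])%:R) / (size P)%:R -
  ((b ^ N) ^ s)%:R^-1.

Lemma sum_net_weight (L : fieldType) N P (phi : {ffun 'I_s -> N.-tuple F} -> L) :
  \sum_x net_weight L P x * phi x =
  (\sum_(z <- P) phi [ffun j => trunc N (z j)]) / (size P)%:R -
  (\sum_x phi x) / ((b ^ N) ^ s)%:R.
Proof.
under eq_bigr do rewrite mulrBl.
rewrite sumrB; congr (_ - _); last first.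
  by rewrite mulr_suml; apply: eq_bigr => x _; rewrite mulrC.
under eq_bigr do rewrite mulrAC mulr_suml.
rewrite -mulr_suml exchange_big/=; congr (_ / _); apply: eq_bigr => z _.
rewrite (bigD1 [ffun j => trunc N (z j)])//= eqxx mul1r big1 ?addr0// => x xz.
by rewrite (negbTE xz) mul0r.
Qed.

Variables (m n : nat) (p : {poly F}).

Definition net_dual N (q : {ffun 'I_s -> 'rV[F]_n}) (k : {ffun 'I_s -> N.-tuple F}) :=
  (\sum_j \sum_(i < N) (rev (k j))`_i == 0) &&
  in_dual m p (fun j i => (rev (k j))`_i) q.

Lemma walsh_transform_net_weight N (q : {ffun 'I_s -> 'rV[F]_n})
    (k : {ffun 'I_s -> N.-tuple F}) : (n <= N)%N ->
  normc (walsh_transform psi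
    (net_weight R (antithetic (ho_poly_lattice m n p (rV_family q)))) k)
  <= ((k != fzero b s N) && net_dual q k)%:R.
Proof.
move=> nN; set P := antithetic _.
have sP : size P = (b * b ^ m)%N by exact: size_antithetic_lattice.
have b0 := prime_gt0 b_prime.
have sP0 : (size P)%:R != 0 :> R[i].
  by rewrite pnatr_eq0 sP muln_eq0 expn_eq0 !gtn_eqF.
have -> : walsh_transform psi (net_weight R P) k =
    \sum_(x : {ffun 'I_s -> N.-tuple F}) net_weight R[i] P x * psi (fdot k x).
  apply: eq_bigr => x _; congr (_ * _).
  rewrite /net_weight rmorphB fmorph_div fmorphV !rmorph_nat rmorph_sum/=.
  by congr (_ / _ - _); apply: eq_bigr => z _; rewrite rmorph_nat.
rewrite sum_net_weight (sum_psi_fdot b_prime psi_char).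
(* The constant Walsh function is integrated exactly: both averages are 1. *)
have [->|k0] := eqVneq k (fzero b s N).
  rewrite (eq_bigr (fun=> 1)) => [|z _]; last first.
    rewrite /fdot big1 ?(psi0 psi_char)// => j _.
    by rewrite ffunE dotC dot_zdigits.
  rewrite big_const_seq count_predT iter_addr_0 divff//.
  rewrite divff ?subrr ?normc0//.
  by rewrite pnatr_eq0 !expn_eq0 gtn_eqF.
rewrite mul0r subr0 (eq_bigr (fun z => psi (\sum_j dot (k j) (trunc N (z j))))); last first.
  by move=> z _; rewrite /fdot; congr psi; apply: eq_bigr => j _; rewrite ffunE.
rewrite (lattice_walsh_sum b_prime psi_char)//= -/(in_dual m p _ q) -/(net_dual q k).
case: ifP => _; last by rewrite mul0r normc0.
by rewrite -sP divff// normc1.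
Qed.

End LatticeError.

(** * Averaging over the generating vectors *)

Section PowRSums.
Variable R : realType.

(** With S = x + y, the ratios x / S and y / S lie in [0, 1], where t <= t^lambda; multiply by
    S^lambda and add. *)
Lemma powRD_le (x y lambda : R) : 0 <= x -> 0 <= y -> 0 < lambda <= 1 ->
  (x + y) `^ lambda <= x `^ lambda + y `^ lambda.
Proof.
move=> x0 y0 /andP[l0 l1]; have [xy0|xy0] := eqVneq (x + y) 0.
  by rewrite xy0 powR0 ?gt_eqF// addr_ge0 ?powR_ge0.
have S0 : 0 < x + y by rewrite lt0r xy0 addr_ge0.
have part z : 0 <= z -> z <= x + y -> z / (x + y) * (x + y) `^ lambda <= z `^ lambda.
  move=> z0 zS; have [->|zn0] := eqVneq z 0; first by rewrite !mul0r powR_ge0.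
  have zp : 0 < z by rewrite lt0r zn0.
  have t0 : 0 < z / (x + y) by rewrite divr_gt0.
  have -> : z `^ lambda = (z / (x + y)) `^ lambda * (x + y) `^ lambda.
    by rewrite -powRM ?(ltW t0) ?(ltW S0)// divfK// gt_eqF.
  rewrite ler_wpM2r ?powR_ge0//.
  have t1 : z / (x + y) <= 1 by rewrite ler_pdivrMr// mul1r.
  have iv : 1 <= (z / (x + y))^-1 by rewrite invf_ge1.
  have := ler1_powR iv l1; move: (z / (x + y)) t0 => t t0.
  rewrite -(powR_inv1 (ltW t0)) -powRrM mulN1r powRN (powR_inv1 (ltW t0)).
  by rewrite lef_pV2// posrE powR_gt0.
apply: le_trans (lerD (part x x0 _) (part y y0 _)); rewrite ?lerDl ?lerDr//.
by rewrite -mulrDl -mulrDl divff ?mul1r// gt_eqF.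
Qed.

Lemma powR_sum_le (I : Type) (r : seq I) (a : I -> R) (lambda : R) :
  0 < lambda <= 1 -> (forall i, 0 <= a i) ->
  (\sum_(i <- r) a i) `^ lambda <= \sum_(i <- r) a i `^ lambda.
Proof.
move=> l a0; elim: r => [|i r IH].
  by rewrite !big_nil powR0// gt_eqF//; case/andP: l.
rewrite !big_cons; apply: le_trans (powRD_le (a0 i) _ l) _; first exact: sumr_ge0.
by rewrite lerD2l.
Qed.

Lemma powR_prod (I : Type) (r : seq I) (a : I -> R) (lambda : R) :
  (forall i, 0 <= a i) ->
  (\prod_(i <- r) a i) `^ lambda = \prod_(i <- r) a i `^ lambda.
Proof.
move=> a0; elim: r => [|i r IH]; first by rewrite !big_nil powR1.
by rewrite !big_cons powRM ?prodr_ge0// IH.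
Qed.

Lemma powR_bool (c : bool) (lambda : R) : 0 < lambda -> c%:R `^ lambda = c%:R :> R.
Proof. by case: c => l0; rewrite ?powR1// powR0// gt_eqF. Qed.

End PowRSums.

Section DigitSums.
Variables (b : nat).
Local Notation F := 'F_b.

Lemma sum_rev_digits N (k : N.-tuple F) : \sum_(i < N) (rev k)`_i = \sum_(c <- k) c.
Proof.
transitivity (\sum_(c <- rev k) c); last by apply: perm_big; rewrite perm_rev.
by rewrite (big_nth 0) big_mkord size_rev size_tuple.
Qed.

Lemma count0_digits (k : seq F) : count (fun c => c != 0) k = 0%N ->
  k = nseq (size k) 0.
Proof.
move=> h; apply/all_pred1P; apply: contraTT isT => /allPn[c ck c0].
by move/eqP: h; rewrite -leqn0 leqNgt -has_count => /hasPn/(_ c ck); rewrite c0.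
Qed.

Lemma sum_one_digit (k : seq F) : count (fun c => c != 0) k = 1%N ->
  \sum_(c <- k) c != 0.
Proof.
elim: k => [//|c k IH] /=; rewrite big_cons.
have [->|c0] /= := eqVneq c 0; first by rewrite add0n add0r.
move=> [] /count0_digits ->; rewrite big_nseq.
rewrite (_ : iter _ _ _ = 0) ?addr0//.
by elim: (size k) => //= i ->; rewrite addr0.
Qed.

(** A single non-zero digit cannot sum to zero, so there are at least two. As alpha >= 2, the cut at
    alpha keeps two of them, in one component or in different ones. *)
Lemma nsel_sum_ge2 alpha s N (k : {ffun 'I_s -> N.-tuple F}) : (2 <= alpha)%N ->
  k != fzero b s N -> \sum_j \sum_(i < N) (rev (k j))`_i == 0 ->
  (2 <= \sum_j nsel alpha (k j))%N.
Proof.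
move=> a2 k0 dk; rewrite leqNgt; apply/negP => lt2.
have [j0 j0k] : exists j, k j != zdigits b N.
  apply/existsP; apply: contraNT k0; rewrite negb_exists => /forallP h.
  by apply/eqP/ffunP => j; rewrite ffunE; apply/eqP; move: (h j); rewrite negbK.
have cnt_eq0 (t : N.-tuple F) : nsel alpha t = 0%N -> t = zdigits b N.
  rewrite nsel_count => h; have {}h : count (fun c => c != 0) t = 0%N by lia.
  by apply: val_inj; rewrite /= (count0_digits h) size_tuple.
have n0 : (0 < nsel alpha (k j0))%N.
  by rewrite lt0n; apply: contraNneq j0k => /cnt_eq0 ->.
move: lt2; rewrite (bigD1 j0)//= => lt2.
have others j : j != j0 -> k j = zdigits b N.
  move=> jj0; apply: cnt_eq0; move: lt2; rewrite (bigD1 j)//=; lia.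
have c1 : count (fun c => c != 0) (k j0) = 1%N.
  have : nsel alpha (k j0) = 1%N by lia.
  rewrite nsel_count; lia.
move: dk; rewrite (bigD1 j0)//= [X in _ + X]big1 ?addr0.
  by rewrite sum_rev_digits; apply/negP/sum_one_digit.
move=> j jj0; rewrite others// sum_rev_digits /= big_nseq.
by elim: (N) => //= i ->; rewrite addr0.
Qed.

Lemma tail_zeroPn M n (k : (M + n).-tuple F) : ~~ tail_zero M k ->
  exists2 i, (i < n)%N & (rev k)`_i != 0.
Proof.
move=> /allPn[c /(nthP 0)[e]]; rewrite size_drop size_tuple addKn => elt.
rewrite nth_drop => <- c0; exists (n.-1 - e)%N; first by lia.
rewrite nth_rev size_tuple; last by lia.
by rewrite (_ : (M + n - (n.-1 - e).+1 = M + e)%N)//; lia.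
Qed.

End DigitSums.

Section Averaging.
Variables (R : realType) (b : nat) (b_prime : prime b).
Variables (alpha s m n : nat) (alpha2 : (2 <= alpha)%N) (mn : (m <= n)%N).
Local Notation F := 'F_b.
Variables (p : {poly F}) (irp : irreducible_poly p) (sp : size p = n.+1).
Variables (lambda A : R) (lambda01 : 0 < lambda <= 1).
Hypothesis dw_sum_le : forall i M, dw_sum b lambda i alpha M <= A.
Variable M : nat.
Local Notation X := {ffun 'I_s -> (M + n).-tuple F}.
Local Notation Q := {ffun 'I_s -> 'rV[F]_n}.

Let l0 : 0 < lambda. Proof. by case/andP: lambda01. Qed.
Let b0 : 0 < b%:R :> R. Proof. exact: base_gt0. Qed.

Lemma sum_dw_le N : \sum_(t : N.-tuple F) dw R alpha t `^ lambda <= A.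
Proof.
have cast N' : N' = N -> \sum_(t : N.-tuple F) dw R alpha t `^ lambda =
    \sum_(t : N'.-tuple F) dw R alpha t `^ lambda by move=> ->.
rewrite (cast _ (addn0 N)); apply: le_trans (dw_sum_le 0 N).
rewrite /dw_sum [leRHS]big_mkcond/=; apply: ler_sum => t _.
by rewrite /tail_zero drop_oversize ?size_tuple ?addn0//= /scaled_dw expn0 expr1n mul1r.
Qed.

Lemma prod_weights (u : {set 'I_s}) (f : 'I_s -> R) :
  (forall j, 0 <= f j) -> (forall j, j \in u -> f j <= A) ->
  (forall j, j \notin u -> f j <= 1) -> \prod_j f j <= A ^+ #|u|.
Proof.
move=> f0 fu fnu.
have -> : A ^+ #|u| = \prod_j (if j \in u then A else 1).
  by rewrite -big_mkcond/= prodr_const.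
apply: ler_prod => j _; rewrite f0/=.
by case: ifPn => ju; [exact: fu|exact: fnu].
Qed.

Lemma sum_is_zdigits N : \sum_(t : N.-tuple F) (t == zdigits b N)%:R = 1 :> R.
Proof.
rewrite (bigD1 (zdigits b N))//= eqxx big1 ?addr0// => t tz.
by rewrite (negbTE tz).
Qed.

Lemma sum_dual_weight_le (u : {set 'I_s}) :
  \sum_(k : X) dual_weight R alpha u k `^ lambda <= A ^+ #|u|.
Proof.
pose f (j : 'I_s) (t : (M + n).-tuple F) : R :=
  if j \in u then dw R alpha t `^ lambda else (t == zdigits b (M + n))%:R.
have fE (k : X) : dual_weight R alpha u k `^ lambda = \prod_j f j (k j).
  rewrite powR_prod => [|j]; last by case: ifP => // _; exact: dw_ge0.
  by apply: eq_bigr => j _; rewrite /f; case: ifP => // _; rewrite powR_bool.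
under eq_bigr do rewrite fE.
rewrite -(bigA_distr_bigA f); apply: prod_weights => j.
- by apply: sumr_ge0 => t _; rewrite /f; case: ifP => // _; exact: powR_ge0.
- by rewrite /f => ->; exact: sum_dw_le.
- by rewrite /f => /negbTE ->; rewrite sum_is_zdigits.
Qed.

Definition deep_digits (k : X) := [forall j, tail_zero M (k j)].

Definition digit_sum0 (k : X) := \sum_j \sum_(i < M + n) (rev (k j))`_i == 0.

(** Every selected digit gains b^-n over its rescaled weight, and [nsel_sum_ge2] provides two; the
    rescaled weights have sums bounded independently of n. *)
Lemma sum_deep_dual_weight_le (u : {set 'I_s}) :
  \sum_(k : X | [&& deep_digits k, k != fzero b s (M + n) & digit_sum0 k])
     dual_weight R alpha u k `^ lambda
  <= ((b ^ n)%:R ^- 2) `^ lambda * A ^+ #|u|.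
Proof.
have bn0 : (0 : R) < (b ^ n)%:R by rewrite ltr0n expn_gt0 prime_gt0.
have bn1 : (1 : R) <= (b ^ n)%:R by rewrite ler1n expn_gt0 prime_gt0.
pose sc (j : 'I_s) (t : (M + n).-tuple F) : R :=
  if j \in u then scaled_dw R n alpha t else (t == zdigits b (M + n))%:R.
have sc0 j t : 0 <= sc j t by rewrite /sc; case: ifP => // _; exact: scaled_dw_ge0.
pose f (j : 'I_s) (t : (M + n).-tuple F) : R :=
  if tail_zero M t then sc j t `^ lambda else 0.
have nselz : nsel alpha (zdigits b (M + n)) = 0%N.
  rewrite nsel_count; suff -> : count (fun c : F => c != 0) (zdigits b (M + n)) = 0%N by rewrite minn0.
  by rewrite /= count_nseq eqxx.
have scE (k : X) : \prod_j sc j (k j) =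
    (b ^ n)%:R ^+ (\sum_j nsel alpha (k j)) * dual_weight R alpha u k.
  rewrite -prodrXr -big_split/=; apply: eq_bigr => j _; rewrite /sc.
  case: ifP => // _; case: eqP => [->|_]; last by rewrite mulr0.
  by rewrite nselz expr0 mul1r.
have pw (k : X) : [&& deep_digits k, k != fzero b s (M + n) & digit_sum0 k] ->
    dual_weight R alpha u k `^ lambda <=
    ((b ^ n)%:R ^- 2) `^ lambda * \prod_j f j (k j).
  move=> /and3P[/forallP dk k0 sk].
  have -> : \prod_j f j (k j) = (\prod_j sc j (k j)) `^ lambda.
    by rewrite powR_prod//; apply: eq_bigr => j _; rewrite /f dk.
  rewrite -powRM ?invr_ge0 ?exprn_ge0 ?prodr_ge0//.
  rewrite ge0_ler_powR ?nnegrE ?(ltW l0) ?dual_weight_ge0//.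
    by rewrite mulr_ge0 ?invr_ge0 ?exprn_ge0 ?prodr_ge0.
  rewrite scE mulrA ler_peMl ?dual_weight_ge0//.
  rewrite mulrC ler_pdivlMr ?exprn_gt0// mul1r.
  by apply: ler_weXn2l => //; exact: nsel_sum_ge2.
apply: le_trans (_ : _ <= \sum_(k : X) ((b ^ n)%:R ^- 2) `^ lambda * \prod_j f j (k j)) _.
  rewrite big_mkcond/=; apply: ler_sum => k _; case: ifP => [/pw//|_].
  rewrite mulr_ge0 ?powR_ge0// prodr_ge0// => j _.
  by rewrite /f; case: ifP => // _; exact: powR_ge0.
rewrite -mulr_sumr ler_wpM2l ?powR_ge0// -(bigA_distr_bigA f).
apply: prod_weights => j.
- by apply: sumr_ge0 => t _; rewrite /f; case: ifP => // _; exact: powR_ge0.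
- move=> ju; apply: le_trans (dw_sum_le n M).
  by rewrite /dw_sum [leRHS]big_mkcond/= /f /sc ju.
- move=> /negbTE ju; rewrite -(sum_is_zdigits (M + n)); apply: ler_sum => t _.
  by rewrite /f /sc ju; case: ifP => _; rewrite ?powR_bool.
Qed.

Definition dual_indicator (q : Q) (k : X) : R :=
  ((k != fzero b s (M + n)) && net_dual m p q k)%:R.

Lemma sum_dual_indicator (k : X) : \sum_q dual_indicator q k <=
  #|{: Q}|%:R * ((b ^ m)%:R^-1 +
    [&& deep_digits k, k != fzero b s (M + n) & digit_sum0 k]%:R).
Proof.
have Q0 : (0 : R) <= #|{: Q}|%:R by [].
have bm0 : (0 : R) < (b ^ m)%:R by rewrite ltr0n expn_gt0 prime_gt0.
have [/andP[k0 sk]|] := boolP ((k != fzero b s (M + n)) && digit_sum0 k); last first.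
  move=> h; rewrite big1 => [|q _].
    by rewrite mulr_ge0// addr_ge0// invr_ge0.
  rewrite /dual_indicator /net_dual -/(digit_sum0 k) andbA (negbTE h)//.
have [dk|dk] := boolP (deep_digits k); rewrite ?k0 ?sk /=.
  apply: (@le_trans _ _ (\sum_(q : Q) 1)).
    by apply: ler_sum => q _; rewrite /dual_indicator lern1 leq_b1.
  by rewrite sumr_const -[leLHS]mulr_natl ler_wpM2l// lerDr invr_ge0.
rewrite addr0 ler_pdivlMr//.
pose c (j : 'I_s) (i : nat) : F := (rev (k j))`_i.
have [j kj] : exists j, ~~ tail_zero M (k j) by apply/existsP; rewrite -negb_forall.
have [i ilt ci] := tail_zeroPn kj.
have := card_in_dual b_prime mn irp sp (c := c) (ex_intro _ j (ex_intro2 _ _ i ilt ci)).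
rewrite -(ler_nat R) natrM; apply: le_trans; rewrite ler_wpM2r ?(ltW bm0)//.
rewrite -sum1_card natr_sum [leRHS]big_mkcond/=; apply: ler_sum => q _.
rewrite /dual_indicator /net_dual k0 -/(digit_sum0 k) sk/=.
by rewrite unfold_in -/(c) ; case: ifP.
Qed.

(** Removes the empty set from the bound: constants are integrated without error. *)
Lemma dual_weight_set0 (k : X) : k != fzero b s (M + n) ->
  dual_weight R alpha finset.set0 k = 0.
Proof.
move=> k0; have [j kj] : exists j, k j != zdigits b (M + n).
  apply/existsP; apply: contraNT k0; rewrite negb_exists => /forallP h.
  by apply/eqP/ffunP => j; rewrite ffunE; apply/eqP; move: (h j); rewrite negbK.
by rewrite /dual_weight (bigD1 j)//= inE (negbTE kj) mul0r.
Qed.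

(** Subadditivity is used over u and then over k. The power does not change the indicator, so the
    sum over q acts on it alone. *)
Lemma sum_error_bound (c : {set 'I_s} -> R) : (forall u, 0 <= c u) ->
  \sum_(q : Q) (\sum_u c u * \sum_k dual_indicator q k * dual_weight R alpha u k) `^ lambda
  <= #|{: Q}|%:R * (((b ^ m)%:R^-1 + ((b ^ n)%:R ^- 2) `^ lambda) *
       \sum_(u : {set 'I_s} | u != finset.set0) c u `^ lambda * A ^+ #|u|).
Proof.
move=> c0.
have ind0 q k : 0 <= dual_indicator q k by rewrite /dual_indicator.
have w0 u (k : X) : 0 <= dual_weight R alpha u k by exact: dual_weight_ge0.
have inner0 q u : 0 <= \sum_(k : X) dual_indicator q k * dual_weight R alpha u k.
  by apply: sumr_ge0 => k _; rewrite mulr_ge0.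
pose W u := \sum_(q : Q) \sum_(k : X) dual_indicator q k * dual_weight R alpha u k `^ lambda.
apply: (@le_trans _ _ (\sum_u c u `^ lambda * W u)).
  rewrite /W; under [leRHS]eq_bigr do rewrite mulr_sumr.
  rewrite [leRHS]exchange_big/=; apply: ler_sum => q _.
  apply: le_trans (powR_sum_le _ lambda01 _) _ => [u|]; first by rewrite mulr_ge0.
  apply: ler_sum => u _; rewrite powRM// ler_wpM2l ?powR_ge0//.
  apply: le_trans (powR_sum_le _ lambda01 _) _ => [k|]; first by rewrite mulr_ge0.
  by apply: ler_sum => k _; rewrite powRM// /dual_indicator powR_bool.
rewrite (bigD1 finset.set0)//= {1}/W big1 ?mulr0 ?add0r; last first.
  move=> q _; apply: big1 => k _; rewrite /dual_indicator.
  have [->|k0] := eqVneq k (fzero b s (M + n)); first by rewrite mul0r.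
  by rewrite dual_weight_set0// powR0 ?mulr0// gt_eqF.
rewrite mulrA mulr_sumr; apply: ler_sum => u _.
rewrite mulrCA ler_wpM2l ?powR_ge0//.
rewrite /W exchange_big/=.
apply: (@le_trans _ _ (\sum_(k : X) #|{: Q}|%:R * ((b ^ m)%:R^-1 +
    [&& deep_digits k, k != fzero b s (M + n) & digit_sum0 k]%:R) *
    dual_weight R alpha u k `^ lambda)).
  apply: ler_sum => k _; rewrite -mulr_suml ler_wpM2r ?powR_ge0//.
  exact: sum_dual_indicator.
under eq_bigr do rewrite -mulrA mulrDl.
rewrite -mulr_sumr big_split/= -mulr_sumr -mulrA ler_wpM2l// mulrDl lerD//.
  by rewrite ler_wpM2l ?invr_ge0// sum_dual_weight_le.
apply: le_trans (sum_deep_dual_weight_le u).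
rewrite [leRHS]big_mkcond/=; apply: ler_sum => k _.
by case: ifP => _; rewrite ?mul1r ?mul0r.
Qed.

End Averaging.

(** * One generating vector for all functions and exponents *)

Section ErrorBound.
Variables (R : realType) (b : nat) (b_prime : prime b).
Local Notation F := 'F_b.

Lemma cvg_frequently_le (u : nat -> R) (l B : R) : u n @[n --> \oo] --> l ->
  (forall N, exists2 n, (N <= n)%N & `|u n| <= B) -> `|l| <= B.
Proof.
move=> ul ub; rewrite leNgt; apply/negP => lB.
have /cvgrPdist_lt/(_ (`|l| - B)) := ul.
rewrite subr_gt0 => /(_ lB)[N _ hN].
have [n Nn un] := ub N; have := hN n Nn => /= h.
have := lerB_dist l (u n); lra.
Qed.

Lemma frequent_value (T : finType) (g : nat -> T) :
  exists t, forall N, exists2 n, (N <= n)%N & g n = t.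
Proof.
apply: contrapT => h.
have {}h t : exists N, forall n, (N <= n)%N -> g n <> t.
  apply: contrapT => ht; apply: h; exists t => N; apply: contrapT => hN.
  by apply: ht; exists N => n Nn gt; apply: hN; exists n.
have [B hB] := choice h.
(* Beyond all thresholds at once, no value is left for [g N]. *)
pose N := \max_(t : T) B t.
exact: (hB (g N) N (leq_bigmax (g N))).
Qed.

Section Lattice.
Variables (alpha s m n : nat) (gamma : {set 'I_s} -> R).
Variables (H : rkhs (sobolev_kernel alpha gamma)) (p : {poly F}).
Local Notation Q := {ffun 'I_s -> 'rV[F]_n}.

Definition lattice_points (q : Q) := antithetic (ho_poly_lattice m n p (rV_family q)).

(** The number of digits is written M + n: it is never below n and splits as [tail_zero]
    requires. *)
Definition truncated_error (q : Q) (f : cube R s -> R) (M : nat) : R :=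
  \sum_(x : {ffun 'I_s -> (M + n).-tuple F})
    net_weight R (lattice_points q) x * f (digit_cube R b_prime x).

Lemma truncated_error_cvg (q : Q) f : rkhs_dom H f ->
  truncated_error q f M @[M --> \oo] -->
  cube_qmc [seq net_proj R z | z <- lattice_points q] f - cube_int f.
Proof.
move=> df; set P := lattice_points q.
pose v N : R := (\sum_(z <- P) f (digit_cube R b_prime (fun j => trunc N (z j)))) /
  (size P)%:R - (\sum_(x : {ffun 'I_s -> N.-tuple F}) f (digit_cube R b_prime x)) /
  ((b ^ N) ^ s)%:R.
have vcv : v N @[N --> \oo] -->
    cube_qmc [seq net_proj R z | z <- P] f - cube_int f.
  apply: cvgB; last exact: digit_average_cvg df.
  rewrite /cube_qmc size_map big_map; apply: cvgM; last exact: cvg_cst.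
  by apply: cvg_bigsum => z; exact: digit_cube_cvg df.
have E M : truncated_error q f M = v (M + n)%N.
  rewrite /truncated_error sum_net_weight /v; congr (_ / _ - _).
  apply: eq_bigr => z _; congr f; apply: val_inj; apply: eq_from_tnth => j.
  by rewrite /= !tnth_mktuple ffunE.
under eq_cvg do rewrite E.
exact: cvg_comp (cvg_addnr n) vcv.
Qed.



Lemma cube_error_le (q : Q) f (B : R) : rkhs_dom H f ->
  (forall M0, exists2 M, (M0 <= M)%N & `|truncated_error q f M| <= B) ->
  `|cube_qmc [seq net_proj R z | z <- lattice_points q] f - cube_int f| <= B.
Proof. by move=> df hB; exact: (cvg_frequently_le (truncated_error_cvg df) hB). Qed.

Variables (psi : F -> R[i]) (psi_char : add_char psi) (D : R).
Hypotheses (D0 : 0 < D) (decay : forall n (k l : n.-tuple F),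
  normc (wcoef2 psi (fun x y : n.-tuple F =>
    (sobolev_kernel1 alpha (rval R x) (rval R y))%:C%C) k l)
  <= D * (dw R alpha k * dw R alpha l)).
Hypotheses (gamma0 : forall u, 0 <= gamma u).

(** Contains neither f nor lambda, so one minimiser over q serves them all. *)
Definition dual_error (M : nat) (q : Q) : R :=
  \sum_u (Num.sqrt (gamma u) * Num.sqrt D ^+ #|u|) *
    \sum_(k : {ffun 'I_s -> (M + n).-tuple F})
      dual_indicator R m p q k * dual_weight R alpha u k.

Lemma truncated_error_le (q : Q) f M : rkhs_dom H f -> rkhs_norm H f <= 1 ->
  `|truncated_error q f M| <= dual_error M q.
Proof.
move=> df f1.
have {}f1 : rkhs_dot H f f <= 1.
  by rewrite -(sqr_sqrtr (rkhs_dot_ge0 df)) exprn_ile1// sqrtr_ge0.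
apply: le_trans (rkhs_walsh_bound b_prime psi_char (ltW D0) decay _ gamma0 df f1) _.
apply: ler_sum => u _; rewrite ler_wpM2l ?mulr_ge0 ?exprn_ge0 ?sqrtr_ge0//.
apply: ler_sum => k _; rewrite ler_wpM2r ?dual_weight_ge0//.
by apply: (walsh_transform_net_weight b_prime psi_char m p q k); rewrite leq_addl.
Qed.

Hypotheses (alpha2 : (2 <= alpha)%N) (mn : (m <= n)%N).
Hypotheses (irp : irreducible_poly p) (sp : size p = n.+1).

(** The lambda-th power of a minimum is at most the average of the lambda-th powers. *)
Lemma dual_error_min (M : nat) (q : Q) (lambda A : R) :
  (forall q', dual_error M q <= dual_error M q') ->
  0 < lambda <= 1 -> 1 <= A ->
  (forall i N, dw_sum b lambda i alpha N <= A) ->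
  dual_error M q <= 1 / b%:R `^ Num.min (m%:R / lambda) (2 * n%:R) *
    (\sum_(u : {set 'I_s} | u != finset.set0)
       gamma u `^ (lambda / 2) * (2 * Num.sqrt D `^ lambda * A) ^+ #|u|) `^ lambda^-1.
Proof.
move=> qmin lambda01 A1 hA; have /andP[l0 l1] := lambda01.
have b0 : 0 < b%:R :> R by exact: base_gt0.
have b1 : 1 <= b%:R :> R by exact: base_ge1.
set theta := Num.min _ _; set S := \sum_(u | _) _.
pose c (u : {set 'I_s}) := Num.sqrt (gamma u) * Num.sqrt D ^+ #|u|.
have c0 u : 0 <= c u by rewrite mulr_ge0 ?exprn_ge0 ?sqrtr_ge0.
have e0 q' : 0 <= dual_error M q'.
  apply: sumr_ge0 => u _; rewrite mulr_ge0 ?c0// sumr_ge0// => k _.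
  by rewrite mulr_ge0 ?dual_weight_ge0.
have Q0 : (0 : R) < #|{: Q}|%:R by rewrite ltr0n; apply/card_gt0P; exists q.
have avg := sum_error_bound b_prime alpha2 mn irp sp lambda01 hA M c0.
have {avg}main : dual_error M q `^ lambda <=
    ((b ^ m)%:R^-1 + ((b ^ n)%:R ^- 2) `^ lambda) *
       \sum_(u : {set 'I_s} | u != finset.set0) c u `^ lambda * A ^+ #|u|.
  rewrite -(ler_pM2l Q0); apply: le_trans avg.
  rewrite mulr_natl -sumr_const; apply: ler_sum => q' _.
  by rewrite ge0_ler_powR ?nnegrE ?(ltW l0)// ?e0//; exact: qmin.
(* theta * lambda is the smaller of m and 2 n lambda, so t dominates both terms. The factor 2 for
   their sum goes into the constant, as 2 <= 2^|u| for non-empty u. *)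
pose t := b%:R `^ (- theta * lambda) : R.
have t1 : (b ^ m)%:R^-1 <= t.
  rewrite natrX -(powR_mulrn _ (ltW b0)) -powRN /t ler_powR//.
  by rewrite mulNr lerN2 -ler_pdivlMr// /theta ge_min lexx.
have t2 : ((b ^ n)%:R ^- 2) `^ lambda <= t.
  rewrite natrX -exprM -(powR_mulrn _ (ltW b0)) -powRN -powRrM /t ler_powR//.
  have -> : (n * 2)%N%:R = 2 * n%:R :> R by rewrite natrM mulrC.
  by rewrite !mulNr lerN2 ler_pM2r// /theta ge_min lexx orbT.
have cS : \sum_(u : {set 'I_s} | u != finset.set0) 2 * (c u `^ lambda * A ^+ #|u|) <= S.
  apply: ler_sum => u u0.
  have cE : c u `^ lambda = gamma u `^ (lambda / 2) * (Num.sqrt D `^ lambda) ^+ #|u|.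
    rewrite /c powRM ?exprn_ge0 ?sqrtr_ge0// powR_expn ?sqrtr_ge0//.
    by rewrite -(powR12_sqrt (gamma0 u)) -powRrM [2^-1 * _]mulrC.
  have u1 : (0 < #|u|)%N by rewrite card_gt0.
  have h : 2 <= 2 ^+ #|u| :> R by rewrite -[leLHS]expr1 ler_weXn2l// ler1n.
  rewrite cE !exprMn; set x := _ `^ (lambda / 2); set y := _ ^+ #|u|; set z := A ^+ _.
  have -> : x * (2 ^+ #|u| * y * z) = 2 ^+ #|u| * (x * y * z) by ring.
  by rewrite ler_wpM2r// !mulr_ge0 ?exprn_ge0 ?powR_ge0// (le_trans ler01).
have {}main : dual_error M q `^ lambda <= t * S.
  apply: le_trans main _.
  apply: (@le_trans _ _ (t * \sum_(u : {set 'I_s} | u != finset.set0)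
      2 * (c u `^ lambda * A ^+ #|u|))).
    rewrite -mulr_sumr mulrA; apply: ler_wpM2r; last by lra.
    by apply: sumr_ge0 => u _; rewrite mulr_ge0 ?powR_ge0 ?exprn_ge0// (le_trans ler01).
  by rewrite ler_wpM2l// powR_ge0.
have -> : 1 / b%:R `^ theta = t `^ lambda^-1.
  by rewrite /t -powRrM mulfK ?gt_eqF// div1r powRN.
have S0 : 0 <= S.
  apply: sumr_ge0 => u _; rewrite mulr_ge0 ?powR_ge0 ?exprn_ge0 ?mulr_ge0 ?powR_ge0//.
  exact: le_trans ler01 A1.
rewrite -powRM ?powR_ge0//.
rewrite -[leLHS](powRr1 (e0 q)) -(divff (lt0r_neq0 l0)) powRrM.
by rewrite ge0_ler_powR ?nnegrE ?invr_ge0 ?(ltW l0) ?powR_ge0// mulr_ge0 ?powR_ge0.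
Qed.

End Lattice.
End ErrorBound.

Theorem theorem3 (R : realType) (b : nat) (b_prime : prime b) :
  exists C : nat -> R -> R,
    (forall (alpha : nat) (lambda : R), (2 <= alpha)%N ->
       alpha%:R^-1 < lambda <= 1 -> 0 < C alpha lambda) /\
    forall (alpha s : nat) (gamma : {set 'I_s} -> R)
           (H : rkhs (sobolev_kernel alpha gamma))
           (m n : nat) (p : {poly 'F_b}),
      (2 <= alpha)%N -> (1 <= s)%N -> (forall u, 0 <= gamma u) ->
      (1 <= m <= n)%N -> irreducible_poly p -> size p = n.+1 ->
      exists q : 'I_s -> {poly 'F_b},
        (forall j, (size (q j) <= n)%N) /\
        forall lambda : R, alpha%:R^-1 < lambda <= 1 ->
          (worst_case_error H
             [seq net_proj R z | z <- antithetic (ho_poly_lattice m n p q)]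
           <= (1 / b%:R `^ Num.min (m%:R / lambda) (2 * n%:R) *
               (\sum_(u : {set 'I_s} | u != finset.set0)
                  gamma u `^ (lambda / 2) * C alpha lambda ^+ #|u|)
                 `^ lambda^-1)%:E)%E.
Proof.
have [psi psi_char] := exists_add_char R b_prime.
(* Constants are chosen before s, gamma and p appear. Adding 1 to M makes D, and with it C,
   positive. *)
have exD (alpha : nat) : exists D : R, 0 < D /\ ((0 < alpha)%N ->
    forall n (k l : n.-tuple 'F_b),
    normc (wcoef2 psi (fun x y : n.-tuple 'F_b =>
      (sobolev_kernel1 alpha (rval R x) (rval R y))%:C%C) k l)
    <= D * (dw R alpha k * dw R alpha l)).
  have [a0|a0] := posnP alpha; first by exists 1; split=> //; rewrite a0.
  have [M M0 hM] := walsh_decay_sobolev b_prime psi_char a0.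
  exists (M + 1); split=> [|_ n k l]; first by rewrite ltr_pwDr.
  apply: le_trans (hM n k l) _.
  by rewrite ler_wpM2r ?lerDl// mulr_ge0 ?dw_ge0.
have [D hD] := choice exD.
have exA (al : nat * R) : exists A : R, 1 <= A /\ ((0 < al.1)%N ->
    al.1%:R^-1 < al.2 -> forall n N, dw_sum b al.2 n al.1 N <= A).
  have [/andP[a0 la]|h] := pselect ((0 < al.1)%N && (al.1%:R^-1 < al.2)).
    by have [A A1 hA] := dw_sum_bounded b_prime a0 la; exists A.
  by exists 1; split=> // a0 la; case: h; rewrite a0 la.
have [A hA] := choice exA.
exists (fun alpha lambda => 2 * Num.sqrt (D alpha) `^ lambda * A (alpha, lambda)).
split=> [alpha lambda _ _|].
  rewrite !mulr_gt0 ?powR_gt0 ?sqrtr_gt0//; first by case: (hD alpha).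
  by apply: lt_le_trans ltr01 _; case: (hA (alpha, lambda)).
move=> alpha s gamma H m n p alpha2 _ gamma0 /andP[_ mn] irp sp.
have a0 : (0 < alpha)%N by apply: leq_trans alpha2.
have [D0 /(_ a0) decay] := hD alpha.
pose g M := [arg min_(q < (0 : {ffun 'I_s -> 'rV['F_b]_n}))
  dual_error alpha m gamma p (D alpha) M q]%O.
have gmin M (q : {ffun 'I_s -> 'rV['F_b]_n}) : dual_error alpha m gamma p (D alpha) M (g M) <=
    dual_error alpha m gamma p (D alpha) M q.
  by rewrite /g; case: arg_minP => // q0 _ h; exact: (h q isT).
have [q hq] := frequent_value g.
exists (rV_family q); split=> [j|lambda /andP[la l1]]; first exact: size_poly.
have l0 : 0 < lambda by rewrite (le_lt_trans _ la)// invr_ge0.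
have [A1 hA'] := hA (alpha, lambda).
apply: ge_ereal_sup => _ [f [df f1] <-]; rewrite lee_fin.
(* q is known to be minimal only for the recurring M; a limit is already bounded by a bound along
   these. *)
apply: (cube_error_le (b_prime := b_prime) df) => M0.
have [M MM0 gM] := hq M0; exists M => //.
apply: le_trans (truncated_error_le b_prime m p psi_char D0 decay gamma0 q M df f1) _.
apply: dual_error_min => //; first by rewrite -gM; exact: gmin.
- by rewrite l0.
- by move=> i N; exact: hA'.
Qed.
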